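(* Let $\mathcal{F}$ be a family of extrapolation pairs on $\mathbb{R}^n$. Suppose that $\mathbb{X}$ is a rearrangement invariant Banach function space over $(\mathbb{R}^n,dx)$ with upper Boyd index $q_{\mathbb{X}}<\infty$. Suppose that for some $p_0\in[1,\infty)$ and for every $w\in A_{p_0}$, $$\|f\|_{L^1(w)}\le \Psi\big([w]_{A_{p_0}}\big)\,\|g\|_{L^1(w)},\qquad (f,g)\in\mathcal{F},$$ where $\Psi:[1,\infty)\to[1,\infty)$ is an increasing function. Then for every weight $u$ with $u^{1-p_0'}\in A_1$ and for every $v\in A_1$, $$\|fu\|_{\mathbb{X}_v}\le 4\,\Psi\Big(2\,\|M_v\|_{\mathbb{X}_v'\to\mathbb{X}_v'}\,[u^{1-p_0'}]_{A_1}^{p_0-1}\,[v]_{A_1}\Big)\,\|gu\|_{\mathbb{X}_v},\qquad (f,g)\in\mathcal{F}.$$ Here, in the case $p_0=1$, $u$ is understood as the constant $1$ (and the factor $[u^{1-p_0'}]_{A_1}^{p_0-1}$ as $1$).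
   Context: Weights. A weight on $\mathbb{R}^n$ is a measurable $w$ with $0<w<\infty$ a.e.; $w(E)=\int_E w\,dx$; $\|f\|_{L^p(w)}=(\int|f|^p w\,dx)^{1/p}$. The Hardy–Littlewood maximal operator is $Mf(x)=\sup_{Q\ni x}\frac1{|Q|}\int_Q|f|\,dy$ (sup over cubes $Q\ni x$). For $1<p<\infty$, $w\in A_p$ if $[w]_{A_p}=\sup_Q\big(\frac1{|Q|}\int_Q w\big)\big(\frac1{|Q|}\int_Q w^{1-p'}\big)^{p-1}<\infty$, where $1/p+1/p'=1$; $w\in A_1$ if $[w]_{A_1}=\|Mw/w\|_{L^\infty}<\infty$. For a weight $v$, $M_vf(x)=\sup_{Q\ni x}\frac1{v(Q)}\int_Q|f|v\,dy$. A family of extrapolation pairs is a collection of pairs $(f,g)$ of nonnegative measurable functions on $\mathbb{R}^n$. Banach function spaces. Let $\mathbb{M}$ be the set of (classes of) measurable functions on $\mathbb{R}^n$. A function norm is a map $\|\cdot\|:\mathbb{M}\to[0,\infty]$ with: (1) $\|f\|=\||f|\|$, and $\|f\|=0$ iff $f=0$ a.e.; (2) $\|f+g\|\le\|f\|+\|g\|$; (3) $\|\lambda f\|=|\lambda|\|f\|$; (4) $|f|\le|g|$ a.e. implies $\|f\|\le\|g\|$; (5) $|f_j|\uparrow|f|$ a.e. implies $\|f_j\|\uparrow\|f\|$; (6) if $|E|<\infty$ then $\|\mathbf{1}_E\|<\infty$ and $\int_E|f|\,dx\le C_E\|f\|$. Then $\mathbb{X}=\{f:\|f\|<\infty\}$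 is a Banach function space (BFS) over $(\mathbb{R}^n,dx)$; functions not in $\mathbb{X}$ have norm $+\infty$. Its associate space $\mathbb{X}'$ has norm $\|f\|_{\mathbb{X}'}=\sup\{\int|fg|\,dx:\|g\|_{\mathbb{X}}\le1\}$. For a weight $v$, BFS over $(\mathbb{R}^n,v\,dx)$ and associate spaces are defined in the same way with $dx$ replaced by $v\,dx$. $\mathbb{X}$ is rearrangement invariant if $\|f\|_{\mathbb{X}}=\|g\|_{\mathbb{X}}$ whenever $f,g$ have the same distribution function $\lambda\mapsto|\{|f|>\lambda\}|$. By Luxemburg's theorem there is then a rearrangement invariant BFS $\overline{\mathbb{X}}$ over $[0,\infty)$ with $\|f\|_{\mathbb{X}}=\|f^*\|_{\overline{\mathbb{X}}}$, $f^*$ the decreasing rearrangement. For a weight $w$, put $w_f(\lambda)=w(\{|f|>\lambda\})$, $f_w^*(t)=\inf\{\lambda\ge0:w_f(\lambda)\le t\}$; $\mathbb{X}_w=\mathbb{X}(w)$ is the BFS over $(\mathbb{R}^n,w\,dx)$ with norm $\|f\|_{\mathbb{X}_w}=\|f_w^*\|_{\overline{\mathbb{X}}}$. Its associate space with respect to $w\,dx$, denoted $\mathbb{X}_w'$, coincides with $\mathbb{X}'(w)$. With $D_tf(s)=f(s/t)$ and $h_{\mathbb{X}}(t)=\sup\{\|D_tf\|_{\overline{\mathbb{X}}}:\|f\|_{\overline{\mathbb{X}}}\le1\}$, the upper Boyd index is $q_{\mathbb{X}}=\lim_{t\to0^+}\frac{\log t}{\log h_{\mathbb{X}}(t)}=\inf_{0<t<1}\frac{\log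 t}{\log h_{\mathbb{X}}(t)}\in[1,\infty]$. $\|M_v\|_{\mathbb{X}_v'\to\mathbb{X}_v'}$ is the operator norm of $M_v$ on $\mathbb{X}_v'$. *)

(* Defs.v *)
From HB Require Import structures.
From mathcomp Require Import all_boot all_order all_algebra.
From mathcomp Require Import all_classical all_reals all_analysis.
From mathcomp Require Import measurable_realfun ess_sup_inf.

Set Implicit Arguments.
Unset Strict Implicit.
Unset Printing Implicit Defensive.

Import Order.TTheory GRing.Theory Num.Theory.
Import numFieldNormedType.Exports.

Local Open Scope classical_set_scope.
Local Open Scope ring_scope.
Local Open Scope ereal_scope.

Notation Rn R n := (n.-tuple (measurableTypeR R)).

(** Lebesgue measure on R^n, by recursion on n: the measure on R^(n+1) is the
    product of the measure on R and the measure on R^n, transported along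
    (x, y) |-> x :: y. *)
Section lebesgue_cons.
Context {R : realType} {n : nat}
  (m : {sigma_finite_measure set (Rn R n) -> \bar R}).

Definition consRn (p : measurableTypeR R * Rn R n) : Rn R n.+1 :=
  [tuple of p.1 :: p.2].

Definition lebesgue_cons : set (Rn R n.+1) -> \bar R :=
  pushforward (@lebesgue_measure R \x m) consRn.

Let measurable_consRn : measurable_fun setT consRn.
Proof. exact: measurable_cons. Qed.

Let lebesgue_cons0 : lebesgue_cons set0 = 0.
Proof. by rewrite /lebesgue_cons /pushforward preimage_set0 measure0. Qed.

Let lebesgue_cons_ge0 A : 0 <= lebesgue_cons A.
Proof. exact: measure_ge0. Qed.

Let lebesgue_cons_sigma_additive : semi_sigma_additive lebesgue_cons.
Proof.
move=> F mF tF mUF; rewrite /lebesgue_cons /pushforward preimage_bigcup.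
apply: measure_semi_sigma_additive.
- by move=> k; rewrite -[X in measurable X]setTI; exact: measurable_consRn.
- apply/trivIsetP => /= i j _ _ ij; rewrite -preimage_setI.
  by move/trivIsetP : tF => /(_ _ _ _ _ ij) ->//; rewrite preimage_set0.
- by rewrite -preimage_bigcup -[X in measurable X]setTI;
     exact: measurable_consRn.
Qed.

HB.instance Definition _ := isMeasure.Build _ _ _ lebesgue_cons
  lebesgue_cons0 lebesgue_cons_ge0 lebesgue_cons_sigma_additive.

Let unconsRn (x : Rn R n.+1) : measurableTypeR R * Rn R n :=
  (tnth x ord0, [tuple of behead x]).

Let unconsRnK : cancel unconsRn consRn.
Proof. by move=> x; rewrite [RHS]tuple_eta. Qed.

Let consRnK : cancel consRn unconsRn.
Proof. by case=> x y; congr pair; exact: val_inj. Qed.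

Let measurable_unconsRn : measurable_fun setT unconsRn.
Proof.
apply/measurable_fun_pairP; split.
  exact: (@measurable_tnth _ (measurableTypeR R) n.+1 ord0).
exact: measurable_behead.
Qed.

Let lebesgue_cons_sigma_finite : sigma_finite setT lebesgue_cons.
Proof.
have /sigma_finiteP[F [FT ndF Foo]] := sigma_finiteT (@lebesgue_measure R).
have /sigma_finiteP[G [GT ndG Goo]] := sigma_finiteT m.
exists (fun k => unconsRn @^-1` (F k `*` G k)).
  rewrite -preimage_bigcup; apply/esym/seteqP; split => // x _.
  have [i _ Fi] : (\bigcup_k F k) (unconsRn x).1 by rewrite -FT.
  have [j _ Gj] : (\bigcup_k G k) (unconsRn x).2 by rewrite -GT.
  exists (maxn i j) => //; split.
    by move: Fi; exact/subsetPset/ndF/leq_maxl.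
  by move: Gj; exact/subsetPset/ndG/leq_maxr.
move=> k; have [mF Fk] := Foo k; have [mG Gk] := Goo k; split.
  rewrite -[X in measurable X]setTI; apply: measurable_unconsRn => //.
  exact: measurableX.
rewrite /lebesgue_cons /pushforward -comp_preimage.
rewrite (_ : unconsRn \o consRn = id) ?preimage_id; last first.
  by apply/funext => p /=; rewrite consRnK.
by rewrite product_measure1E// lte_mul_pinfty// ge0_fin_numE.
Qed.

HB.instance Definition _ := Measure_isSigmaFinite.Build _ _ _ lebesgue_cons
  lebesgue_cons_sigma_finite.

End lebesgue_cons.

Fixpoint lebesgueRn (R : realType) (n : nat) :
    {sigma_finite_measure set (Rn R n) -> \bar R} :=
  match n with
  | 0 => \d_ ([tuple] : Rn R 0)
  | n'.+1 => lebesgue_cons (lebesgueRn R n')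
  end.

(** Lebesgue measure on [0, +oo[; functions on [0, +oo[ are represented by
    functions on R, whose values on the negative half-line are irrelevant. *)
Definition lebesgue_half (R : realType) :
    {measure set (measurableTypeR R) -> \bar R} :=
  mrestr (@lebesgue_measure R) (@measurable_itv R `[0%R, +oo[).

Section function_norm.
Context {d} {T : measurableType d} {R : realType}.
Variable mu : {measure set T -> \bar R}.

(** Functions may take the values -oo and +oo: f^* and M f may be infinite. *)
Record function_norm (N : (T -> \bar R) -> \bar R) : Prop := {
  fnorm_ge0 : forall f : T -> \bar R, measurable_fun setT f -> 0 <= N f ;
  fnorm_abs : forall f : T -> \bar R, measurable_fun setT f -> N (abse \o f) = N f ;
  fnorm_eq0 : forall f : T -> \bar R, measurable_fun setT f ->
    N f = 0 <-> \forall x \ae mu, f x = 0 ;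
  fnormD : forall f g : T -> \bar R, measurable_fun setT f -> measurable_fun setT g ->
    N (f \+ g) <= N f + N g ;
  fnormZ : forall (a : R) (f : T -> \bar R), measurable_fun setT f ->
    N (fun x => a%:E * f x) = `|a|%:E * N f ;
  fnorm_le : forall f g : T -> \bar R, measurable_fun setT f -> measurable_fun setT g ->
    (\forall x \ae mu, `|f x| <= `|g x|) -> N f <= N g ;
  fnorm_fatou : forall (f_ : (T -> \bar R)^nat) (f : T -> \bar R),
    (forall j, measurable_fun setT (f_ j)) -> measurable_fun setT f ->
    (\forall x \ae mu, nondecreasing_seq (fun j => `|f_ j x|) /\
       (fun j => `|f_ j x|) @ \oo --> `|f x|) ->
    nondecreasing_seq (fun j => N (f_ j)) /\
    (fun j => N (f_ j)) @ \oo --> N f ;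
  fnorm_indic : forall E, measurable E -> mu E < +oo ->
    N (fun x => (\1_E x)%:E) < +oo ;
  fnorm_integral : forall E, measurable E -> mu E < +oo ->
    exists C : R, forall f : T -> \bar R, measurable_fun setT f ->
      \int[mu]_(x in E) `|f x| <= C%:E * N f
}.

Definition distribution (m : set T -> \bar R) (f : T -> \bar R) (r : R) :
  \bar R := m [set x | r%:E < `|f x|].

Definition rearrangement (m : set T -> \bar R) (f : T -> \bar R) (t : R) :
    \bar R :=
  ereal_inf [set r%:E | r in [set r : R |
    (0 <= r)%R /\ distribution m f r <= t%:E]].

Definition rearrangement_invariant (N : (T -> \bar R) -> \bar R) :=
  forall f g : T -> \bar R, measurable_fun setT f -> measurable_fun setT g ->
    (forall r : R, (0 <= r)%R -> distribution mu f r = distribution mu g r) ->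
    N f = N g.

Definition ri_function_norm (N : (T -> \bar R) -> \bar R) :=
  function_norm N /\ rearrangement_invariant N.

(** [Nbar] is the norm of a space Xbar over [0, +oo[ as in Luxemburg's
    representation theorem for the space X of norm [N]. *)
Definition luxemburg_representation (N : (T -> \bar R) -> \bar R)
    (Nbar : (measurableTypeR R -> \bar R) -> \bar R) :=
  forall f : T -> \bar R, measurable_fun setT f -> N f = Nbar (rearrangement mu f).

(** w(E) *)
Definition wmeasure (w : T -> \bar R) (E : set T) : \bar R :=
  \int[mu]_(x in E) w x.

Definition is_weight (w : T -> \bar R) :=
  measurable_fun setT w /\ \forall x \ae mu, 0 < w x < +oo.

Definition L1norm (w f : T -> \bar R) : \bar R := \int[mu]_x (`|f x| * w x).

(** The norm of X_w, in terms of the norm of Xbar. *)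
Definition weighted_norm (Nbar : (measurableTypeR R -> \bar R) -> \bar R)
    (w f : T -> \bar R) : \bar R :=
  Nbar (rearrangement (wmeasure w) f).

(** The norm of the associate space, with respect to w dx, of the space of
    norm [N]. *)
Definition associate_norm (w : T -> \bar R) (N : (T -> \bar R) -> \bar R)
    (f : T -> \bar R) : \bar R :=
  ereal_sup [set \int[mu]_x (`|f x * g x| * w x) | g in
    [set g : T -> \bar R | measurable_fun setT g /\ N g <= 1]].

End function_norm.

Section boyd.
Context {R : realType}.
Variable Nbar : (measurableTypeR R -> \bar R) -> \bar R.

Definition dilation_norm (t : R) : \bar R :=
  ereal_sup [set Nbar (fun s => f (s / t)%R) | f in
    [set f : measurableTypeR R -> \bar R | measurable_fun setT f /\ Nbar f <= 1]].

(** inf over 0 < t < 1 of log t / log h(t), which is also the limit as t tends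
    to 0+. As 0 < h(t) <= 1, both logarithms are negated so that the ratio is
    +oo when h(t) = 1 (in [\bar R], 0^-1 = +oo). *)
Definition upper_boyd_index : \bar R :=
  ereal_inf [set (- ln t)%:E / - lne (dilation_norm t) | t in
    [set t : R | (0 < t < 1)%R]].

End boyd.

Section cubes_and_weights.
Context {R : realType} {n : nat}.
Local Notation mu := (lebesgueRn R n).
Implicit Types (w v f : Rn R n -> \bar R).

Definition cube (a : Rn R n) (l : R) : set (Rn R n) :=
  [set x | forall i, (tnth a i < tnth x i < tnth a i + l)%R].

Definition cubes : set (set (Rn R n)) :=
  [set Q | exists a l, (0 < l)%R /\ Q = cube a l].

Definition average f (Q : set (Rn R n)) : \bar R :=
  (mu Q)^-1 * \int[mu]_(y in Q) f y.

Definition maximal f (x : Rn R n) : \bar R :=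
  ereal_sup [set average (abse \o f) Q | Q in [set Q | cubes Q /\ Q x]].

Definition wmaximal v f (x : Rn R n) : \bar R :=
  ereal_sup [set (wmeasure mu v Q)^-1 * \int[mu]_(y in Q) (`|f y| * v y)
    | Q in [set Q | cubes Q /\ Q x]].

Definition A1_constant w : \bar R :=
  ess_sup mu (fun x => maximal w x / w x).

Definition conjugate_exponent (p : R) : R := (p / (p - 1))%R.

Definition dual_weight (p : R) w : Rn R n -> \bar R :=
  fun x => w x `^ (1 - conjugate_exponent p).

(** [w]_{A_p} for 1 <= p < +oo. *)
Definition Ap_constant (p : R) w : \bar R :=
  if p == 1%R then A1_constant w else
  ereal_sup [set average w Q *
    (average (dual_weight p w) Q) `^ (p - 1)
    | Q in cubes].

Definition muckenhoupt (p : R) w := is_weight mu w /\ Ap_constant p w < +oo.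

(** Operator norm of M_v on X_v'. *)
Definition wmaximal_norm (Nbar : (measurableTypeR R -> \bar R) -> \bar R) v :
    \bar R :=
  let Nv' := associate_norm mu v (weighted_norm mu Nbar v) in
  ereal_sup [set Nv' (wmaximal v f) | f in
    [set f : Rn R n -> \bar R | measurable_fun setT f /\ Nv' f <= 1]].

Definition extrapolation_pairs
    (F : set ((Rn R n -> \bar R) * (Rn R n -> \bar R))) :=
  forall f g, F (f, g) ->
    [/\ measurable_fun setT f, measurable_fun setT g,
        forall x, 0 <= f x & forall x, 0 <= g x].

(** u^(1 - p0') is an A_1 weight, or u = 1 when p0 = 1. *)
Definition admissible (p0 : R) (u : Rn R n -> \bar R) :=
  if p0 == 1%R then u = cst 1
  else muckenhoupt 1 (dual_weight p0 u).

(** [u^(1 - p0')]_{A_1}^(p0 - 1), read as 1 when p0 = 1. *)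
Definition admissible_constant (p0 : R) (u : Rn R n -> \bar R) : R :=
  if p0 == 1%R then 1%R
  else (fine (A1_constant (dual_weight p0 u))
    `^ (p0 - 1))%R.

End cubes_and_weights.

(** [lebesgueRn] and [cube] are the usual ones: a cube of side l has measure
    l^n. *)
Lemma lebesgueRn_cube (R : realType) (n : nat) (a : Rn R n) (l : R) :
  (0 < l)%R -> lebesgueRn R n (cube a l) = (l ^+ n)%:E.
Proof.
move=> l0.
suff: measurable (cube a l) /\ lebesgueRn R n (cube a l) = (l ^+ n)%:E by case.
elim: n a => [a|n IH a].
  rewrite (_ : cube a l = setT); last by apply/seteqP; split => // x _ [].
  by split; [exact: measurableT | rewrite /= diracT].
pose b : Rn R n := [tuple of behead a].
pose I := `](tnth a ord0), (tnth a ord0 + l)%R[%classic : set (measurableTypeR R).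
have [mb Eb] := IH b.
have mI : measurable I by exact: measurable_itv.
have C : cube a l =
    (fun x : Rn R n.+1 => tnth x ord0) @^-1` I `&`
    (fun x : Rn R n.+1 => [tuple of behead x] : Rn R n) @^-1` cube b l.
  apply/seteqP; split => [x H|x [/= H1 H2] i].
    split; first by have := H ord0; rewrite /I /= in_itv.
    move=> i; have := H (lift ord0 i).
    by rewrite [in X in X -> _](tuple_eta x) [in X in X -> _](tuple_eta a) !tnthS.
  have [->|[j ->]] : i = ord0 \/ exists j, i = lift ord0 j.
  - by case: (unliftP ord0 i) => [j ->|->]; [right; exists j | left].
  - by move: H1; rewrite /I /= in_itv.
  - by have := H2 j; rewrite [in X in _ -> X](tuple_eta x)
      [in X in _ -> X](tuple_eta a) !tnthS.
split.
  rewrite C; apply: measurableI; rewrite -[X in measurable X]setTI.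
    exact: (@measurable_tnth _ (measurableTypeR R) n.+1 ord0).
  exact: measurable_behead.
rewrite /= /lebesgue_cons /pushforward.
have -> : consRn @^-1` cube a l = I `*` cube b l.
  rewrite C; apply/seteqP.
  have K (p : measurableTypeR R * Rn R n) :
    [tuple of behead (consRn p)] = p.2 :> Rn R n by exact: val_inj.
  by split => p [H1 H2]; split => //; move: H2; rewrite /= K.
rewrite product_measure1E//= Eb lebesgue_measure_itv /= lte_fin ltrDl l0.
by rewrite -EFinB -EFinM addrAC subrr add0r exprS.
Qed.

(* Main.v *)
From Pilot Require Import Defs.
From HB Require Import structures.
From mathcomp Require Import all_boot all_order all_algebra.
From mathcomp Require Import all_classical all_reals all_analysis.
From mathcomp Require Import measurable_realfun ess_sup_inf.
From mathcomp Require Import lra ring zify.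

Set Implicit Arguments.
Unset Strict Implicit.
Unset Printing Implicit Defensive.

Import Order.TTheory GRing.Theory Num.Theory.
Import numFieldNormedType.Exports.

Local Open Scope classical_set_scope.
Local Open Scope ring_scope.
Local Open Scope ereal_scope.

(** Write [nu] for the measure [v dx], [X_v] for the space normed by
    [rnorm Nb nu], and [M] for the maximal operator over cubes with respect to
    [nu].

    The inequality is proved by duality. The Lorentz-Luxemburg theorem
    ([rnorm_le_associate]) reduces it to bounding [int |f u| h dnu] for [h >= 0]
    of associate norm at most 1. If [A] is the norm of [M] on the associate
    space, the series [H = sum_k (2 A)^-k M^k h] satisfies [h <= H], has
    associate norm at most 2, and [M H <= 2 A H] ([rubio_de_francia]). The last
    property makes [H v] an [A_1] weight of constant at most [2 A [v]]
    ([majorant_A1]), so that [w = u H v] is an [A_p0] weight of controlled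
    constant ([majorant_Ap]). The hypothesis for the weight [w] and Hoelder's
    inequality then give
    [int f u h dnu <= int f w dx <= Psi int g w dx <= 2 Psi ||g u||].
    As [Psi] is monotone only on [[1, +oo[], one also needs that [A_p] constants
    are at least 1 ([A1_bound_ge1], [Ap_constant_ge1]).

    Two facts about [X_v] are needed: the duality theorem, and the finiteness of
    [A]. Both rest on layered functions, that is, positive multiples of sums of
    indicators of a decreasing sequence of sets. Every nonnegative measurable
    function is an increasing limit of layered functions ([layered_ind]), and the
    rearrangement of a layered function is the layered function on the half-line
    built on the intervals [[0, nu G_k[]. The key estimate ([averaging]) is that
    replacing a function by its averages over the shells of a layered function
    does not increase the norm; it holds because the averaged function is, up
    to a rounding error, a mean of equimeasurable ones. Duality for layered functions follows by applying
    the Hahn-Banach theorem in the finite-dimensional space of step functions on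
    the intervals ([layered_norming]).

    For the finiteness of [A] ([maximal_assoc_bounded]), the maximal operator
    enters only through its values on indicators of sets [D]. There it is bounded
    by 1 and of weak type (1,1), by the Vitali covering lemma and the doubling
    property of [v] ([cube_maximal_weak], [A1_bound_doubling]), so that its level
    set at height [t^k] has measure at most [C t^-k nu(D)]. When [M f] is paired
    with [g], the factor [t^-k] can be traded for a dilation of the
    rearrangement of [g] by [t^k]. A finite upper Boyd index provides [t < 1] for
    which dilation by [t] is a strict contraction ([boyd_contraction]), and the
    dilated terms sum to a geometric series. *)

(* [distribution] is also the name of the law of a random variable. *)
Local Notation distribution := Pilot.Defs.distribution.

(** * Distribution functions and decreasing rearrangements *)

Lemma measurable_superlevels {d} {T : measurableType d} {R : realType} (f : T -> \bar R) :
  (forall r : R, measurable [set x | r%:E < f x]) -> measurable_fun setT f.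
Proof.
move=> mf; apply: (measurability _ (ErealGenOInfty.measurableE R)) => //.
move=> _ [_ [r ->] <-]; rewrite setTI.
rewrite (_ : _ @^-1` _ = [set x | r%:E < f x])//.
by apply/seteqP; split => x /=; rewrite in_itv/= andbT.
Qed.

Lemma lebesgue_halfE {R : realType} (A : set (measurableTypeR R)) :
  lebesgue_half R A = lebesgue_measure (A `&` `[0%R, +oo[).
Proof. by []. Qed.

Section rearrangement.
Context {d} {T : measurableType d} {R : realType}.
Variable m : {measure set T -> \bar R}.
Implicit Types f g : T -> \bar R.

Lemma lt_measure_bigcup (F : (set T)^nat) (a : \bar R) :
  (forall k, measurable (F k)) -> nondecreasing_seq F ->
  a < m (\bigcup_k F k) -> exists k, a < m (F k).
Proof.
move=> mF ndF aF.
have mU : measurable (\bigcup_k F k) by exact: bigcup_measurable.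
apply: contrapT => /forallNP H; move: aF; apply/negP; rewrite -leNgt.
apply: cvge_to_le (nondecreasing_cvg_mu (mu := m) mF mU ndF) _.
by apply: nearW => k /=; rewrite leNgt; exact/negP.
Qed.

Lemma measurable_superlevel f (a : \bar R) : measurable_fun setT f ->
  measurable [set x | a < `|f x|].
Proof.
move=> mf; rewrite -[X in measurable X]setTI.
apply: measurable_lte => //.
exact: measurableT_comp.
Qed.

Lemma le_distribution f g (r s : R) :
  measurable_fun setT f -> measurable_fun setT g ->
  (forall x, `|f x| <= `|g x|) -> (r <= s)%R ->
  distribution m f s <= distribution m g r.
Proof.
move=> mf mg fg rs; apply: le_measure; rewrite ?inE; try exact: measurable_superlevel.
by move=> x /= sf; apply: (le_lt_trans _ (lt_le_trans sf (fg x))); rewrite lee_fin.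
Qed.

(** By continuity of the measure from below. *)
Lemma lt_distribution_right f (r : R) (a : \bar R) : measurable_fun setT f ->
  a < distribution m f r -> exists2 s, (r < s)%R & a < distribution m f s.
Proof.
move=> mf; rewrite /distribution.
pose F (k : nat) := [set x | (r + k.+1%:R^-1)%:E < `|f x|].
have -> : [set x | r%:E < `|f x|] = \bigcup_k F k.
  apply/seteqP; split => [x /= rf|x [k _] /=]; last first.
    by apply: le_lt_trans; rewrite lee_fin lerDl.
  have [q rq qf] : exists2 q : R, (r < q)%R & q%:E <= `|f x|.
    move: rf; case: (`|f x|) => [y|_|//]; last by exists (r + 1)%R; rewrite ?ltrDl ?leey.
    by rewrite lte_fin => ry; exists y.
  have [k kq] : exists k : nat, (k.+1%:R^-1 < q - r)%R.
    have rq0 : (0 < q - r)%R by rewrite subr_gt0.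
    by have [k _ /(_ k (leqnn k))] := near_infty_natSinv_lt (PosNum rq0); exists k.
  exists k => //; apply: lt_le_trans qf; by rewrite lte_fin -ltrBrDl.
move=> H; have [||k ak] := lt_measure_bigcup _ _ H.
- by move=> k; exact: measurable_superlevel.
- move=> i j ij; apply/subsetPset => x /=; apply: le_lt_trans.
  by rewrite lee_fin lerD2l lef_pV2 ?posrE// ler_nat.
- by exists (r + k.+1%:R^-1)%R => //; rewrite ltrDl.
Qed.

Lemma rearrangement_ge0 f (s : R) : 0 <= rearrangement m f s.
Proof. by apply/ereal_infP => _ [r [r0 _] <-]; rewrite lee_fin. Qed.

(** Every property of rearrangements used below is read off this equivalence.
    It holds for strict inequalities because the distribution function is
    right-continuous. *)
Lemma lt_rearrangement f (r s : R) : measurable_fun setT f -> (0 <= r)%R ->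
  (r%:E < rearrangement m f s) = (s%:E < distribution m f r).
Proof.
move=> mf r0; apply/idP/idP => [|H].
  apply: contraTT; rewrite -!leNgt => H.
  by apply: ereal_inf_lbound => /=; exists r.
have [q rq sq] := lt_distribution_right mf H.
rewrite (@lt_le_trans _ _ q%:E) ?lte_fin//.
apply/ereal_infP => _ [l [l0 lm] <-]; rewrite lee_fin leNgt; apply/negP => lq.
have := lt_le_trans sq (le_distribution mf mf (fun=> lexx _) (ltW lq)).
by rewrite ltNge lm.
Qed.

Lemma rearrangement_nonincreasing f (s t : R) : (s <= t)%R ->
  rearrangement m f t <= rearrangement m f s.
Proof.
move=> st; apply/ereal_infP => _ [r [r0 rs] <-]; apply: ge_ereal_inf.
by exists r%:E => //=; exists r => //; split => //; rewrite (le_trans rs)// lee_fin.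
Qed.

Lemma measurable_rearrangement f :
  measurable_fun (setT : set (measurableTypeR R)) (rearrangement m f).
Proof.
apply: measurable_superlevels => r; apply: is_interval_measurable.
move=> x y /= xr yr z /andP[xz zy]; apply: lt_le_trans yr _.
exact: rearrangement_nonincreasing.
Qed.

Lemma distribution_half_rearrangement f (r : R) : measurable_fun setT f -> (0 <= r)%R ->
  distribution (lebesgue_half R) (rearrangement m f) r = distribution m f r.
Proof.
move=> mf r0.
rewrite {1}/distribution lebesgue_halfE.
have d0 : 0 <= distribution m f r by exact: measure_ge0.
have -> : [set x | r%:E < `|rearrangement m f x|] `&` `[0%R, +oo[ =
   [set x : R | (0 <= x)%R /\ x%:E < distribution m f r].
  apply/seteqP; split => x /=; rewrite in_itv/= andbT gee0_abs ?rearrangement_ge0// lt_rearrangement//; tauto.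
move: d0; case E : (distribution m f r) => [a| |//] a0.
  have -> : [set x : R | (0 <= x)%R /\ x%:E < a%:E] = `[0%R, a[%classic.
    by apply/seteqP; split => x /=; rewrite in_itv/= lte_fin; [case=> -> -> | move=> /andP[]].
  rewrite lebesgue_measure_itv/= lte_fin.
  case: ifPn => [_|]; first by rewrite sube0.
  by rewrite -leNgt => a0'; apply/eqP; rewrite eq_sym eqe eq_le a0' -lee_fin.
have -> : [set x : R | (0 <= x)%R /\ x%:E < +oo] = `[0%R, +oo[%classic.
  by apply/seteqP; split => x /=; rewrite in_itv/= ltry andbT; [case|].
by rewrite lebesgue_measure_itv/= ltry.
Qed.

End rearrangement.

(** * Increasing limits *)

Section increasing_limits.
Context {d} {T : measurableType d} {R : realType}.
Implicit Types (A : nat -> T -> \bar R) (F h : T -> \bar R).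

(** The limit is stated as a supremum so that no value has to be finite; cf.
    [increases_to_cvg]. *)
Definition increases_to A F := [/\ forall k x, 0 <= A k x,
  forall k l x, (k <= l)%N -> A k x <= A l x &
  forall x, F x = ereal_sup (range (A^~ x))].

Lemma increases_to_le A F k x : increases_to A F -> A k x <= F x.
Proof. by move=> [_ _ ->]; apply: ereal_sup_ubound; exists k. Qed.

Lemma increases_to_ge0 A F x : increases_to A F -> 0 <= F x.
Proof. by move=> FF; apply: le_trans (increases_to_le 0 x FF); case: FF. Qed.

Lemma increases_to_lt A F x a : increases_to A F -> a < F x ->
  exists k, a < A k x.
Proof. by move=> [_ _ ->] /ereal_sup_gt[_ [k _ <-] ak]; exists k. Qed.

Lemma increases_to_cvg A F x : increases_to A F -> A ^~ x @ \oo --> F x.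
Proof.
by move=> [_ ndF ->]; apply: ereal_nondecreasing_cvgn => k l kl; exact: ndF.
Qed.

Lemma increases_toMr A F h : (forall x, 0 <= h x) -> increases_to A F ->
  increases_to (fun k x => A k x * h x) (fun x => F x * h x).
Proof.
move=> h0 FF; have [A0 ndA supA] := FF; split.
- by move=> k x; rewrite mule_ge0.
- by move=> k l x kl; rewrite lee_wpmul2r// ndA.
move=> x; apply/eqP; rewrite eq_le; apply/andP; split; last first.
  by apply/ereal_supP => _ [k _ <-]; rewrite lee_wpmul2r// (increases_to_le _ _ FF).
have ub k : A k x * h x <= ereal_sup (range (fun k => A k x * h x)).
  by apply: ereal_sup_ubound; exists k.
have /predU1P[F0x|F0x] : (0 == F x) || (0 < F x) by rewrite -le_eqVlt (increases_to_ge0 _ FF).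
  by rewrite -F0x mul0e (le_trans _ (ub 0%N))// mule_ge0.
move: (h0 x) ub; case: (h x) => [r| |]// r0 ub.
  rewrite muleC supA -ereal_supZl//; last by apply/set0P; exists (A 0%N x), 0%N.
  by apply/ereal_supP => _ [_ [k _ <-] <-]; rewrite muleC.
by have [k Ak] := increases_to_lt FF F0x; rewrite (le_trans _ (ub k))// !gt0_muley.
Qed.

Lemma integral_increases_to_le (mu : {measure set T -> \bar R}) A F (c : \bar R) :
  increases_to A F -> (forall k, measurable_fun setT (A k)) ->
  (forall k, \int[mu]_x A k x <= c) -> \int[mu]_x F x <= c.
Proof.
move=> FF mA Ac; have [A0 ndA _] := FF.
have -> : F = fun x => limn (A ^~ x).
  by apply/funext => x; apply/esym/cvg_lim => //; exact: increases_to_cvg.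
apply: cvge_to_le (cvg_monotone_convergence _ _ _ _) _ => //.
- by move=> x _ k l kl; exact: ndA.
- by apply: nearW => k; exact: Ac.
Qed.

Lemma measurable_increases_to A F : increases_to A F ->
  (forall k, measurable_fun setT (A k)) -> measurable_fun setT F.
Proof.
move=> FF mA; apply: (emeasurable_fun_cvg _ _ mA) => x _.
exact: increases_to_cvg.
Qed.

End increasing_limits.

Lemma increases_to_rearrangement {d} {T : measurableType d} {R : realType}
    (m : {measure set T -> \bar R}) (A : nat -> T -> \bar R) (F : T -> \bar R) :
  (forall k, measurable_fun setT (A k)) -> increases_to A F ->
  increases_to (fun k => rearrangement m (A k)) (rearrangement m F).
Proof.
move=> mA FF; have [A0 ndA _] := FF; have mF := measurable_increases_to FF mA.
have le_re f g s : measurable_fun setT f -> measurable_fun setT g ->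
    (forall x, 0 <= f x <= g x) -> rearrangement m f s <= rearrangement m g s.
  move=> mf mg fg; apply/ereal_infP => _ [r [r0 rs] <-]; apply: ge_ereal_inf.
  exists r%:E => //=; exists r => //; split => //; apply: le_trans rs.
  apply: le_distribution => // x; have /andP[f0 {}fg] := fg x.
  by rewrite !gee0_abs// (le_trans f0).
split.
- by move=> k s; exact: rearrangement_ge0.
- by move=> k l s kl; apply: le_re => // x; rewrite A0 ndA.
move=> s; apply/eqP; rewrite eq_le; apply/andP; split; last first.
  apply/ereal_supP => _ [k _ <-]; apply: le_re => // x.
  by rewrite A0 (increases_to_le _ _ FF).
rewrite leNgt; apply/negP => H.
have [r r0 /andP[Hr]] : exists2 r : R, (0 <= r)%R &
    ereal_sup (range (fun k => rearrangement m (A k) s)) <= r%:E < rearrangement m F s.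
  have e0 : 0 <= ereal_sup (range (fun k => rearrangement m (A k) s)).
    by apply: le_trans (rearrangement_ge0 m (A 0%N) s) _; apply: ereal_sup_ubound; exists 0%N.
  move: e0 H; case: ereal_sup => [a a0 H|_|//]; last by rewrite ltNge leey.
  by exists a; rewrite ?lexx -?lee_fin.
rewrite lt_rearrangement//.
rewrite {1}/distribution (_ : [set x | _] = \bigcup_k [set x | r%:E < `|A k x|]); last first.
  apply/seteqP; split => [x /=|x [k _] /=].
    rewrite gee0_abs ?(increases_to_ge0 _ FF)// => /(increases_to_lt FF)[k Ak].
    by exists k => //=; rewrite gee0_abs.
  move=> rA; apply: lt_le_trans rA _.
  by rewrite !gee0_abs ?(increases_to_ge0 _ FF)// (increases_to_le _ _ FF).
move=> /lt_measure_bigcup[k|k l kl|k sk].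
- exact: measurable_superlevel.
- by apply/subsetPset => x /= rA; apply: lt_le_trans rA _; rewrite !gee0_abs// ndA.
have : r%:E < rearrangement m (A k) s by rewrite lt_rearrangement.
by apply/negP; rewrite -leNgt; apply: le_trans Hr; apply: ereal_sup_ubound; exists k.
Qed.

(** * Norms of rearrangements *)

Section rearrangement_norm.
Context {R : realType} (Nb : (measurableTypeR R -> \bar R) -> \bar R).
Hypothesis riN : ri_function_norm (lebesgue_half R) Nb.
Let fnN := riN.1.

(** With [m] the measure of density [w] and [Nb] the norm of Xbar, this is the
    norm of X(w). *)
Definition rnorm {d} {T : measurableType d} (m : set T -> \bar R) (f : T -> \bar R) :=
  Nb (rearrangement m f).

Lemma rnorm_ge0 {d} {T : measurableType d} (m : {measure set T -> \bar R}) f :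
  0 <= rnorm m f.
Proof. by apply: (fnorm_ge0 fnN); exact: measurable_rearrangement. Qed.

(** The two functions may live on different spaces, which lets norms on [T] be
    computed on the half-line and conversely. *)
Lemma rnorm_le_distribution {d d'} {T : measurableType d} {T' : measurableType d'}
    (m : {measure set T -> \bar R}) (m' : {measure set T' -> \bar R}) f g :
  (forall r : R, (0 <= r)%R -> distribution m f r <= distribution m' g r) ->
  rnorm m f <= rnorm m' g.
Proof.
move=> fg; apply: (fnorm_le fnN); try exact: measurable_rearrangement.
apply: aeW => s; rewrite !gee0_abs ?rearrangement_ge0//.
apply/ereal_infP => _ [r [r0 rs] <-]; apply: ge_ereal_inf.
by exists r%:E => //=; exists r => //; split => //; apply: le_trans rs; exact: fg.
Qed.

Lemma rnorm_eq_distribution {d d'} {T : measurableType d} {T' : measurableType d'}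
    (m : {measure set T -> \bar R}) (m' : {measure set T' -> \bar R}) f g :
  (forall r : R, (0 <= r)%R -> distribution m f r = distribution m' g r) ->
  rnorm m f = rnorm m' g.
Proof.
by move=> fg; apply/eqP; rewrite eq_le !rnorm_le_distribution// => r r0; rewrite fg.
Qed.

Lemma rnorm_le {d} {T : measurableType d} (m : {measure set T -> \bar R}) f g :
  measurable_fun setT f -> measurable_fun setT g ->
  (forall x, `|f x| <= `|g x|) -> rnorm m f <= rnorm m g.
Proof.
by move=> mf mg fg; apply: rnorm_le_distribution => r r0; exact: le_distribution.
Qed.

Lemma rnorm_half (f : measurableTypeR R -> \bar R) : measurable_fun setT f ->
  rnorm (lebesgue_half R) f = Nb f.
Proof.
move=> mf; apply: riN.2 => //; first exact: measurable_rearrangement.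
by move=> r r0; rewrite distribution_half_rearrangement.
Qed.

Lemma rnormZ {d} {T : measurableType d} (m : {measure set T -> \bar R}) (a : R) f :
  measurable_fun setT f -> (0 < a)%R ->
  rnorm m (fun x => a%:E * f x) = a%:E * rnorm m f.
Proof.
move=> mf a0.
have distZ e (S : measurableType e) (k : {measure set S -> \bar R}) (g : S -> \bar R) r :
    distribution k (fun x => a%:E * g x) r = distribution k g (r / a).
  congr (k _); apply/seteqP; split => x /=;
  by rewrite abseM /= gtr0_norm// EFinM lte_pdivrMr// muleC.
have mr := measurable_rearrangement m f.
rewrite -[in RHS](gtr0_norm a0) -(fnormZ fnN)//.
rewrite -rnorm_half; last by apply: emeasurable_funM.
apply: rnorm_eq_distribution => r r0.
by rewrite !distZ distribution_half_rearrangement// divr_ge0// ltW.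
Qed.

(** The Fatou axiom, in the form that transfers bounds from layered functions to
    their increasing limits. *)
Lemma fnorm_increases_to_le (A : nat -> measurableTypeR R -> \bar R) F (c : \bar R) :
  (forall k, measurable_fun setT (A k)) -> increases_to A F ->
  (forall k, Nb (A k) <= c) -> Nb F <= c.
Proof.
move=> mA FF Ac; have [A0 ndA _] := FF.
have mF := measurable_increases_to FF mA.
have [_ cN] : nondecreasing_seq (fun j => Nb (A j)) /\ (fun j => Nb (A j)) @ \oo --> Nb F.
  apply: (fnorm_fatou fnN) => //; apply: aeW => s; split.
    by move=> k l kl /=; rewrite !gee0_abs// ndA.
  under eq_fun do rewrite gee0_abs//.
  by rewrite gee0_abs ?(increases_to_ge0 _ FF)//; exact: increases_to_cvg.
by apply: cvge_to_le cN _; exact: nearW.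
Qed.

Lemma rnorm_increases_to_le {d} {T : measurableType d} (m : {measure set T -> \bar R})
    (A : nat -> T -> \bar R) F (c : \bar R) :
  (forall k, measurable_fun setT (A k)) -> increases_to A F ->
  (forall k, rnorm m (A k) <= c) -> rnorm m F <= c.
Proof.
move=> mA FF; apply: fnorm_increases_to_le.
  by move=> k; exact: measurable_rearrangement.
exact: increases_to_rearrangement.
Qed.

Lemma fnorm0 : Nb (cst 0) = 0.
Proof. by apply/(fnorm_eq0 fnN); [exact: measurable_cst|exact: aeW]. Qed.

Lemma fnorm_sum (I : Type) (s : seq I) (A : I -> measurableTypeR R -> \bar R) :
  (forall i, measurable_fun setT (A i)) ->
  Nb (fun x => \sum_(i <- s) A i x) <= \sum_(i <- s) Nb (A i).
Proof.
move=> mA; elim: s => [|i s IH].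
  rewrite big_nil (_ : (fun _ => _) = cst 0) ?fnorm0//.
  by apply/funext => x; rewrite big_nil.
rewrite big_cons (_ : (fun _ => _) = A i \+ (fun x => \sum_(i <- s) A i x)); last first.
  by apply/funext => x; rewrite big_cons.
apply: le_trans (leeD2l _ IH); apply: (fnormD fnN) => //.
exact: emeasurable_sum.
Qed.

End rearrangement_norm.

(** * Step functions and layered functions *)

Section dyadic_layers.
Context {R : realType}.
Implicit Types (a : \bar R) (e : R) (N m : nat).

(** The lower Riemann sum, over the first [N] cells of mesh [e], of the
    integral of the indicator function of [{t | t < a}]. *)
Definition layer_sum e N a : R := (\sum_(k < N) e * ((k.+1%:R * e)%:E < a)%E%:R)%R.

Lemma layer_sum_ge0 e N a : (0 <= e)%R -> (0 <= layer_sum e N a)%R.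
Proof. by move=> e0; apply: sumr_ge0 => k _; rewrite mulr_ge0. Qed.

Lemma layer_sum_le e N a : (0 <= e)%R -> 0 <= a -> (layer_sum e N a)%:E <= a.
Proof.
move=> e0 a0; elim: N => [|N IH]; first by rewrite /layer_sum big_ord0.
rewrite /layer_sum big_ord_recr /=.
have [Na|_] := boolP ((N.+1%:R * e)%:E < a); last by rewrite mulr0 addr0.
apply: le_trans (ltW Na); rewrite lee_fin mulr1 -natr1 mulrDl mul1r lerD2r.
apply: (@le_trans _ _ (\sum_(k < N) e)%R).
  by apply: ler_sum => k _; case: (_ < _)%O; rewrite ?mulr1 ?mulr0.
by rewrite sumr_const card_ord mulr_natl.
Qed.

Lemma layer_sum_ge e N a (j : nat) : (0 <= e)%R -> (j <= N)%N ->
  (j%:R * e)%:E < a -> (j%:R * e <= layer_sum e N a)%R.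
Proof.
move=> e0 jN ja; rewrite /layer_sum -(subnKC jN) big_split_ord /=.
rewrite -[leLHS]addr0 lerD ?sumr_ge0// => [|k _]; last by rewrite mulr_ge0.
rewrite (eq_bigr (fun=> e)); first by rewrite sumr_const card_ord mulr_natl.
move=> k _; rewrite (@le_lt_trans _ _ (j%:R * e)%:E) ?mulr1//.
by rewrite lee_fin ler_wpM2r// ler_nat.
Qed.

Lemma big_ord_double (F : nat -> R) N :
  (\sum_(j < N.*2) F j = \sum_(k < N) (F k.*2 + F k.*2.+1))%R.
Proof.
elim: N => [|N IH]; first by rewrite !big_ord0.
by rewrite doubleS !big_ord_recr /= IH addrA.
Qed.

(** Halving the mesh splits each cell in two; both halves lie below [a] when the
    right end of the cell does. *)
Lemma layer_sum_half e N M a : (0 <= e)%R -> (N.*2 <= M)%N ->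
  (layer_sum e N a <= layer_sum (e / 2) M a)%R.
Proof.
move=> e0 NM; rewrite /layer_sum -(subnKC NM) big_split_ord /=.
rewrite -[leLHS]addr0 lerD ?sumr_ge0// => [|k _]; last by rewrite mulr_ge0// divr_ge0.
rewrite (big_ord_double (fun j => e / 2 * ((j.+1%:R * (e / 2))%:E < a)%E%:R)%R).
apply: ler_sum => k _; have [ka|_] := boolP ((_ * e)%:E < a); last first.
  by rewrite mulr0 addr_ge0// mulr_ge0// divr_ge0.
have E : (k.*2.+2%:R * (e / 2) = k.+1%:R * e)%R.
  by rewrite -doubleS -muln2 natrM mulrACA mulfV// mulr1.
rewrite E ka (@le_lt_trans _ _ (k.+1%:R * e)%:E)//.
  by rewrite !mulr1 -splitr.
by rewrite -E lee_fin ler_wpM2r ?divr_ge0// ler_nat.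
Qed.

Definition dyadic_layers m a : R := layer_sum (2^-1 ^+ m) (m * 2 ^ m) a.

Lemma dyadic_layers_nondecreasing m m' a : (m <= m')%N ->
  (dyadic_layers m a <= dyadic_layers m' a)%R.
Proof.
move=> /subnK <-; elim: (m' - m)%N => [//|k IH]; rewrite addSn.
apply: le_trans IH _; rewrite /dyadic_layers exprSr; apply: layer_sum_half.
  by rewrite exprn_ge0.
by rewrite -muln2 -mulnA -expnSr leq_mul.
Qed.

Lemma lt_dyadic_layers (r : R) a : (0 <= r)%R -> r%:E < a ->
  exists m, (r < dyadic_layers m a)%R.
Proof.
move=> r0 ra.
have [q rq qa] : exists2 q : R, (r < q)%R & q%:E < a.
  move: ra; case: a => [y|_|//]; last by exists (r + 1)%R; rewrite ?ltrDl ?ltry.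
  by rewrite lte_fin => /midf_lt[ry yy]; exists ((r + y) / 2)%R; rewrite ?lte_fin.
have rq0 : (0 < q - r)%R by rewrite subr_gt0.
have [m0 _ Hm0] := near_infty_natSinv_expn_lt (PosNum rq0).
pose m := maxn m0 (Num.truncn q).+1.
have q0 : (0 <= q)%R by rewrite (le_trans r0)// ltW.
have mq : (q < m%:R)%R.
  apply: lt_le_trans (truncnS_gt q) _.
  by rewrite ler_nat leq_maxr.
have {}Hm : (2^-1 ^+ m < q - r)%R.
  have /= := Hm0 m (leq_maxl _ _).
  by rewrite div1r -exprVn.
exists m; rewrite /dyadic_layers; set e := (2^-1 ^+ m)%R in Hm *.
have e0 : (0 < e)%R by rewrite exprn_gt0.
have eV : (e * (2 ^ m)%:R = 1)%R by rewrite /e natrX -exprMn mulVf// expr1n.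
pose j := Num.truncn (q / e)%R.
have qe0 : (0 <= q / e)%R by rewrite divr_ge0// ltW.
have je : (j%:R * e <= q)%R by rewrite -ler_pdivlMr// truncn_le.
apply: (@lt_le_trans _ _ (j%:R * e)%R).
  have : (q < j.+1%:R * e)%R by rewrite -ltr_pdivrMr// truncnS_gt.
  rewrite -natr1 mulrDl mul1r; lra.
apply: layer_sum_ge; rewrite ?ltW//; last by rewrite (le_lt_trans _ qa)// lee_fin.
rewrite -(ler_nat R) -(ler_pM2r e0) (le_trans je)// natrM -mulrA [(_%:R * e)%R]mulrC eV mulr1.
exact: ltW.
Qed.

End dyadic_layers.

Section step_functions.
Context {d} {T : measurableType d} {R : realType}.
Variable m : {measure set T -> \bar R}.

Definition step (J : finType) (W : J -> set T) (c : J -> R) (x : T) : \bar R :=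
  (\sum_j c j * \1_(W j) x)%:E.

Context {J : finType}.
Implicit Types (W : J -> set T) (c : J -> R).

Lemma measurable_step W c : (forall j, measurable (W j)) ->
  measurable_fun setT (step W c).
Proof.
move=> mW; apply/measurable_EFinP; apply: measurable_sum => j.
by apply: measurable_funM => //; exact: measurable_indic.
Qed.

Lemma step_ge0 W c x : (forall j, 0 <= c j)%R -> 0 <= step W c x.
Proof. by move=> c0; rewrite lee_fin sumr_ge0// => j _; rewrite mulr_ge0. Qed.

Lemma step_in W c j x : trivIset setT W -> W j x -> step W c x = (c j)%:E.
Proof.
move=> tW Wj; rewrite /step (bigD1 j)//= indicE mem_set// mulr1 big1 ?addr0// => i ij.
rewrite indicE memNset ?mulr0// => Wi; move/eqP: ij; apply.
by apply: tW => //; exists x.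
Qed.

Lemma step_out W c x : (forall j, ~ W j x) -> step W c x = 0.
Proof.
by move=> nW; rewrite /step big1// => j _; rewrite indicE memNset ?mulr0//; exact: nW.
Qed.

Lemma integral_step W c (h : T -> \bar R) :
  (forall j, measurable (W j)) -> (forall j, 0 <= c j)%R ->
  measurable_fun setT h -> (forall x, 0 <= h x) ->
  \int[m]_x (step W c x * h x) = \sum_j (c j)%:E * \int[m]_(x in W j) h x.
Proof.
move=> mW c0 mh h0.
transitivity (\int[m]_x \sum_j ((c j)%:E * (h x * (\1_(W j) x)%:E))).
  apply: eq_integral => x _; rewrite /step -sumEFin ge0_sume_distrl.
    by apply: eq_bigr => j _; rewrite EFinM -muleA [h x * _]muleC.
  by move=> j _; rewrite lee_fin mulr_ge0.
rewrite ge0_integral_sum//.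
- apply: eq_bigr => j _; rewrite ge0_integralZl//.
  + by rewrite [in RHS]integral_mkcond; congr (_ * _); apply: eq_integral => x _; rewrite epatch_indic.
  + by apply: emeasurable_funM => //; apply/measurable_EFinP; exact: measurable_indic.
  + by move=> x _; rewrite mule_ge0.
  + by rewrite lee_fin.
- move=> j; apply: emeasurable_funM => //; apply: emeasurable_funM => //.
  by apply/measurable_EFinP; exact: measurable_indic.
- by move=> j x _; rewrite !mule_ge0// lee_fin.
Qed.

Lemma distribution_step W c (r : R) : (forall j, measurable (W j)) ->
  trivIset setT W -> (0 <= r)%R ->
  distribution m (step W c) r = \sum_(j | (r < `|c j|)%R) m (W j).
Proof.
move=> mW tW r0; rewrite /distribution.
have mS := measurable_superlevel r%:E (measurable_step c mW).
rewrite -[X in m X]setIT -integral_indic//.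
transitivity (\int[m]_x \sum_(j | (r < `|c j|)%R) (\1_(W j) x)%:E).
  apply: eq_integral => x _; rewrite indicE.
  have [[j Wj]|/forallNP nW] := pselect (exists j, W j x).
    rewrite (_ : (x \in _) = (r < `|c j|)%R); last first.
      by apply/idP/idP; rewrite inE /mkset (step_in _ tW Wj) lte_fin.
    have W0 i : i != j -> \1_(W i) x = 0%R :> R.
      rewrite indicE => ij; rewrite memNset// => Wi; move/eqP: ij; apply.
      by apply: tW => //; exists x.
    have [rc|rc] := boolP (r < `|c j|)%R.
      by rewrite (bigD1 j)//= big1 ?indicE ?mem_set ?adde0// => i /andP[_ ij]; rewrite W0.
    by rewrite big1// => i ri; rewrite W0//; apply: contraNneq rc => <-.
  rewrite memNset ?big1// => [j _|]; first by rewrite indicE memNset//; exact: nW.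
  by rewrite /mkset step_out// abse0 lte_fin ltNge r0.
under eq_integral do rewrite -big_filter.
rewrite ge0_integral_sum//; last first.
  by move=> j; apply/measurable_EFinP; exact: measurable_indic.
rewrite big_filter; apply: eq_bigr => j _.
by rewrite integral_indic// setIT.
Qed.

End step_functions.

Lemma sum_ord_ltn N j : (\sum_(k < N) (k < j) = minn j N)%N.
Proof.
elim: N => [|N IH]; first by rewrite big_ord0 minn0.
rewrite big_ord_recr /= IH; case: (ltnP N j); lia.
Qed.

Section layered.
Context {d} {T : measurableType d} {R : realType}.
Variable m : {measure set T -> \bar R}.

(** The condition [G K = set0] lets the shells [G i `\` G i.+1], [i < K], exhaust
    [G 0]. *)
Definition nested (K : nat) (G : nat -> set T) :=
  [/\ forall k, measurable (G k), {homo G : k l / (k <= l)%N >-> l `<=` k} & G K = set0].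

Definition layered (e : R) (K : nat) (G : nat -> set T) :=
  step (fun k : 'I_K => G k) (fun=> e).

Definition shell (G : nat -> set T) (i : nat) := G i `\` G i.+1.

Context {K : nat} {G : nat -> set T}.
Hypothesis nG : nested K G.

Lemma nested_measurable k : measurable (G k). Proof. by case: nG. Qed.
Lemma nested_sub k l : (k <= l)%N -> G l `<=` G k. Proof. by case: nG => _ + _; exact. Qed.

Lemma measurable_shell i : measurable (shell G i).
Proof. by apply: measurableD; exact: nested_measurable. Qed.

Lemma trivIset_shell : trivIset setT (fun i : 'I_K => shell G i).
Proof.
move=> i j _ _ [x [[Gi nGi] [Gj nGj]]]; apply/val_inj/eqP; rewrite eqn_leq /=.
by apply/andP; split; rewrite leqNgt; apply/negP => ij;
  [apply: nGj|apply: nGi]; [move: Gi|move: Gj]; exact: nested_sub.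
Qed.

Lemma nested_shell k x : G k x -> exists2 i : 'I_K, (k <= i)%N & shell G i x.
Proof.
move=> Gk; have [_ _ GK] := nG.
have P0 : exists i, `[< G i x >] by exists k; apply/asboolP.
have PK i : `[< G i x >] -> (i <= K)%N.
  move=> /asboolP Gi; rewrite leqNgt; apply/negP => Ki.
  by have := nested_sub (ltnW Ki) Gi; rewrite GK.
case: (ex_maxnP P0 PK) => i /asboolP Gi maxi.
have iK : (i < K)%N.
  rewrite ltn_neqAle PK ?andbT; last exact/asboolP.
  by apply/eqP => iK; move: Gi; rewrite iK GK.
exists (Ordinal iK) => /=; first by apply: maxi; exact/asboolP.
split=> // Gi1; have := maxi i.+1; rewrite ltnn => H; suff : false by [].
by apply: H; exact/asboolP.
Qed.

Lemma layered_shell e (i : 'I_K) x : shell G i x -> layered e K G x = (e * i.+1%:R)%:E.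
Proof.
move=> [Gi nGi]; rewrite /layered /step; congr EFin.
rewrite -mulr_sumr; congr (_ * _)%R.
rewrite (eq_bigr (fun k : 'I_K => ((k < i.+1)%N%:R : R)%R)); last first.
  move=> k _; rewrite indicE; congr ((nat_of_bool _)%:R); apply/idP/idP.
    rewrite inE => Gk; rewrite ltnNge; apply/negP => ik; apply: nGi.
    exact: nested_sub Gk.
  by rewrite inE ltnS => ki; exact: nested_sub Gi.
by rewrite -natr_sum sum_ord_ltn (minn_idPl _).
Qed.

Lemma layered_out e x : ~ G 0%N x -> layered e K G x = 0.
Proof.
by move=> nG0; apply: step_out => k Gk; apply: nG0; exact: nested_sub Gk.
Qed.

Lemma layered_step e x :
  layered e K G x = step (fun i : 'I_K => shell G i) (fun i => e * i.+1%:R)%R x.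
Proof.
have [G0|nG0] := pselect (G 0%N x).
  have [i _ Ei] := nested_shell G0.
  by rewrite (layered_shell _ Ei) (step_in _ trivIset_shell Ei).
by rewrite layered_out// step_out// => i [Gi _]; apply: nG0; exact: nested_sub Gi.
Qed.

Lemma layered_ge e x (l : 'I_K) : (0 <= e)%R -> G l x -> (e * l.+1%:R)%:E <= layered e K G x.
Proof.
move=> e0 Gl; have [i li Ei] := nested_shell Gl.
by rewrite (layered_shell _ Ei) lee_fin ler_wpM2l// ler_nat.
Qed.

Lemma measurable_layered e : measurable_fun setT (layered e K G).
Proof. by apply: measurable_step => k; exact: nested_measurable. Qed.

End layered.

Section layers.
Context {d} {T : measurableType d} {R : realType}.
Implicit Types f : T -> \bar R.

(** The bound on [k] makes the family empty from its length on, as [nested]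
    requires. *)
Definition layer_set f (n k : nat) : set T :=
  [set x | (k < n * 2 ^ n)%N /\ (k.+1%:R * 2^-1 ^+ n)%:E < `|f x|].

Definition layers f n := layered (2^-1 ^+ n : R) (n * 2 ^ n) (layer_set f n).

Lemma nested_layer_set f n : measurable_fun setT f -> nested (n * 2 ^ n) (layer_set f n).
Proof.
move=> mf; split=> [k|k l kl x [ln fx]|].
- have [kn|kn] := boolP (k < n * 2 ^ n)%N.
    rewrite (_ : layer_set f n k = [set x | (k.+1%:R * 2^-1 ^+ n)%:E < `|f x|]).
      exact: measurable_superlevel.
    by apply/seteqP; split => x; [case|].
  by rewrite (_ : layer_set f n k = set0)//; apply/seteqP; split => x //; case; rewrite (negbTE kn).
- split; first exact: leq_ltn_trans kl ln.
  by apply: le_lt_trans fx; rewrite lee_fin ler_wpM2r ?exprn_ge0// ler_nat.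
- by apply/seteqP; split => x //; case; rewrite ltnn.
Qed.

Lemma increases_to_layers f : measurable_fun setT f ->
  increases_to (layers f) (abse \o f).
Proof.
have E n x : layers f n x = (dyadic_layers n `|f x|)%:E.
  congr EFin; apply: eq_bigr => k _; rewrite indicE; congr (_ * (nat_of_bool _)%:R)%R.
  by apply/idP/idP; rewrite inE /layer_set /=; [case|split].
move=> mf; split.
- by move=> n x; rewrite E lee_fin; apply: layer_sum_ge0; exact: exprn_ge0.
- by move=> n n' x nn'; rewrite !E lee_fin dyadic_layers_nondecreasing.
move=> x /=; apply/eqP; rewrite eq_le; apply/andP; split; last first.
  apply/ereal_supP => _ [n _ <-]; by rewrite E layer_sum_le.
rewrite leNgt; apply/negP.
have ub n : (dyadic_layers n `|f x|)%:E <= ereal_sup (range (layers f ^~ x)).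
  by apply: ereal_sup_ubound; exists n => //; rewrite E.
have : 0 <= ereal_sup (range (layers f ^~ x)).
  by apply: le_trans (ub 0%N); rewrite lee_fin; apply: layer_sum_ge0; exact: exprn_ge0.
move: ub; case: ereal_sup => [r ub r0| |//].
  by move=> /lt_dyadic_layers[|n]; [rewrite -lee_fin|apply/negP; rewrite -leNgt -lee_fin].
by move=> _ _; rewrite ltNge leey.
Qed.

End layers.

(** * Averaging over the shells of a layered function *)

Section rearranged_shells.
Context {R : realType} (Nb : (measurableTypeR R -> \bar R) -> \bar R).
Hypothesis riN : ri_function_norm (lebesgue_half R) Nb.
Let fnN := riN.1.

Lemma lebesgue_half_itv (a b : R) : (0 <= a)%R -> (a <= b)%R ->
  lebesgue_half R (`[a, b[%classic : set (measurableTypeR R)) = (b - a)%:E.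
Proof.
move=> a0 ab; rewrite lebesgue_halfE (_ : _ `&` _ = `[a, b[%classic); last first.
  apply/seteqP; split => x /=; rewrite !in_itv/= andbT; first by case.
  by move=> /andP[ax xb]; rewrite ax xb (le_trans a0 ax).
rewrite lebesgue_measure_itv /= lte_fin; case: ltP => [//|ba].
by rewrite (@le_anti _ _ a b) ?subrr// ab ba.
Qed.

Lemma measurable_co (a b : R) : measurable (`[a, b[%classic : set (measurableTypeR R)).
Proof. exact: measurable_itv. Qed.

Context {d} {T : measurableType d}.
Variable m : {measure set T -> \bar R}.
Context {K : nat} {G : nat -> set T}.
Hypotheses (nG : nested K G) (finG : m (G 0%N) < +oo).

Definition level_measure k : R := fine (m (G k)).
Local Notation t := level_measure.

(** The interval of [0, +oo[ on which the rearrangement of a layered function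
    takes the value that the function takes on the [i]-th shell. *)
Definition level_itv (i : nat) : set (measurableTypeR R) := `[t i.+1, t i[%classic.
Local Notation w i := (t i - t i.+1)%R.

Lemma nested_fin_num k : m (G k) \is a fin_num.
Proof.
rewrite ge0_fin_numE ?measure_ge0//; apply: le_lt_trans finG.
by apply: le_measure; rewrite ?inE; [exact: nested_measurable nG _..|exact: (nested_sub nG)].
Qed.

Lemma level_measureE k : m (G k) = (t k)%:E.
Proof. by rewrite fineK// nested_fin_num. Qed.

Lemma level_measure_ge0 k : (0 <= t k)%R.
Proof. by rewrite fine_ge0// measure_ge0. Qed.

Lemma level_measure_le k l : (k <= l)%N -> (t l <= t k)%R.
Proof.
move=> kl; rewrite -lee_fin -!level_measureE.
by apply: le_measure; rewrite ?inE; [exact: nested_measurable nG _..|exact: (nested_sub nG)].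
Qed.

Lemma level_width_ge0 i : (0 <= w i)%R.
Proof. by rewrite subr_ge0 level_measure_le. Qed.

Lemma measure_shell i : m (shell G i) = (w i)%:E.
Proof.
have mG k : measurable (G k) by exact: nested_measurable nG _.
have finGi : m (G i) < +oo by rewrite level_measureE ltry.
by rewrite EFinB -!level_measureE /shell measureD// (setIidr (nested_sub nG (leqnSn i))).
Qed.

Lemma measure_level_itv i : lebesgue_half R (level_itv i) = (w i)%:E.
Proof. by rewrite lebesgue_half_itv// ?level_measure_ge0// level_measure_le. Qed.

Lemma trivIset_level_itv : trivIset setT (fun i : 'I_K => level_itv i).
Proof.
move=> i j _ _ [x []]; rewrite /level_itv/= !in_itv/= => /andP[ix xi] /andP[jx xj].
apply/val_inj/eqP; rewrite eqn_leq /=; apply/andP; split; rewrite leqNgt; apply/negP => ij.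
  by have := lt_le_trans xi (le_trans (level_measure_le ij) jx); rewrite ltxx.
by have := lt_le_trans xj (le_trans (level_measure_le ij) ix); rewrite ltxx.
Qed.

(** Both step functions take each value on sets of equal measure. *)
Lemma rnorm_step_shell (c : 'I_K -> R) :
  rnorm Nb m (step (fun i : 'I_K => shell G i) c) =
  Nb (step (fun i : 'I_K => level_itv i) c).
Proof.
have mI : forall i : 'I_K, measurable (level_itv i) by move=> i; exact: measurable_co.
rewrite -(rnorm_half riN); last exact: measurable_step.
apply: rnorm_eq_distribution => // r r0; rewrite !distribution_step//.
- by apply: eq_bigr => i _; rewrite measure_level_itv measure_shell.
- exact: trivIset_level_itv.
- by move=> i; exact: measurable_shell nG _.
- exact: trivIset_shell.
Qed.

Lemma fnorm_itv_lty (a : R) : (0 <= a)%R ->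
  Nb (fun s => (\1_(`[0%R, a[%classic : set (measurableTypeR R)) s)%:E) < +oo.
Proof.
move=> a0; apply: (fnorm_indic fnN); first exact: measurable_co.
by rewrite lebesgue_half_itv// ltry.
Qed.

End rearranged_shells.

Arguments level_measure {R d T} m G k.
Arguments level_itv {R d T} m G i.

Lemma sum_measure_disjoint_le {d} {T : measurableType d} {R : realType}
    (m : {measure set T -> \bar R}) (J : finType) (W : J -> set T) (A : set T) :
  (forall j, measurable (W j)) -> trivIset setT W -> measurable A ->
  (forall j, W j `<=` A) -> \sum_j m (W j) <= m A.
Proof.
move=> mW tW mA WA.
have := @distribution_step _ _ _ m _ W (fun=> 1%R) 0%R mW tW (lexx _).
rewrite (eq_bigl predT) => [<-|j]; last by rewrite normr1 ltr01.
apply: le_measure; rewrite ?inE//.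
  exact: measurable_superlevel (measurable_step _ mW).
move=> x; rewrite /mkset; have [[j Wj] _|/forallNP nW] := pselect (exists j, W j x); first exact: WA Wj.
by rewrite step_out// abse0 ltxx.
Qed.

Section averaging.
Context {R : realType} (Nb : (measurableTypeR R -> \bar R) -> \bar R).
Hypothesis riN : ri_function_norm (lebesgue_half R) Nb.
Let fnN := riN.1.
Context {d} {T : measurableType d}.
Variable m : {measure set T -> \bar R}.
Context {K : nat} {G : nat -> set T}.
Hypotheses (nG : nested K G) (finG : m (G 0%N) < +oo).
Context {e : R} {L : nat} {H : nat -> set T}.
Hypotheses (e0 : (0 <= e)%R) (nH : nested L H).

Local Notation t := (level_measure m G).
Local Notation w i := (t i - t i.+1)%R.
Local Notation I := (level_itv m G).
Local Notation E := (shell G).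

Let v l i : R := fine (m (H l `&` E i)).

Let mHE l i : measurable (H l `&` E i).
Proof. by apply: measurableI; [exact: nested_measurable nH _|exact: measurable_shell nG _]. Qed.

Let mHE_le l i : m (H l `&` E i) <= (w i)%:E.
Proof.
rewrite -(measure_shell nG finG); apply: le_measure; rewrite ?inE//.
  exact: measurable_shell nG _.
Qed.

Let vE l i : m (H l `&` E i) = (v l i)%:E.
Proof.
rewrite fineK// ge0_fin_numE ?measure_ge0//.
by apply: le_lt_trans (mHE_le l i) _; rewrite ltry.
Qed.

Let v_ge0 l i : (0 <= v l i)%R. Proof. by rewrite fine_ge0// measure_ge0. Qed.

Let v_le l i : (v l i <= w i)%R. Proof. by rewrite -lee_fin -vE. Qed.

Let v_mono l l' i : (l <= l')%N -> (v l' i <= v l i)%R.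
Proof.
move=> ll'; rewrite -lee_fin -!vE; apply: le_measure; rewrite ?inE//.
by apply: setSI; exact: (nested_sub nH).
Qed.

Let w_ge0 i : (0 <= w i)%R. Proof. exact: (level_width_ge0 nG finG). Qed.

Section pieces.
Variable P' : nat.
Local Notation P := P'.+1.
Local Notation u i := (w i / P%:R)%R.

Let piece (j : 'I_K * 'I_P) : set (measurableTypeR R) :=
  `[(t j.1.+1 + j.2%:R * u j.1)%R, (t j.1.+1 + j.2.+1%:R * u j.1)%R[%classic.

Let u_ge0 i : (0 <= u i)%R. Proof. by rewrite divr_ge0// w_ge0. Qed.

Let piece_sub j : piece j `<=` I j.1.
Proof.
move=> x; rewrite /piece /level_itv /= !in_itv /= => /andP[h1 h2]; apply/andP; split.
  by apply: le_trans h1; rewrite lerDl mulr_ge0.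
apply: lt_le_trans h2 _; rewrite -lerBrDl mulrA ler_pdivrMr// mulrC ler_wpM2l//.
by rewrite ler_nat ltn_ord.
Qed.

Let trivIset_piece : trivIset setT piece.
Proof.
move=> [i p] [j q] _ _ [x [xi xj]].
have ij : i = j.
  by apply: (trivIset_level_itv nG finG) => //; exists x; split; [exact: piece_sub xi|exact: piece_sub xj].
subst j; congr pair; apply/val_inj/eqP; rewrite eqn_leq /=.
move: xi xj; rewrite /piece/= !in_itv/= => /andP[pi ip] /andP[qi iq].
apply/andP; split; rewrite leqNgt; apply/negP => pq.
  suff /(lt_le_trans iq)/lt_le_trans/(_ pi) :
    (t i.+1 + q.+1%:R * u i <= t i.+1 + p%:R * u i)%R by rewrite ltxx.
  by rewrite lerD2l ler_wpM2r// ler_nat.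
suff /(lt_le_trans ip)/lt_le_trans/(_ qi) :
  (t i.+1 + p.+1%:R * u i <= t i.+1 + q%:R * u i)%R by rewrite ltxx.
by rewrite lerD2l ler_wpM2r// ler_nat.
Qed.

Let measure_piece j : lebesgue_half R (piece j) = (u j.1)%:E.
Proof.
rewrite lebesgue_half_itv.
- by congr EFin; rewrite -natr1; ring.
- by rewrite addr_ge0 ?level_measure_ge0// mulr_ge0.
- by rewrite lerD2l ler_wpM2r// ler_nat.
Qed.

Let mpiece j : measurable (piece j). Proof. exact: measurable_co. Qed.

Let piece_cover (i : 'I_K) s : I i s -> exists p, piece (i, p) s.
Proof.
rewrite /level_itv /= in_itv /= => /andP[h1 h2].
have wi : (0 < w i)%R by lra.
have ui : (0 < u i)%R by rewrite divr_gt0.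
pose x := ((s - t i.+1) / u i)%R.
have x0 : (0 <= x)%R by rewrite divr_ge0 ?subr_ge0.
have xP : (Num.truncn x < P)%N.
  rewrite truncn_lt_nat// /x ltr_pdivrMr// mulrCA divff ?mulr1//; lra.
exists (Ordinal xP); rewrite /piece /= in_itv /=.
have /andP[] := truncn_itv x0.
rewrite /x ler_pdivlMr// ltr_pdivrMr// => a b.
by rewrite -lerBrDl a -ltrBlDl b.
Qed.

(** The number of pieces of the [i]-th interval that the part of [H l] in the
    [i]-th shell can fill. *)
Let q i l : nat := Num.truncn (P%:R * v l i / w i).

Let qx_ge0 i l : (0 <= P%:R * v l i / w i)%R.
Proof. by rewrite divr_ge0 ?mulr_ge0. Qed.

Let q_le i l : (u i * (q i l)%:R <= v l i)%R.
Proof.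
have [w0|w0] := eqVneq (w i) 0%R; first by rewrite w0 mul0r mul0r.
have wi : (0 < w i)%R by rewrite lt_neqAle eq_sym w0 w_ge0.
have : ((q i l)%:R <= P%:R * v l i / w i)%R by rewrite truncn_le.
by rewrite ler_pdivlMr// => H1; rewrite mulrAC ler_pdivrMr// mulrC [leRHS]mulrC.
Qed.

Let q_leP i l : (q i l <= P)%N.
Proof.
have [w0|w0] := eqVneq (w i) 0%R; first by rewrite /q w0 invr0 mulr0 truncn0.
have wi : (0 < w i)%R by rewrite lt_neqAle eq_sym w0 w_ge0.
rewrite -(ler_nat R); apply: le_trans (_ : P%:R * v l i / w i <= _)%R.
  by rewrite truncn_le.
by rewrite ler_pdivrMr// ler_wpM2l.
Qed.

Let q_gt i l : (0 < w i)%R -> (P%:R * v l i <= w i * (q i l)%:R + w i)%R.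
Proof.
move=> wi; have := truncnS_gt (P%:R * v l i / w i); rewrite -/(q i l) ltr_pdivrMr// -[X in (_ < X * _)%R]natr1 => /ltW.
by rewrite mulrDl mul1r [((q i l)%:R * _)%R]mulrC.
Qed.

Let q_mono i l l' : (l <= l')%N -> (q i l' <= q i l)%N.
Proof.
move=> ll'; rewrite truncn_ge_nat//; apply: le_trans (_ : P%:R * v l' i / w i <= _)%R; first by rewrite truncn_le.
rewrite ler_wpM2r ?invr_ge0//.
by rewrite ler_wpM2l// v_mono.
Qed.

(** The rearrangement of the layered function over the [i]-th interval, rounded
    down; [p] numbers the pieces of the interval. *)
Let sigma i p : R := (e * \sum_(l < L) (p < q i l)%N%:R)%R.

Let sigma_ge0 i p : (0 <= sigma i p)%R.
Proof. by rewrite mulr_ge0// sumr_ge0. Qed.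

Let sigma_sum i : (\sum_(p < P) sigma i p = e * \sum_(l < L) (q i l)%:R)%R.
Proof.
rewrite /sigma -mulr_sumr exchange_big /=; congr (_ * _)%R; apply: eq_bigr => l _.
by rewrite -natr_sum sum_ord_ltn (minn_idPl _).
Qed.

(** As [q i l] decreases in [l], a superlevel set of [sigma] is governed by a
    single layer, the same for all intervals. *)
Let sigma_level (r : R) : (0 <= r)%R ->
  (forall i p, (sigma i p <= r)%R) \/
  exists2 l : 'I_L, (forall i p, (r < sigma i p)%R -> (p < q i l)%N) & (r < e * l.+1%:R)%R.
Proof.
move=> r0; have [[l lr]|/forallNP nl] := pselect (exists l : 'I_L, (r < e * l.+1%:R)%R).
  right; case: (@arg_minnP _ l (fun l : 'I_L => r < e * l.+1%:R)%R val lr) => k kr mink.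
  exists k => // i p; apply: contraTT; rewrite -leqNgt -leNgt => qp.
  apply: (@le_trans _ _ (e * k%:R)%R).
    rewrite ler_wpM2l//; apply: (@le_trans _ _ (\sum_(l < L) (l < k)%N%:R)%R).
      apply: ler_sum => j _; rewrite ler_nat; case: (ltnP j k) => [_|kj]; first exact: leq_b1.
      by rewrite ltnNge (leq_trans (q_mono _ kj) qp).
    by rewrite -natr_sum sum_ord_ltn ler_nat geq_minl.
  rewrite leNgt; apply/negP => ek; case: k => [[|k] kL] /= in kr mink qp ek *.
    by move: ek; rewrite mulr0 ltNge r0.
  by have := mink (Ordinal (ltnW kL)) ek; rewrite /= ltnn.
left=> i p; apply: (@le_trans _ _ (e * L%:R)%R).
  rewrite ler_wpM2l// -natr_sum ler_nat -[leqRHS]card_ord -sum1_card.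
  by apply: leq_sum => l _; exact: leq_b1.
case: (posnP L) => [->|L0]; first by rewrite mulr0.
have L1 : (L.-1 < L)%N by rewrite prednK.
have := nl (Ordinal L1); rewrite /= prednK// => /negP; by rewrite -leNgt.
Qed.

Let shifted (r : 'I_P) := step piece (fun j => sigma j.1 (j.2 + r)%R).

Let rnorm_shifted r : Nb (shifted r) <= rnorm Nb m (layered e L H).
Proof.
rewrite -(rnorm_half riN); last exact: measurable_step.
apply: rnorm_le_distribution => // a a0; rewrite distribution_step//.
under eq_bigl do rewrite ger0_norm//.
case: (sigma_level a0) => [small|[l lq al]].
  by rewrite big_pred0 ?measure_ge0// => j; rewrite ltNge small.
apply: (@le_trans _ _ (\sum_(i < K) m (H l `&` E i))); last first.
  apply: (@le_trans _ _ (m (H l))).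
    apply: sum_measure_disjoint_le => //.
      move=> i j _ _ [x [[_ xi] [_ xj]]].
      by apply: (trivIset_shell nG) => //; exists x.
    exact: nested_measurable nH _.
  apply: le_measure; rewrite ?inE; [exact: nested_measurable nH _| |].
    exact: measurable_superlevel (measurable_layered nH e).
  move=> x Hl; rewrite /mkset; apply: lt_le_trans (lee_abs (layered e L H x)).
  by apply: lt_le_trans (layered_ge nH e0 Hl); rewrite lte_fin.
rewrite (eq_bigr (fun j : 'I_K * 'I_P => (u j.1)%:E)); last by move=> j _; exact: measure_piece.
rewrite big_mkcond /= -(pair_bigA _ (fun (i : 'I_K) (p : 'I_P) => if (a < sigma i (p + r)%R)%R then (u i)%:E else 0)) /=.
apply: lee_sum => i _; rewrite vE.
have -> : \sum_(p < P) (if (a < sigma i (p + r)%R)%R then (u i)%:E else 0) =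
    \sum_(p < P) (if (a < sigma i p)%R then (u i)%:E else 0).
  by rewrite [RHS](reindex_inj (addIr r)).
apply: (@le_trans _ _ (\sum_(p < P) (u i * (p < q i l)%N%:R)%:E)).
  apply: lee_sum => p _; case: ifPn => [/lq ->|_]; rewrite ?mulr1// lee_fin mulr_ge0//.
by rewrite sumEFin lee_fin -mulr_sumr -natr_sum sum_ord_ltn (minn_idPl _).
Qed.

(** The function averaged over the cyclic shifts falls short of the average over
    the shell by at most one unit [e] per layer and piece, whence the error
    term [e L / P]. *)
Lemma averaging_pieces (a : 'I_K -> R) : (forall i, 0 <= a i)%R ->
  (forall i, a i * w i <= e * \sum_(l < L) v l i)%R ->
  Nb (step (fun i : 'I_K => I i) a) <= rnorm Nb m (layered e L H) +
    (e * L%:R / P%:R)%:E * Nb (fun s => (\1_(`[0%R, t 0%N[%classic : set (measurableTypeR R)) s)%:E).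
Proof.
move=> a0 aw.
pose one := (fun s => (\1_(`[0%R, t 0%N[%classic : set (measurableTypeR R)) s)%:E) : measurableTypeR R -> \bar R.
pose c : R := (e * L%:R / P%:R)%R.
have c0 : (0 <= c)%R by rewrite divr_ge0// mulr_ge0.
have m1 : measurable_fun setT one.
  by apply/measurable_EFinP; apply: measurable_indic; exact: measurable_co.
pose S r s : \bar R := (P%:R^-1)%:E * shifted r s.
have mS r : measurable_fun setT (S r) by apply: emeasurable_funM => //; exact: measurable_step.
have mSS : measurable_fun setT (fun s => \sum_(r < P) S r s) by exact: emeasurable_sum.
have mc1 : measurable_fun setT (fun s => c%:E * one s) by exact: emeasurable_funM.
apply: (@le_trans _ _ (Nb ((fun s => \sum_(r < P) S r s) \+ (fun s => c%:E * one s)))); last first.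
  apply: le_trans (fnormD fnN mSS mc1) _; apply: leeD; last first.
    by rewrite (fnormZ fnN)// ger0_norm.
  apply: le_trans (fnorm_sum riN _ mS) _.
  apply: (@le_trans _ _ (\sum_(r < P) (P%:R^-1)%:E * rnorm Nb m (layered e L H))).
    apply: lee_sum => r _; rewrite (fnormZ fnN) ?ger0_norm//; last exact: measurable_step.
    by rewrite lee_wpmul2l// rnorm_shifted.
  rewrite -ge0_sume_distrl => [|i _]; last by rewrite lee_fin.
  by rewrite sumEFin sumr_const card_ord -[(_ *+ P)%R]mulr_natl mulfV// mul1e.
have S0 r s : 0 <= S r s by rewrite mule_ge0// step_ge0.
apply: (fnorm_le fnN).
- by apply: measurable_step => i; exact: measurable_co.
- exact: emeasurable_funD.
apply: aeW => s.
have c1 : 0 <= c%:E * one s by rewrite mule_ge0// lee_fin.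
rewrite gee0_abs; last exact: step_ge0.
rewrite gee0_abs; last by rewrite adde_ge0// sume_ge0.
have [[i Ii]|/forallNP nI] := pselect (exists i : 'I_K, I i s); last first.
  by rewrite step_out// adde_ge0// sume_ge0.
have [p pis] := piece_cover Ii.
rewrite (step_in _ (trivIset_level_itv nG finG) Ii).
have -> : \sum_(r < P) S r s = (P%:R^-1 * (e * \sum_(l < L) (q i l)%:R))%:E.
  rewrite -sigma_sum [X in (_ * X)%R](reindex_inj (addrI p)) mulr_sumr -sumEFin.
  by apply: eq_bigr => r _; rewrite /S /shifted (step_in _ trivIset_piece pis).
have -> : one s = 1.
  rewrite /one indicE mem_set//= in_itv/=; move: Ii; rewrite /level_itv/= in_itv/= => /andP[i1 i2].
  rewrite (le_trans _ i1) ?level_measure_ge0//= (lt_le_trans i2)//.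
  exact: level_measure_le nG finG _ _ _.
rewrite mule1 lee_fin.
have wi : (0 < w i)%R by move: Ii; rewrite /level_itv/= in_itv/= => /andP[i1 i2]; lra.
rewrite -(ler_pM2r wi) (le_trans (aw i))//.
rewrite -(ler_pM2l (ltr0Sn R P')) mulrCA mulr_sumr.
have -> : (P%:R * ((P%:R^-1 * (e * \sum_(l < L) (q i l)%:R) + c) * w i) =
   e * \sum_(l < L) (w i * (q i l)%:R + w i))%R.
  rewrite big_split /= sumr_const card_ord -mulr_sumr /c -[(w i *+ L)%R]mulr_natl.
  by field; rewrite addrC natr1 pnatr_eq0.
by rewrite ler_wpM2l//; apply: ler_sum => l _; exact: q_gt.
Qed.

End pieces.

(** Each interval is cut into [P] pieces of equal length, and the function,
    rearranged over the interval, is rounded down to be constant on the pieces.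
    The mean of its cyclic shifts by pieces is constant on the interval, whereas
    each single shift has a distribution function dominated by that of the
    original. Then [P] tends to infinity. *)
Lemma averaging (a : 'I_K -> R) : (forall i, 0 <= a i)%R ->
  (forall i, (a i * w i)%:E <= e%:E * \sum_(l < L) m (H l `&` E i)) ->
  Nb (step (fun i : 'I_K => I i) a) <= rnorm Nb m (layered e L H).
Proof.
move=> a0 aw.
have aw' i : (a i * w i <= e * \sum_(l < L) v l i)%R.
  rewrite -lee_fin (le_trans (aw i))// EFinM -sumEFin.
  by under eq_bigr do rewrite vE.
have := fnorm_itv_lty riN (@level_measure_ge0 _ _ _ m G 0).
have := fun n => averaging_pieces n a0 aw'.
set N1 := Nb (fun s => (\1__ s)%:E) => key N1y.
have N10 : 0 <= N1.
  apply: (fnorm_ge0 fnN); apply/measurable_EFinP; apply: measurable_indic; exact: measurable_co.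
have N1E : N1 = (fine N1)%:E by rewrite fineK// ge0_fin_numE.
apply/lee_addgt0Pr => x x0.
pose C := (e * L%:R * fine N1)%R.
have C0 : (0 <= C)%R by rewrite !mulr_ge0// fine_ge0.
pose n := Num.truncn (C / x).
apply: le_trans (key n) _; rewrite leeD2l// N1E -EFinM lee_fin.
have nx : (C / x < n.+1%:R)%R by exact: truncnS_gt.
rewrite mulrAC ler_pdivrMr//; move: nx; rewrite ltr_pdivrMr// mulrC => /ltW.
by rewrite /C.
Qed.

End averaging.

(** * The associate norm and duality *)

(** The Hahn-Banach theorem for the span of finitely many vectors, obtained by
    extending a functional one vector at a time. The vectors need not be
    independent, since the functional is only recorded through the values
    [beta] that it gives them. *)
Lemma hahn_banach_span (R : realType) (V : lmodType R) (p : V -> R) (v : nat -> V) (n : nat) :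
  (forall x y, p (x + y)%R <= p x + p y)%R ->
  (forall a x, p (a *: x) = `|a| * p x)%R ->
  exists2 beta : nat -> R, beta 0%N = p (v 0%N) &
    forall c : nat -> R,
      (\sum_(i < n.+1) c i * beta i <= p (\sum_(i < n.+1) c i *: v i))%R.
Proof.
move=> pD pZ.
have p0 : p 0%R = 0%R by rewrite -(scale0r (0 : V)%R) pZ normr0 mul0r.
have p_ge0 x : (0 <= p x)%R.
  have := pD x (- x)%R; rewrite subrr p0 -scaleN1r pZ normrN1 mul1r; lra.
elim: n => [|n [beta b0 IH]].
  exists (fun=> p (v 0%N)) => // c.
  by rewrite !big_ord1 pZ ler_wpM2r ?p_ge0 ?ler_norm.
pose l (c : nat -> R) := (\sum_(i < n.+1) c i * beta i)%R.
pose X (c : nat -> R) := (\sum_(i < n.+1) c i *: v i)%R.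
pose S := [set (l c - p (X c - v n.+1))%R | c in setT].
have lD c c' : (l c + l c' = l (fun i => c i + c' i))%R.
  by rewrite /l -big_split /=; apply: eq_bigr => i _; rewrite mulrDl.
have XD c c' : (X c + X c' = X (fun i => c i + c' i))%R.
  by rewrite /X -big_split /=; apply: eq_bigr => i _; rewrite scalerDl.
have lZ a c : (l (fun i => a * c i) = a * l c)%R.
  by rewrite /l mulr_sumr; apply: eq_bigr => i _; rewrite mulrA.
have XZ a c : (X (fun i => a * c i) = a *: X c)%R.
  by rewrite /X scaler_sumr; apply: eq_bigr => i _; rewrite scalerA.
have ubS c' : ubound S (p (X c' + v n.+1) - l c')%R.
  move=> _ [c _ <-]; rewrite lerBrDr addrAC lerBlDr lD.
  apply: le_trans (IH _) _; rewrite -/(X (fun i => c i + c' i)%R) -XD.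
  rewrite (_ : X c + X c' = (X c' + v n.+1) + (X c - v n.+1))%R ?pD//.
  by rewrite addrACA subrr addr0 addrC.
have S0 : S !=set0 by exists (l (fun=> 0%R) - p (X (fun=> 0%R) - v n.+1))%R, (fun=> 0%R).
(* The value at the new vector; [ubS] is the compatibility of the two families of
   constraints on it, those from negative and from positive coefficients. *)
pose g := sup S.
have g_ge c : (l c - p (X c - v n.+1) <= g)%R.
  apply: ub_le_sup; last by exists c.
  by exists (p (X c + v n.+1) - l c)%R; exact: ubS.
have g_le c : (g <= p (X c + v n.+1) - l c)%R by apply: ge_sup => //; exact: ubS.
exists (fun i => if i == n.+1 then g else beta i) => [//|c].
rewrite big_ord_recr [in leRHS]big_ord_recr /= eqxx.
rewrite (eq_bigr (fun i : 'I_n.+1 => c i * beta i)%R); last first.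
  by move=> i _; rewrite ltn_eqF.
rewrite -/(l c) -/(X c).
have [a0|a0|->] := ltgtP (c n.+1) 0%R; last by rewrite mul0r scale0r !addr0; exact: IH.
- have [a ca] : exists a, (c n.+1 = - a)%R by exists (- c n.+1)%R; rewrite opprK.
  have {}a0 : (0 < a)%R by rewrite -oppr_lt0 -ca.
  have := g_ge (fun i => a^-1 * c i)%R; rewrite lZ XZ -(ler_pM2l a0) mulrBr mulrA mulfV ?gt_eqF// mul1r.
  rewrite -{1}(gtr0_norm a0) -pZ scalerBr scalerA mulfV ?gt_eqF// scale1r ca scaleNr mulNr; lra.
- have := g_le (fun i => (c n.+1)^-1 * c i)%R; rewrite lZ XZ -(ler_pM2l a0) mulrBr mulrA mulfV ?gt_eqF// mul1r.
  rewrite -{2}(gtr0_norm a0) -pZ scalerDr scalerA mulfV ?gt_eqF// scale1r; lra.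
Qed.

Section associate.
Context {R : realType} (Nb : (measurableTypeR R -> \bar R) -> \bar R).
Hypothesis riN : ri_function_norm (lebesgue_half R) Nb.
Context {d} {T : measurableType d}.
Variable m : {measure set T -> \bar R}.
Implicit Types f g h : T -> \bar R.

Lemma rnorm0 : rnorm Nb m (cst 0) = 0.
Proof.
have -> : rnorm Nb m (cst 0) = rnorm Nb (lebesgue_half R) (cst 0).
  apply: rnorm_eq_distribution => // r r0; rewrite /distribution.
  have E (S : Type) : [set x : S | r%:E < `|(cst 0 : S -> \bar R) x|] = set0.
    by apply/seteqP; split => x //=; rewrite normr0 lte_fin ltNge r0.
  by rewrite !E !measure0.
by rewrite rnorm_half// fnorm0.
Qed.

(** The associate norm of X(w), with [m] the measure of density [w]. *)
Definition assoc h : \bar R := ereal_sup [set \int[m]_x `|h x * g x| | g in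
  [set g : T -> \bar R | measurable_fun setT g /\ rnorm Nb m g <= 1]].

Lemma assoc_ge h g : measurable_fun setT g -> rnorm Nb m g <= 1 ->
  \int[m]_x `|h x * g x| <= assoc h.
Proof. by move=> mg g1; apply: ereal_sup_ubound; exists g. Qed.

(** Real bounds [a] and [b] avoid the products [0 * +oo]; the case where the norm
    of [g] vanishes is reached by letting [b'] decrease to [b]. *)
Lemma hoelder_assoc h g (a b : R) : measurable_fun setT h -> measurable_fun setT g ->
  assoc h <= a%:E -> rnorm Nb m g <= b%:E -> \int[m]_x `|h x * g x| <= (a * b)%:E.
Proof.
move=> mh mg ha gb.
have a0 : (0 <= a)%R.
  rewrite -lee_fin; apply: le_trans ha; apply: le_trans (assoc_ge h (g := cst 0) _ _).
  - by apply: integral_ge0 => x _; exact: abse_ge0.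
  - exact: measurable_cst.
  - by rewrite rnorm0.
have b0 : (0 <= b)%R by rewrite -lee_fin (le_trans _ gb)// rnorm_ge0.
suff key (b' : R) : (b < b')%R -> \int[m]_x `|h x * g x| <= (a * b')%:E.
  apply/lee_addgt0Pr => e e0; have a1 : (0 < a + 1)%R by rewrite ltr_wpDl.
  apply: le_trans (key (b + e / (a + 1))%R _) _; first by rewrite ltrDl divr_gt0.
  rewrite -EFinD lee_fin mulrDr lerD2l mulrCA ler_piMr ?ltW// ltr_pdivrMr// mul1r.
  by rewrite ltrDl.
move=> bb'; have b'0 : (0 < b')%R by exact: le_lt_trans bb'.
have : \int[m]_x `|h x * ((b'^-1)%:E * g x)| <= a%:E.
  apply: le_trans ha; apply: assoc_ge; first exact: emeasurable_funM.
  by rewrite rnormZ ?invr_gt0// lee_pdivrMl// mule1 (le_trans gb)// lee_fin ltW.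
under eq_integral.
  move=> x _; rewrite muleCA abseM /= gtr0_norm ?invr_gt0//; over.
rewrite ge0_integralZl//=; last 2 first.
- by apply: measurableT_comp => //; exact: emeasurable_funM.
- by rewrite lee_fin invr_ge0 ltW.
by rewrite lee_pdivrMl// EFinM muleC.
Qed.

(** Every measurable function is the increasing limit of its truncations to the
    sets [B n], and these of the layered functions [layers]. Estimates thus need
    only be proved for finite layered functions, where integrals and
    rearrangements are finite sums. *)
Lemma layered_ind (B : nat -> set T) (P : (T -> \bar R) -> Prop) f :
  (forall n, measurable (B n)) -> nondecreasing_seq B -> \bigcup_n B n = setT ->
  (forall n, m (B n) < +oo) ->
  (forall A F, (forall k, measurable_fun setT (A k)) -> increases_to A F ->
     (forall k, P (A k)) -> P F) ->
  measurable_fun setT f ->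
  (forall e L H, (0 <= e)%R -> nested L H -> m (H 0%N) < +oo ->
    (forall x, layered e L H x <= `|f x|) -> P (layered e L H)) ->
  P (abse \o f).
Proof.
move=> mB ndB UB finB Plim mf Play.
pose fB n x := `|f x| * (\1_(B n) x)%:E.
have mfB n : measurable_fun setT (fB n).
  by apply: emeasurable_funM; [exact: measurableT_comp|apply/measurable_EFinP; exact: measurable_indic].
have fB0 n x : 0 <= fB n x by rewrite mule_ge0.
apply: (Plim fB) => //.
  split=> // [k l x kl|x].
    rewrite lee_wpmul2l// lee_fin !indicE ler_nat.
    have [kx|] := boolP (x \in B k) => //.
    rewrite (_ : x \in B l = true)//; apply: mem_set.
    by move/subsetPset : (ndB _ _ kl); apply; exact: set_mem.
  apply/eqP; rewrite eq_le; apply/andP; split.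
    have [n _ Bn] : (\bigcup_n B n) x by rewrite UB.
    by apply: ereal_sup_ubound; exists n => //; rewrite /fB indicE mem_set// mule1.
  apply/ereal_supP => _ [n _ <-]; rewrite /fB indicE /=.
  by case: (_ \in _); rewrite ?mule1 ?mule0.
move=> n; have -> : fB n = abse \o fB n by apply/funext => x /=; rewrite gee0_abs.
apply: (Plim (layers (fB n))) => [k||k].
- exact: measurable_layered (nested_layer_set _ (mfB n)) _.
- exact: increases_to_layers.
apply: Play => //.
- exact: nested_layer_set.
- apply: le_lt_trans (finB n); apply: le_measure; rewrite ?inE//.
    exact: nested_measurable (nested_layer_set _ (mfB n)) _.
  move=> x [_]; rewrite gee0_abs// /fB indicE; have [/set_mem//|_] := boolP (x \in B n).
  by rewrite mule0 lte_fin ltNge mulr_ge0// exprn_ge0.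
- move=> x; apply: (le_trans (increases_to_le k x (increases_to_layers (mfB n)))).
  rewrite /= gee0_abs// /fB indicE.
  by case: (_ \in _); rewrite ?mule1 ?mule0.
Qed.

End associate.

Section duality.
Context {R : realType} (Nb : (measurableTypeR R -> \bar R) -> \bar R).
Hypothesis riN : ri_function_norm (lebesgue_half R) Nb.
Let fnN := riN.1.
Context {d} {T : measurableType d}.
Variable m : {measure set T -> \bar R}.
Variable B : nat -> set T.
Hypotheses (mB : forall n, measurable (B n)) (ndB : nondecreasing_seq B)
  (UB : \bigcup_n B n = setT) (finB : forall n, m (B n) < +oo).
Implicit Types f g h : T -> \bar R.

Lemma integral_layered e K G h : nested K G -> (0 <= e)%R ->
  measurable_fun setT h -> (forall x, 0 <= h x) ->
  \int[m]_x (layered e K G x * h x) = \sum_(k < K) e%:E * \int[m]_(x in G k) h x.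
Proof. by move=> nG e0 mh h0; rewrite integral_step// => k; exact: nested_measurable nG _. Qed.

Lemma assoc_le h (c : \bar R) : measurable_fun setT h ->
  (forall e L H, (0 <= e)%R -> nested L H -> m (H 0%N) < +oo ->
     rnorm Nb m (layered e L H) <= 1 ->
     \int[m]_x (layered e L H x * `|h x|) <= c) ->
  assoc Nb m h <= c.
Proof.
move=> mh Hc; apply/ereal_supP => _ [g [mg g1] <-].
under eq_integral do rewrite abseM muleC.
apply: (@layered_ind _ _ _ m B (fun f => \int[m]_x (f x * `|h x|) <= c) g) => //.
- move=> A F mA AF Ac; apply: (integral_increases_to_le (increases_toMr _ AF)) => //.
  by move=> k; apply: emeasurable_funM => //; exact: measurableT_comp.
- move=> e L H e0 nH finH Hg; apply: Hc => //; apply: le_trans g1.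
  apply: rnorm_le => //; first exact: measurable_layered nH _.
  by move=> x; rewrite gee0_abs ?step_ge0.
Qed.

Lemma integral_layered_in e L H D : nested L H -> (0 <= e)%R -> measurable D ->
  \int[m]_(x in D) layered e L H x = \sum_(l < L) e%:E * m (H l `&` D).
Proof.
move=> nH e0 mD; rewrite integral_mkcond.
transitivity (\int[m]_x (layered e L H x * (\1_D x)%:E)).
  by apply: eq_integral => x _; rewrite epatch_indic.
rewrite integral_layered//; last by apply/measurable_EFinP; exact: measurable_indic.
apply: eq_bigr => l _; rewrite integral_indic 1?setIC//.
exact: nested_measurable nH _.
Qed.

Section layered_duality.
Context {K : nat} {G : nat -> set T} {e : R}.
Hypotheses (nG : nested K G) (finG : m (G 0%N) < +oo) (e0 : (0 <= e)%R).

Local Notation t := (level_measure m G).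
Local Notation w i := (t i - t i.+1)%R.
Local Notation I := (fun i : 'I_K => level_itv m G i).
Local Notation E := (fun i : 'I_K => shell G i).

Let mI i : measurable (I i). Proof. exact: measurable_co. Qed.
Let mE i : measurable (E i). Proof. exact: measurable_shell nG _. Qed.

Lemma fnorm_step_lty (c : 'I_K -> R) : Nb (step I c) < +oo.
Proof.
pose M := (\sum_i `|c i|)%R.
have M0 : (0 <= M)%R by exact: sumr_ge0.
pose one := (fun s => (\1_(`[0%R, t 0%N[%classic : set (measurableTypeR R)) s)%:E) : measurableTypeR R -> \bar R.
have m1 : measurable_fun setT one.
  by apply/measurable_EFinP; apply: measurable_indic; exact: measurable_co.
have one_lty : Nb one < +oo by have := fnorm_itv_lty riN (@level_measure_ge0 _ _ _ m G 0).
apply: (@le_lt_trans _ _ (Nb (fun s => M%:E * one s))); last first.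
  by rewrite (fnormZ fnN)// ger0_norm// lte_mul_pinfty// lee_fin.
apply: (fnorm_le fnN).
- exact: measurable_step.
- exact: emeasurable_funM.
apply: aeW => s; have [[i Ii]|/forallNP nI] := pselect (exists i : 'I_K, I i s); last first.
  by rewrite step_out// abse0 abse_ge0.
rewrite (step_in _ (trivIset_level_itv nG finG) Ii).
have -> : one s = 1.
  rewrite /one indicE mem_set//= in_itv/=; move: Ii; rewrite /level_itv/= in_itv/= => /andP[i1 i2].
  rewrite (le_trans _ i1) ?(@level_measure_ge0 _ _ _ m G)//= (lt_le_trans i2)//.
  exact: level_measure_le nG finG _ _ _.
by rewrite mule1 lee_fin (ger0_norm M0) /M (bigD1 i)//= lerDl sumr_ge0.
Qed.

(** The norming function is constant on the shells of the layered function. Its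
    values come from a supporting functional of the norm on step functions,
    given by Hahn-Banach, and its associate norm is at most 1 because averaging
    over shells is a contraction. *)
Lemma layered_norming : exists h, [/\ measurable_fun setT h, forall x, 0 <= h x,
  assoc Nb m h <= 1 &
  rnorm Nb m (layered e K G) <= \int[m]_x (layered e K G x * h x)].
Proof.
pose stp (r : 'rV[R]_K) := step I (fun i => r ord0 i).
pose p r := fine (Nb (stp r)).
have mstp r : measurable_fun setT (stp r) by exact: measurable_step.
have N0 r : 0 <= Nb (stp r) by exact: (fnorm_ge0 fnN).
have pE r : Nb (stp r) = (p r)%:E by rewrite fineK// ge0_fin_numE// fnorm_step_lty.
have pD r s : (p (r + s) <= p r + p s)%R.
  rewrite -lee_fin EFinD -!pE; apply: le_trans (fnormD fnN (mstp r) (mstp s)).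
  rewrite (_ : stp (r + s)%R = stp r \+ stp s)//; apply/funext => x.
  by rewrite /stp /step /= -EFinD -big_split; congr EFin; apply: eq_bigr => i _; rewrite mxE mulrDl.
have pZ a r : (p (a *: r) = `|a| * p r)%R.
  apply: EFin_inj; rewrite EFinM -!pE -(fnormZ fnN)//.
  congr (Nb _); apply/funext => x.
  by rewrite /stp /step -EFinM mulr_sumr; congr EFin; apply: eq_bigr => i _; rewrite mxE mulrA.
pose a (i : 'I_K) : R := (e * i.+1%:R)%R.
(* The first vector is the one to be normed, the others the canonical basis. *)
pose v (k : nat) : 'rV[R]_K := \row_j (if k is k'.+1 then (j == k' :> nat)%:R else a j)%R.
have vS (i : 'I_K) : v (bump 0 i) = (\row_j (j == i)%:R)%R by [].
have [beta beta0 betaP] := hahn_banach_span v K pD pZ.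
pose b (i : 'I_K) := beta i.+1.
have b_le (c : 'I_K -> R) : (\sum_i c i * b i <= p (\row_i c i))%R.
  have := betaP (fun k => if k is k'.+1 then oapp c 0 (insub k' : option 'I_K) else 0)%R.
  rewrite !big_ord_recl /= mul0r scale0r !add0r.
  under eq_bigr do rewrite valK /=.
  under [X in p X]eq_bigr do rewrite valK /=.
  suff -> : (\sum_(i < K) c i *: v (bump 0 i) = \row_i c i)%R by [].
  apply/rowP => j; rewrite summxE (bigD1 j)//= vS !mxE eqxx mulr1 big1 ?addr0// => i ij.
  by rewrite vS !mxE eq_sym (negbTE ij) mulr0.
(* [v 0] is a combination of the other vectors, whence a relation on [beta]. *)
have beta0_le : (beta 0%N <= \sum_i a i * b i)%R.
  have := betaP (fun k => if k is k'.+1 then - oapp a 0 (insub k' : option 'I_K) else 1)%R.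
  rewrite !big_ord_recl /= mul1r scale1r.
  under eq_bigr do rewrite valK /= mulNr.
  under [X in p (_ + X)%R]eq_bigr do rewrite valK /= scaleNr.
  rewrite !sumrN.
  suff -> : (v 0%N - \sum_(i < K) a i *: v (bump 0 i) = 0)%R.
    by rewrite -(scale0r (0 : 'rV[R]_K)%R) pZ normr0 mul0r subr_le0.
  apply/rowP => j; rewrite !mxE summxE (bigD1 j)//= vS !mxE eqxx mulr1 big1 ?addr0 ?subrr// => i ij.
  by rewrite vS !mxE eq_sym (negbTE ij) mulr0.
(* Shells of measure zero are invisible to the norm. *)
have b_null (i : 'I_K) : w i = 0%R -> (b i <= 0)%R.
  move=> wi; have := b_le (fun j => (j == i)%:R)%R.
  rewrite (bigD1 i)//= eqxx mul1r big1 ?addr0; last by move=> j /negbTE ->; rewrite mul0r.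
  move=> /le_trans; apply; rewrite -lee_fin -pE /stp.
  rewrite (_ : step _ _ = cst 0) ?(fnorm0 riN)//; apply/funext => x.
  rewrite /step /= big1// => j _; rewrite mxE; case: eqVneq => [->|]; rewrite ?mul0r//.
  rewrite mul1r indicE memNset// /level_itv/= in_itv/= => /andP[h1 h2].
  by have := le_lt_trans h1 h2; rewrite ltNge; move/eqP: wi; rewrite subr_eq0 => /eqP ->; rewrite lexx.
pose c (i : 'I_K) : R := (`|b i| / w i)%R.
have w_ge0 (i : 'I_K) : (0 <= w i)%R by exact: (level_width_ge0 nG finG).
have c0 i : (0 <= c i)%R by rewrite divr_ge0.
have trE : trivIset setT E by exact: trivIset_shell.
exists (step E c); split.
- exact: measurable_step.
- by move=> x; exact: step_ge0.
- apply: assoc_le => [|e' L H e'0 nH finH H1]; first exact: measurable_step.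
  have l0 x : 0 <= layered e' L H x by exact: step_ge0.
  have ml : measurable_fun setT (layered e' L H) by exact: measurable_layered nH _.
  under eq_integral do rewrite gee0_abs ?step_ge0// muleC.
  rewrite integral_step//.
  pose A (i : 'I_K) := e'%:E * \sum_(l < L) m (H l `&` shell G i).
  have AE i : \int[m]_(x in E i) layered e' L H x = A i.
    by rewrite integral_layered_in// /A ge0_sume_distrr.
  have A0 i : 0 <= A i by rewrite -AE; exact: integral_ge0.
  have Afin i : A i \is a fin_num.
    rewrite ge0_fin_numE// /A lte_mul_pinfty//; rewrite ?lee_fin//.
    apply: lte_sum_pinfty => l _; apply: le_lt_trans (_ : m (shell G i) < +oo); last first.
      by rewrite (measure_shell nG finG) ltry.
    apply: le_measure; rewrite ?inE//; apply: measurableI => //.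
    exact: nested_measurable nH _.
  pose al (i : 'I_K) := (fine (A i) / w i)%R.
  have al0 i : (0 <= al i)%R by rewrite divr_ge0// fine_ge0.
  under eq_bigr do rewrite AE -(fineK (Afin _)) -EFinM.
  rewrite sumEFin.
  have -> : (\sum_i c i * fine (A i) = \sum_i (Num.sg (b i) * al i) * b i)%R.
    by apply: eq_bigr => i _; rewrite /c /al normrEsg; ring.
  apply: le_trans H1.
  apply: (@le_trans _ _ (p (\row_i (Num.sg (b i) * al i))%R)%:E); first by rewrite lee_fin b_le.
  apply: le_trans (averaging riN nG finG e'0 nH al0 _); last first.
    move=> i; rewrite -/(A i) -(fineK (Afin i)) lee_fin /al.
    have [w0|w0] := eqVneq (w i) 0%R; first by rewrite w0 mulr0 fine_ge0.
    by rewrite divfK.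
  rewrite -pE; apply: (fnorm_le fnN); [exact: mstp|exact: measurable_step|apply: aeW => s].
  have [[i Ii]|/forallNP nI] := pselect (exists i : 'I_K, I i s); last first.
    by rewrite /stp !step_out.
  rewrite /stp !(step_in _ (trivIset_level_itv nG finG) Ii) mxE lee_fin normrM.
  by rewrite normr_sg ler_piMl//; case: (_ != _).
have -> : layered e K G = step E a by apply/funext => x; rewrite (layered_step nG).
rewrite (rnorm_step_shell riN nG finG).
have -> : Nb (step I a) = (beta 0%N)%:E.
  by rewrite beta0 -pE; congr (Nb _); apply/funext => x; rewrite /stp /step; congr EFin; apply: eq_bigr => i _; rewrite mxE.
have a0 i : (0 <= a i)%R by rewrite mulr_ge0.
rewrite integral_step//; last 2 first.
- exact: measurable_step.
- by move=> x; exact: step_ge0.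
have -> : \sum_i (a i)%:E * \int[m]_(x in E i) step E c x = (\sum_i a i * (c i * w i))%:E.
  rewrite -sumEFin; apply: eq_bigr => i _; rewrite [RHS]EFinM; congr (_ * _).
  transitivity (\int[m]_(x in E i) (c i)%:E).
    by apply: eq_integral => x; rewrite inE => Ei; rewrite (step_in _ trE Ei).
  by rewrite integral_cst// (measure_shell nG finG).
rewrite lee_fin (le_trans beta0_le)//; apply: ler_sum => i _; rewrite ler_wpM2l//.
have [w0|w0] := eqVneq (w i) 0%R; first by rewrite w0 mulr0 b_null.
by rewrite /c divfK// ler_norm.
Qed.

End layered_duality.

(** One half of the Lorentz-Luxemburg theorem, the one that is not Hoelder's
    inequality. Layered functions are normed by [layered_norming], and the Fatou
    property does the rest. *)
Theorem rnorm_le_associate f (C : \bar R) : measurable_fun setT f ->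
  (forall h, measurable_fun setT h -> (forall x, 0 <= h x) -> assoc Nb m h <= 1 ->
     \int[m]_x (`|f x| * h x) <= C) ->
  rnorm Nb m f <= C.
Proof.
move=> mf fC; apply: (@le_trans _ _ (rnorm Nb m (abse \o f))).
  apply: rnorm_le => //; first exact: measurableT_comp.
  by move=> x /=; rewrite abse_id.
apply: (@layered_ind _ _ _ m B (fun f => rnorm Nb m f <= C) f) => //.
- by move=> A F mA AF Ac; exact: (rnorm_increases_to_le riN mA AF).
- move=> e L H e0 nH finH Hf; have [h [mh h0 h1 le_h]] := layered_norming nH finH e0.
  apply: (le_trans le_h); apply: le_trans (fC h mh h0 h1).
  apply: ge0_le_integral => //.
  + by move=> x _; rewrite mule_ge0// step_ge0.
  + by apply: emeasurable_funM => //; exact: measurable_layered nH _.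
  + by apply: emeasurable_funM => //; exact: measurableT_comp.
  + by move=> x _; rewrite lee_wpmul2r.
Qed.

End duality.

(** * Dilations and the upper Boyd index *)

Section dilation.
Context {R : realType}.

(** By uniqueness of Lebesgue measure: the left-hand side divided by [t] is a
    measure with the right values on intervals. *)
Lemma lebesgue_measure_dilation (t : R) (A : set (measurableTypeR R)) : (0 < t)%R -> measurable A ->
  lebesgue_measure ((fun x : measurableTypeR R => (x / t)%R : measurableTypeR R) @^-1` A) =
  t%:E * lebesgue_measure A.
Proof.
move=> t0 mA; pose phi (x : measurableTypeR R) : measurableTypeR R := (x / t)%R.
have mphi : measurable_fun setT phi by exact: mulrr_measurable.
have ti0 : (0 <= t^-1)%R by rewrite invr_ge0 ltW.
pose nu : {measure set (measurableTypeR R) -> \bar R} :=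
  mscale (NngNum ti0) (measure_function_pushforward__canonical__measure_function_Measure lebesgue_measure mphi).
have E : lebesgue_measure A = nu A.
  apply: lebesgue_measure_unique => //= _ [[a b]] _ <- /=.
  rewrite /nu/= /mscale /= /pushforward.
  have -> : phi @^-1` `]a, b]%classic = `](a * t)%R, (b * t)%R]%classic.
    by apply/seteqP; split => x /=; rewrite !in_itv/= /phi ltr_pdivlMr// ler_pdivrMr.
  rewrite !lebesgue_measure_itv/= !lte_fin ltr_pM2r//; case: ifPn => _; last by rewrite mule0.
  by rewrite -!EFinD -EFinM -mulrBl mulrCA mulVf ?gt_eqF// mulr1.
by rewrite E /nu/= /mscale/= muleA -EFinM mulfV ?gt_eqF// mul1e.
Qed.

Context (Nb : (measurableTypeR R -> \bar R) -> \bar R).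
Hypothesis riN : ri_function_norm (lebesgue_half R) Nb.
Let fnN := riN.1.
Implicit Types phi : measurableTypeR R -> \bar R.

Definition dilate (t : R) phi : measurableTypeR R -> \bar R := fun s => phi (s / t)%R.

Lemma measurable_dilate (t : R) phi : measurable_fun setT phi -> measurable_fun setT (dilate t phi).
Proof.
by move=> mphi; apply: (measurableT_comp mphi); exact: mulrr_measurable.
Qed.

Lemma fnorm_dilate_le (t : R) phi : (0 < t)%R -> (t <= 1)%R -> measurable_fun setT phi ->
  Nb (dilate t phi) <= Nb phi.
Proof.
move=> t0 t1 mphi; rewrite -!(rnorm_half riN)//; last exact: measurable_dilate.
apply: rnorm_le_distribution => // r r0; rewrite /distribution !lebesgue_halfE.
have mA := measurable_superlevel r%:E mphi.
have -> : [set x | r%:E < `|dilate t phi x|] `&` `[0%R, +oo[ =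
    (fun x : measurableTypeR R => (x / t)%R : measurableTypeR R) @^-1`
      ([set x | r%:E < `|phi x|] `&` `[0%R, +oo[).
  by apply/seteqP; split => x /=; rewrite !in_itv/= !andbT pmulr_lge0 ?invr_gt0.
rewrite lebesgue_measure_dilation//; last by apply: measurableI => //; exact: measurable_itv.
by rewrite -[leRHS]mul1e lee_wpmul2r.
Qed.

(** Dilations by [t < 1] have norm at most 1, so a ratio of logarithms that is
    less than [+oo] comes from a [t] whose dilation norm is less than 1. Taking
    [d > 0] keeps the powers of [d] positive, as iterating the bound requires. *)
Lemma boyd_contraction : upper_boyd_index Nb < +oo ->
  exists t d : R, [/\ (0 < t < 1)%R, (0 < d < 1)%R &
    forall phi (c : R), measurable_fun setT phi -> (0 < c)%R ->
      Nb phi <= c%:E -> Nb (dilate t phi) <= (d * c)%:E].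
Proof.
move=> /ereal_inf_lt[_ [t /andP[t0 t1] <-] fin_ratio].
have h1 : dilation_norm Nb t <= 1.
  apply/ereal_supP => _ [phi [mphi phi1] <-].
  by apply: le_trans phi1; exact: fnorm_dilate_le (ltW t1) mphi.
have h0 : 0 <= dilation_norm Nb t.
  have m0 : measurable_fun setT (cst 0 : measurableTypeR R -> \bar R) by exact: measurable_cst.
  apply: (@le_trans _ _ (Nb (dilate t (cst 0)))).
    by apply: (fnorm_ge0 fnN); exact: measurable_dilate.
  by apply: ereal_sup_ubound; exists (cst 0) => //; split => //; rewrite fnorm0.
have hlt : dilation_norm Nb t < 1.
  rewrite lt_neqAle h1 andbT; apply: contraTneq fin_ratio => ->.
  have lt0 : (0 < - ln t)%R by rewrite oppr_gt0 ln_lt0// t0.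
  by rewrite (_ : lne 1 = 0) ?oppe0 ?inve0 ?gt0_muley ?ltxx// lne1.
have hfin : dilation_norm Nb t \is a fin_num by rewrite ge0_fin_numE// (lt_trans hlt)// ltry.
pose h := fine (dilation_norm Nb t).
have hE : dilation_norm Nb t = h%:E by rewrite fineK.
exists t, (Num.max h (1 / 2))%R; split.
- by rewrite t0.
- have h1' : (h < 1)%R by rewrite -lte_fin -hE.
  by rewrite lt_max gt_max h1' /= divr_gt0 ?orbT//= ltr_pdivrMr// mul1r ltr1n.
move=> phi c mphi c0 phic.
have : Nb (dilate t (fun s => (c^-1)%:E * phi s)) <= h%:E.
  rewrite -hE; apply: ereal_sup_ubound; exists (fun s => (c^-1)%:E * phi s) => //; split.
    exact: emeasurable_funM.
  by rewrite (fnormZ fnN)// gtr0_norm ?invr_gt0// lee_pdivrMl// mule1.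
rewrite (_ : dilate t _ = fun s => (c^-1)%:E * dilate t phi s)//.
rewrite (fnormZ fnN); last exact: measurable_dilate.
rewrite gtr0_norm ?invr_gt0// lee_pdivrMl// => /le_trans; apply.
by rewrite -EFinM lee_fin mulrC ler_wpM2r ?(ltW c0)// le_max lexx.
Qed.

End dilation.

(** * Boundedness of maximal operators on the associate space *)

Section maximal_bound.
Context {R : realType} (Nb : (measurableTypeR R -> \bar R) -> \bar R).
Hypothesis riN : ri_function_norm (lebesgue_half R) Nb.
Context {d} {T : measurableType d}.
Variable m : {measure set T -> \bar R}.
Implicit Types f g h : T -> \bar R.

(** Duality between [T] and the half-line: pairing the rearrangement of a layered
    function [f] with [Gamma] amounts to pairing [f] itself with the function
    obtained by averaging [Gamma] over the intervals of [f^*]. *)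
Lemma layered_pairing K G e L H eta (a b : R) :
  nested K G -> m (G 0%N) < +oo -> (0 <= e)%R -> nested L H -> (0 <= eta)%R ->
  assoc Nb m (layered e K G) <= a%:E -> Nb (layered eta L H) <= b%:E ->
  \int[lebesgue_half R]_s
    (layered e K (fun k => `[0%R, level_measure m G k[%classic : set (measurableTypeR R)) s * layered eta L H s) <= (a * b)%:E.
Proof.
move=> nG finG e0 nH eta0 ha hb.
set t := level_measure m G.
pose G' k : set (measurableTypeR R) := `[0%R, t k[%classic.
have t_le k l : (k <= l)%N -> (t l <= t k)%R by exact: level_measure_le nG finG _ _.
have t0 k : (0 <= t k)%R by exact: level_measure_ge0.
have nG' : nested K G'.
  split=> [k|k l kl x|]; first exact: measurable_co.
    by rewrite /G'/= !in_itv/= => /andP[-> /= xl]; exact: lt_le_trans (t_le _ _ kl).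
  have -> : G' K = `[0%R, 0%R[%classic.
    by rewrite /G' /t /level_measure; have [_ _ ->] := nG; rewrite measure0.
  by apply/seteqP; split => x //; rewrite /= in_itv/= => /andP[h1 h2]; have := le_lt_trans h1 h2; rewrite ltxx.
have hG' k : lebesgue_half R (G' k) = (t k)%:E by rewrite /G' lebesgue_half_itv// subr0.
have finG' : lebesgue_half R (G' 0%N) < +oo by rewrite hG' ltry.
have tG' k : level_measure (lebesgue_half R) G' k = t k.
  by rewrite /level_measure hG'.
have IG' k : level_itv (lebesgue_half R) G' k = level_itv m G k by rewrite /level_itv !tG'.
have shG' k : shell G' k = level_itv m G k.
  apply/seteqP; split => x; rewrite /shell /level_itv /G' /= !in_itv/=.
    by case=> /andP[x0 xk] /negP; rewrite x0 /= -leNgt => ->.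
  move=> /andP[h1 h2]; rewrite h2 (le_trans (t0 _) h1); split => //.
  by apply/negP; rewrite /= -leNgt.
pose Ga := layered eta L H.
have Ga0 s : 0 <= Ga s by exact: step_ge0.
have mGa : measurable_fun setT Ga by exact: measurable_layered nH _.
pose A (i : 'I_K) := eta%:E * \sum_(l < L) lebesgue_half R (H l `&` shell G' i).
have AE (i : 'I_K) : \int[lebesgue_half R]_(s in shell G' i) Ga s = A i.
  rewrite (integral_layered_in (lebesgue_half R) nH eta0); last exact: measurable_shell nG' _.
  by rewrite /A ge0_sume_distrr.
have A0 i : 0 <= A i by rewrite -AE; exact: integral_ge0.
have Afin i : A i \is a fin_num.
  rewrite ge0_fin_numE// /A lte_mul_pinfty//; rewrite ?lee_fin//.
  apply: lte_sum_pinfty => l _; apply: le_lt_trans (_ : lebesgue_half R (shell G' i) < +oo); last first.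
    by rewrite (measure_shell nG' finG') ltry.
  apply: le_measure; rewrite ?inE//; last exact: measurable_shell nG' _.
  apply: measurableI; [exact: nested_measurable nH _|exact: measurable_shell nG' _].
pose w (i : 'I_K) := (t i - t i.+1)%R.
pose al (i : 'I_K) := (fine (A i) / w i)%R.
have w0 i : (0 <= w i)%R by exact: level_width_ge0 nG finG _.
have al0 i : (0 <= al i)%R by rewrite divr_ge0// fine_ge0.
have A_null i : w i = 0%R -> A i = 0.
  move=> wi; apply: le_anti; rewrite A0 andbT /A.
  rewrite big1 ?mule0// => l _; apply: le_anti; rewrite measure_ge0 andbT.
  apply: (@le_trans _ _ (lebesgue_half R (shell G' i))).
    apply: le_measure; rewrite ?inE//; last exact: measurable_shell nG' _.
    apply: measurableI; [exact: nested_measurable nH _|exact: measurable_shell nG' _].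
  by rewrite (measure_shell nG' finG') !tG' -/(w i) wi.
have alw i : (al i * w i)%:E = A i.
  have [wi|wi] := eqVneq (w i) 0%R; first by rewrite wi mulr0 A_null.
  by rewrite /al divfK// fineK.
pose E := fun i : 'I_K => shell G i.
have mE i : measurable (E i) by exact: measurable_shell nG _.
pose g := step E al.
have gb : rnorm Nb m g <= b%:E.
  rewrite (rnorm_step_shell riN nG finG); apply: le_trans hb.
  rewrite -(rnorm_half riN mGa).
  have := averaging riN nG' finG' eta0 nH al0.
  rewrite (_ : (fun i : 'I_K => level_itv (lebesgue_half R) G' i) = fun i : 'I_K => level_itv m G i); last first.
    by apply/funext => i; rewrite IG'.
  by apply => i; rewrite !tG' -/(w i) alw.
have mg : measurable_fun setT g by exact: measurable_step.
have ml : measurable_fun setT (layered e K G) by exact: measurable_layered nG _.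
apply: le_trans (hoelder_assoc riN ml mg ha gb).
under [leRHS]eq_integral do rewrite gee0_abs ?mule_ge0 ?step_ge0// muleC.
rewrite (integral_step m mE al0 ml); last by move=> x; exact: step_ge0.
under eq_integral do rewrite (layered_step nG').
rewrite integral_step//; last first.
- by move=> j; rewrite mulr_ge0.
- by move=> j; exact: measurable_shell nG' _.
rewrite le_eqVlt; apply/orP; left; apply/eqP; apply: eq_bigr => i _.
rewrite AE -alw.
transitivity ((al i)%:E * \int[m]_(x in E i) (e * i.+1%:R)%:E); last first.
  by congr (_ * _); apply: eq_integral => x; rewrite inE => Ei; rewrite (layered_shell nG _ Ei).
rewrite integral_cst// (measure_shell nG finG) -/(w i) -!EFinM; congr EFin; ring.
Qed.

End maximal_bound.

Lemma nneseries_ge_term {R : realType} (u : nat -> \bar R) (k : nat) :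
  (forall n, 0 <= u n) -> u k <= \sum_(0 <= n <oo) u n.
Proof.
move=> u0; apply: le_trans (nneseries_lim_ge k.+1 (fun n _ _ => u0 n)).
by rewrite big_nat_recr//= leeDr// sume_ge0.
Qed.

Section maximal_bound.
Context {R : realType} (Nb : (measurableTypeR R -> \bar R) -> \bar R).
Hypothesis riN : ri_function_norm (lebesgue_half R) Nb.
Context {d} {T : measurableType d}.
Variable m : {measure set T -> \bar R}.
Variable B : nat -> set T.
Hypotheses (mB : forall n, measurable (B n)) (ndB : nondecreasing_seq B)
  (UB : \bigcup_n B n = setT) (finB : forall n, m (B n) < +oo).
Implicit Types f g h : T -> \bar R.

Variables (M : (T -> \bar R) -> T -> \bar R) (C : R).
Hypotheses (C1 : (1 <= C)%R)
  (mM : forall f, measurable_fun setT (M f))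
  (M0 : forall f x, 0 <= M f x)
  (Mabs : forall f, M (abse \o f) = M f)
  (Mlayered : forall e K G x, (0 <= e)%R -> nested K G ->
     M (layered e K G) x <= \sum_(k < K) e%:E * M (EFin \o \1_(G k)) x)
  (Mlim : forall A f, (forall k, measurable_fun setT (A k)) -> increases_to A f ->
     increases_to (fun k => M (A k)) (M f))
  (M1 : forall D x, measurable D -> M (EFin \o \1_D) x <= 1)
  (Mweak : forall D (l : R), measurable D -> (0 < l)%R ->
     m [set x | l%:E < M (EFin \o \1_D) x] <= (C / l)%:E * m D).

Section layered_case.
Variables (t q : R).
Hypotheses (t01 : (0 < t < 1)%R) (q01 : (0 < q < 1)%R)
  (tq : forall phi (c : R), measurable_fun setT phi -> (0 < c)%R ->
      Nb phi <= c%:E -> Nb (dilate t phi) <= (q * c)%:E).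
Context {K : nat} {G : nat -> set T} {e : R} {L : nat} {H : nat -> set T} {eta : R}.
Hypotheses (nG : nested K G) (finG : m (G 0%N) < +oo) (e0 : (0 <= e)%R).
Hypotheses (nH : nested L H) (finH : m (H 0%N) < +oo) (eta0 : (0 <= eta)%R).
Hypotheses (fa : assoc Nb m (layered e K G) <= 1) (gN : rnorm Nb m (layered eta L H) <= 1).

Let t0 : (0 < t)%R. Proof. by case/andP : t01. Qed.
Let t1 : (t < 1)%R. Proof. by case/andP : t01. Qed.
Let q0 : (0 < q)%R. Proof. by case/andP : q01. Qed.

(** [layered eta L (J k)] is the rearrangement of [layered eta L H], dilated [k]
    times. *)
Let J (k l : nat) : set (measurableTypeR R) := `[0%R, (t ^+ k * level_measure m H l)%R[%classic.
Let Ga k := layered eta L (J k).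

Let tk0 k : (0 < t ^+ k)%R. Proof. by rewrite exprn_gt0. Qed.

Let J_size k l : lebesgue_half R (J k l) = (t ^+ k * level_measure m H l)%:E.
Proof. by rewrite /J lebesgue_half_itv ?subr0// mulr_ge0 ?level_measure_ge0// ltW. Qed.

Let nJ k : nested L (J k).
Proof.
split=> [l|l l' ll' x|]; first exact: measurable_co.
  rewrite /J/= !in_itv/= => /andP[-> /= xl]; apply: (lt_le_trans xl).
  by rewrite ler_pM2l// (level_measure_le nH finH).
apply/seteqP; split => x //; rewrite /J /= in_itv/= => /andP[h1].
have -> : level_measure m H L = 0%R by rewrite /level_measure; have [_ _ ->] := nH; rewrite measure0.
by rewrite mulr0 ltNge h1.
Qed.

Let Ga_le k : Nb (Ga k) <= (q ^+ k)%:E.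
Proof.
elim: k => [|k IH].
  rewrite expr0 -(rnorm_half riN); last exact: measurable_layered (nJ 0) _.
  apply: le_trans gN; rewrite le_eqVlt; apply/orP; left; apply/eqP.
  have finJ : lebesgue_half R (J 0 0%N) < +oo by rewrite J_size ltry.
  have lJ l : level_measure (lebesgue_half R) (J 0) l = level_measure m H l.
    by rewrite /level_measure J_size expr0 mul1r.
  have -> : layered eta L H = step (fun i : 'I_L => shell H i) (fun i => eta * i.+1%:R)%R.
    by apply/funext => x; rewrite (layered_step nH).
  have -> : Ga 0 = step (fun i : 'I_L => shell (J 0) i) (fun i => eta * i.+1%:R)%R.
    by apply/funext => x; rewrite /Ga (layered_step (nJ 0)).
  rewrite (rnorm_step_shell riN nH finH) (rnorm_step_shell riN (nJ 0) finJ).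
  by congr (Nb (step _ _)); apply/funext => i; rewrite /level_itv !lJ.
have -> : Ga k.+1 = dilate t (Ga k).
  apply/funext => s; rewrite /dilate /Ga /layered /step; congr EFin; apply: eq_bigr => l _.
  rewrite !indicE; congr (_ * (nat_of_bool _)%:R)%R.
  apply/idP/idP; rewrite !inE /J /= !in_itv/= => /andP[s0 s1].
    by rewrite divr_ge0//= ?(ltW t0)// ltr_pdivrMr// mulrAC -exprSr.
  by move: s0 s1; rewrite pmulr_lge0 ?invr_gt0// => -> /=; rewrite ltr_pdivrMr// mulrAC -exprSr.
rewrite exprS; apply: tq => //; first exact: measurable_layered (nJ k) _.
by rewrite exprn_gt0.
Qed.

Let Omega j k := [set x | (t ^+ k.+1)%:E < M (EFin \o \1_(G j)) x].

Let mOmega j k : measurable (Omega j k).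
Proof. by rewrite -[X in measurable X]setTI; exact: measurable_lte. Qed.

Let M_indic_le j x : M (EFin \o \1_(G j)) x <= \sum_(0 <= k <oo) (t ^+ k)%:E * (\1_(Omega j k) x)%:E.
Proof.
have term0 k : 0 <= (t ^+ k)%:E * (\1_(Omega j k) x)%:E by rewrite mule_ge0// lee_fin// ltW.
have := M0 (EFin \o \1_(G j)) x; set y := M _ x => y0.
have y1 : y <= 1 by apply: M1; exact: nested_measurable nG _.
have [->|yn0] := eqVneq y 0; first exact: nneseries_ge0.
have {}y0 : 0 < y by rewrite lt_neqAle eq_sym yn0.
have yfin : y \is a fin_num by rewrite ge0_fin_numE ?(ltW y0)// (le_lt_trans y1)// ltry.
have yE : y = (fine y)%:E by rewrite fineK.
have fy0 : (0 < fine y)%R by rewrite -lte_fin -yE.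
have [n tn] : exists n, (t ^+ n.+1 < fine y)%R.
  have tlt : (`|t| < 1)%R by rewrite gtr0_norm.
  have /cvgrPdist_lt/(_ _ fy0)[n _ Hn] := cvg_expr tlt.
  have := Hn n.+1 (leqnSn n); rewrite /= sub0r normrN gtr0_norm// => tn.
  by exists n.
have P0 : exists n, (t ^+ n.+1 < fine y)%R by exists n.
case: (ex_minnP P0) => k tk mink.
have yk : (fine y <= t ^+ k)%R.
  case: k tk mink => [_ _|k tk mink]; first by rewrite expr0 -lee_fin -yE.
  by rewrite leNgt; apply/negP => /mink; rewrite ltnn.
apply: (@le_trans _ _ ((t ^+ k)%:E * (\1_(Omega j k) x)%:E)).
  by rewrite indicE mem_set ?mule1 1?yE// /Omega /= -/y yE lte_fin.
exact: nneseries_ge_term.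
Qed.

Let integral_Omega_le j k :
  \int[m]_(x in Omega j k) layered eta L H x <=
  (C / t ^+ k.+1)%:E * \int[lebesgue_half R]_(s in `[0%R, level_measure m G j[) Ga k.+1 s.
Proof.
have C0 : (0 <= C / t ^+ k.+1)%R by rewrite divr_ge0// ?(ltW (tk0 _))// (le_trans ler01).
rewrite (integral_layered_in m nH)// (integral_layered_in _ (nJ k.+1))//.
rewrite ge0_sume_distrr => [|l _]; last by rewrite mule_ge0// lee_fin.
apply: lee_sum => l _; rewrite muleCA lee_wpmul2l ?lee_fin//.
set h := level_measure m H l; set s := level_measure m G j.
have h0 : (0 <= h)%R by exact: level_measure_ge0.
have s0 : (0 <= s)%R by exact: level_measure_ge0.
have -> : J k.+1 l `&` `[0%R, s[%classic = `[0%R, (Num.min (t ^+ k.+1 * h) s)%R[%classic.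
  by apply/seteqP; split => x; rewrite /J /= !in_itv/= lt_min; [case=> /andP[-> ->]|move=> /and3P[-> -> ->]].
rewrite lebesgue_half_itv//; last by rewrite le_min s0 mulr_ge0// ltW.
rewrite subr0.
have mH := nested_measurable nH l.
have mG := nested_measurable nG j.
(* The measure of [H l `&` Omega j k] is bounded by that of [H l], and by the
   weak type estimate. *)
have [hs|hs] := leP (t ^+ k.+1 * h)%R s.
  apply: (@le_trans _ _ (m (H l))); first by apply: le_measure; rewrite ?inE//; exact: measurableI.
  rewrite (level_measureE nH finH) -EFinM lee_fin mulrA divfK ?gt_eqF//.
  by rewrite ler_peMl.
apply: (@le_trans _ _ (m (Omega j k))); first by apply: le_measure; rewrite ?inE//; exact: measurableI.
by rewrite -(level_measureE nG finG); exact: Mweak.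
Qed.

Let geometric_sum_le n : (\sum_(0 <= k < n) q ^+ k <= (1 - q)^-1)%R.
Proof.
have q1 : (0 < 1 - q)%R by rewrite subr_gt0; case/andP : q01.
rewrite -[leRHS]mul1r ler_pdivlMr//.
have -> : ((\sum_(0 <= k < n) q ^+ k) * (1 - q) = 1 - q ^+ n)%R.
  elim: n => [|n IH]; first by rewrite big_nil mul0r expr0 subrr.
  by rewrite big_nat_recr//= mulrDl IH exprSr; ring.
by rewrite lerBlDr lerDl exprn_ge0// ltW.
Qed.

(** The sum over the levels [t^k] of [M] on indicators. The weak type bound at
    level [t^(k+1)] costs a factor [t^-(k+1)], absorbed by dilating the
    rearrangement of the layered function paired with [M f]: this is the
    function [Ga k.+1], whose norm is at most [q^(k+1)]. *)
Lemma integral_maximal_layered :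
  \int[m]_x (layered eta L H x * M (layered e K G) x) <= (C / t * q / (1 - q))%:E.
Proof.
have Ct0 : (0 <= C / t)%R by rewrite divr_ge0 ?(ltW t0)// (le_trans ler01).
have g0 x : 0 <= layered eta L H x by exact: step_ge0.
have mg : measurable_fun setT (layered eta L H) by exact: measurable_layered nH _.
pose S k := step (fun j : 'I_K => Omega j k) (fun=> (e * t ^+ k)%R).
have S0 k x : 0 <= S k x by apply: step_ge0 => j; rewrite mulr_ge0// ltW.
have mS k : measurable_fun setT (S k) by exact: measurable_step.
have le_S x : layered eta L H x * M (layered e K G) x <=
    \sum_(0 <= k <oo) (S k x * layered eta L H x).
  have := g0 x; have -> : layered eta L H x = (fine (layered eta L H x))%:E by [].
  move=> y0; rewrite (eq_eseriesr (g := fun k => (fine (layered eta L H x))%:E * S k x)); last first.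
    by move=> k _; rewrite muleC.
  rewrite nneseriesZl; last by move=> k _.
  rewrite lee_wpmul2l//; apply: le_trans (Mlayered x e0 nG) _.
  apply: (@le_trans _ _ (\sum_(j < K) \sum_(0 <= k <oo) (e * t ^+ k)%:E * (\1_(Omega j k) x)%:E)).
    apply: lee_sum => j _.
    rewrite (eq_eseriesr (g := fun k => e%:E * ((t ^+ k)%:E * (\1_(Omega j k) x)%:E))); last first.
      by move=> k _; rewrite EFinM muleA.
    rewrite nneseriesZl; last by move=> k _; rewrite mule_ge0// lee_fin// ltW.
    by rewrite lee_wpmul2l// lee_fin.
  rewrite -nneseries_sum; last by move=> *; rewrite mule_ge0// lee_fin// mulr_ge0// ltW.
  rewrite le_eqVlt; apply/orP; left; apply/eqP; apply: eq_eseriesr => k _.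
  by rewrite /S /step -sumEFin; apply: eq_bigr.
apply: le_trans (ge0_le_integral _ _ _ _ _ (fun x _ => le_S x)) _ => //.
- by move=> x _; rewrite mule_ge0.
- exact: emeasurable_funM.
- by apply: ge0_emeasurable_sum => [k x _ _|k _]; [rewrite mule_ge0|exact: emeasurable_funM].
rewrite integral_nneseries//; last 2 first.
- by move=> k; exact: emeasurable_funM.
- by move=> k x _; rewrite mule_ge0.
have term k : \int[m]_x (S k x * layered eta L H x) <= (C / t * q * q ^+ k)%:E.
  have et0 : (0 <= e * t ^+ k)%R by rewrite mulr_ge0// ltW.
  rewrite integral_step//.
  apply: (@le_trans _ _ (\sum_(j < K) (C / t)%:E * (e%:E *
      \int[lebesgue_half R]_(s in `[0%R, level_measure m G j[) Ga k.+1 s))).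
    apply: lee_sum => j _.
    apply: le_trans (lee_wpmul2l _ (integral_Omega_le j k)) _; first by rewrite lee_fin.
    rewrite muleA -EFinM muleA -EFinM lee_wpmul2r//.
      by apply: integral_ge0 => s _; exact: step_ge0.
    rewrite lee_fin le_eqVlt; apply/orP; left; apply/eqP; rewrite exprS.
    by field; rewrite ?gt_eqF.
  rewrite -ge0_sume_distrr => [|j _]; last first.
    by rewrite mule_ge0 ?lee_fin//; apply: integral_ge0 => s _; exact: step_ge0.
  rewrite -[(C / t * q * q ^+ k)%R]mulrA [leRHS]EFinM lee_wpmul2l ?lee_fin//.
  have := layered_pairing riN nG finG e0 (nJ k.+1) eta0 fa (Ga_le k.+1).
  rewrite mul1r exprS; apply: le_trans.
  rewrite integral_step//; first exact: measurable_layered (nJ _) _.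
  by move=> s; exact: step_ge0.
apply: lime_le.
  by apply: is_cvg_nneseries => k _ _; apply: integral_ge0 => x _; rewrite mule_ge0.
apply: nearW => n; apply: (@le_trans _ _ (\sum_(0 <= k < n) (C / t * q * q ^+ k)%:E)).
  exact: lee_sum.
rewrite sumEFin lee_fin -mulr_sumr ler_wpM2l//.
by rewrite mulr_ge0// ltW.
Qed.

End layered_case.

Lemma assoc_le_abs f g : measurable_fun setT f -> measurable_fun setT g ->
  (forall x, `|f x| <= `|g x|) -> assoc Nb m f <= assoc Nb m g.
Proof.
move=> mf mg fg; apply/ereal_supP => _ [h [mh h1] <-].
apply: le_trans (assoc_ge g mh h1); apply: ge0_le_integral => //.
- by apply: measurableT_comp => //; exact: emeasurable_funM.
- by apply: measurableT_comp => //; exact: emeasurable_funM.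
- by move=> x _; rewrite !abseM lee_wpmul2r.
Qed.

(** Boyd's theorem for operators that are bounded by 1 and of weak type (1,1) on
    indicator functions. Only the values on indicators matter, because the
    operator is sublinear and commutes with increasing limits. *)
Theorem maximal_assoc_bounded : upper_boyd_index Nb < +oo ->
  exists D : R, forall f, measurable_fun setT f -> assoc Nb m f <= 1 ->
    assoc Nb m (M f) <= D%:E.
Proof.
move=> /(boyd_contraction riN)[t [q [t01 q01 tq]]].
exists (C / t * q / (1 - q))%R => f mf f1.
apply: (assoc_le riN mB ndB UB finB) => // eta L H eta0 nH finH gN.
under eq_integral do rewrite gee0_abs// muleC.
have mg : measurable_fun setT (layered eta L H) by exact: measurable_layered nH _.
have g0 x : 0 <= layered eta L H x by exact: step_ge0.
rewrite -Mabs.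
apply: (@layered_ind _ _ _ m B (fun f => \int[m]_x (M f x * layered eta L H x) <= _) f) => //.
- move=> A F mA AF Ac.
  apply: (integral_increases_to_le (increases_toMr g0 (Mlim mA AF))) => // k.
  exact: emeasurable_funM.
- move=> e K G e0 nG finG Gf.
  under eq_integral do rewrite muleC.
  apply: (integral_maximal_layered t01 q01 tq nG finG e0 nH finH eta0 _ gN).
  apply: le_trans f1; apply: assoc_le_abs => //; first exact: measurable_layered nG _.
  by move=> x; rewrite gee0_abs ?step_ge0.
Qed.

End maximal_bound.

(** * Measures with a density; coverings by cubes *)

Section density.
Context {d} {T : measurableType d} {R : realType}.
Variable mu : {measure set T -> \bar R}.
Context {v : T -> \bar R}.

(** The absolute value makes this a measure for every measurable [v]; it does not
    change it when [v] is a weight. The argument [mv] lets the measure structure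
    be inferred. *)
Definition density (mv : measurable_fun setT v) (A : set T) : \bar R :=
  \int[mu]_(x in A) `|v x|.

Variable mv : measurable_fun setT v.

Let density0 : density mv set0 = 0. Proof. exact: integral_set0. Qed.

Let density_ge0 A : 0 <= density mv A.
Proof. by apply: integral_ge0 => x _; exact: abse_ge0. Qed.

Let density_sigma_additive : semi_sigma_additive (density mv).
Proof.
move=> F mF tF mUF; rewrite /density ge0_integral_bigcup//.
- by apply: is_cvg_nneseries => k _ _; exact: density_ge0.
- by apply: measurable_funTS; exact: measurableT_comp.
Qed.

HB.instance Definition _ := isMeasure.Build _ _ _ (density mv)
  density0 density_ge0 density_sigma_additive.

(** Both sides agree on layered functions, which converge to [f] from below. *)
Lemma integral_density (f : T -> \bar R) : measurable_fun setT f -> (forall x, 0 <= f x) ->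
  \int[density mv]_x f x = \int[mu]_x (f x * `|v x|).
Proof.
move=> mf f0.
have mav : measurable_fun setT (fun x => `|v x|) by exact: measurableT_comp.
have fE : abse \o f = f by apply/funext => x /=; rewrite gee0_abs.
have lf := increases_to_layers mf; rewrite fE in lf.
have e0 k : (0 <= 2^-1 ^+ k :> R)%R by rewrite exprn_ge0.
have nl k := nested_layer_set k mf.
have ml k : measurable_fun setT (layers f k) by exact: measurable_layered (nl k) _.
have l0 k x : 0 <= layers f k x by exact: step_ge0.
have E k : \int[density mv]_x layers f k x = \int[mu]_x (layers f k x * `|v x|).
  rewrite (integral_layered _ (nl k) (e0 k) mav)// (integral_layered_in _ (nl k) (e0 k))//.
  by apply: eq_bigr => i _; rewrite setIT.
apply/eqP; rewrite eq_le; apply/andP; split.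
  apply: (integral_increases_to_le lf ml) => k; rewrite E.
  apply: ge0_le_integral => //.
  - by move=> x _; rewrite mule_ge0.
  - exact: emeasurable_funM.
  - exact: emeasurable_funM.
  - by move=> x _; rewrite lee_wpmul2r// (increases_to_le _ _ lf).
apply: (integral_increases_to_le (increases_toMr _ lf)) => // k; last first.
  rewrite -E; apply: ge0_le_integral => //.
  by move=> x _; exact: increases_to_le.
exact: emeasurable_funM.
Qed.

End density.

Section cubes.
Context {R : realType} {n : nat}.
Implicit Types (a b x : Rn R n) (l : R).

Lemma measurable_cube a l : measurable (cube a l : set (Rn R n)).
Proof.
have -> : cube a l = \bigcap_(i in [set: 'I_n])
    ((fun x : Rn R n => tnth x i) @^-1` `](tnth a i), (tnth a i + l)%R[%classic).
  apply/seteqP; split => x /= H i; first by move=> _ /=; rewrite in_itv/=; exact: H.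
  by have := H i I; rewrite /= in_itv/=.
apply: fin_bigcap_measurable => [|i _]; first exact: finite_finset.
rewrite -[X in measurable X]setTI; apply: (@measurable_tnth _ (measurableTypeR R) n i) => //.
Qed.

Lemma cube_ex x l : (0 < l)%R -> exists a, cube a l x.
Proof.
move=> l0; exists [tuple (tnth x i - l / 2)%R | i < n] => i; rewrite tnth_mktuple; apply/andP; split; lra.
Qed.

(** Rational cubes form a countable basis: to each rational cube contained in a
    member of the family is attached one such member. *)
Lemma cubes_countable_subcover (F : set (set (Rn R n))) : F `<=` cubes ->
  exists2 Q : nat -> set (Rn R n), forall k, F (Q k) \/ Q k = set0 &
    \bigcup_(D in F) D = \bigcup_k Q k.
Proof.
move=> FQ.
pose rcube (c : n.-tuple rat * rat) : set (Rn R n) :=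
  cube [tuple (ratr (tnth c.1 i) : R) | i < n] (ratr c.2).
pose good (k : nat) (D : set (Rn R n)) := F D /\
  if (unpickle k : option (n.-tuple rat * rat)) is Some c then rcube c `<=` D else False.
have exQ k : exists D, good k D \/ (D = set0 /\ forall D, ~ good k D).
  have [[D gD]|/forallNP nD] := pselect (exists D, good k D); first by exists D; left.
  by exists set0; right.
have [Q HQ] := choice exQ.
exists Q => [k|]; first by case: (HQ k) => [[FD _]|[-> _]]; [left|right].
apply/seteqP; split => x; last first.
  by move=> [k _ Qx]; exists (Q k) => //; case: (HQ k) => [[]//|[Q0 _]]; move: Qx; rewrite Q0.
move=> [D FD Dx]; have [b [L [L0 DE]]] := FQ _ FD; rewrite DE in Dx.
have [e e0 He] : exists2 e : R, (0 < e)%R & forall i, (tnth b i + e < tnth x i < tnth b i + L - e)%R.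
  pose f (i : 'I_n) := (Num.min (tnth x i - tnth b i) (tnth b i + L - tnth x i) / 2)%R.
  have f0 i : (0 < f i)%R.
    have /andP[h1 h2] := Dx i; rewrite divr_gt0// lt_min; apply/andP; split; lra.
  exists (\big[Num.min/1%R]_i f i)%R.
    by apply: (big_ind (fun y : R => 0 < y)%R) => // y z y0 z0; rewrite lt_min y0.
  move=> i; have le_f : (\big[Num.min/1%R]_i f i <= f i)%R by exact: bigmin_le_cond.
  have /andP[h1 h2] := Dx i; have f_i := f0 i.
  have h3 : (f i <= (tnth x i - tnth b i) / 2)%R by rewrite ler_wpM2r// ge_min lexx.
  have h4 : (f i <= (tnth b i + L - tnth x i) / 2)%R by rewrite ler_wpM2r// ge_min lexx orbT.
  apply/andP; split; lra.
have [r rin] := rat_in_itvoo e0.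
have /andP[r0 re] : (0 < (ratr r : R) < e)%R by move: rin; rewrite in_itv.
have exc i : exists s : rat, (tnth x i - ratr r < ratr s < tnth x i)%R.
  have lt_i : (tnth x i - ratr r < tnth x i)%R by rewrite ltrBlDr ltrDl.
  by have [s] := rat_in_itvoo lt_i; rewrite in_itv/=; exists s.
have [c Hc] := choice exc.
pose code : n.-tuple rat * rat := ([tuple c i | i < n], r).
have xc : rcube code x.
  move=> i; rewrite !tnth_mktuple /=; have /andP[h1 h2] := Hc i.
  by rewrite h2 /= -ltrBlDr.
have cD : rcube code `<=` D.
  rewrite DE => y yc i; have := yc i; rewrite !tnth_mktuple /= => /andP[y1 y2].
  have /andP[h1 h2] := Hc i; have /andP[g1 g2] := He i; apply/andP; split; lra.
exists (pickle code) => //; case: (HQ (pickle code)) => [[_]|[_ nG]].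
  by rewrite pickleK; apply.
by exfalso; apply: (nG D); split => //; rewrite pickleK.
Qed.

End cubes.

Section vitali.
Context {R : realType} {n : nat}.
Implicit Types (q : Rn R n * R) (s : seq (Rn R n * R)).

Definition scube q : set (Rn R n) := cube q.1 q.2.

Definition tripled q : Rn R n * R := ([tuple (tnth q.1 i - q.2)%R | i < n], (3 * q.2)%R).

Lemma meet_sub_tripled q q' : (q.2 <= q'.2)%R -> scube q `&` scube q' !=set0 ->
  scube q `<=` scube (tripled q').
Proof.
move=> qq' [y [yq yq']] z zq i; rewrite tnth_mktuple /=.
have /andP[y1 y2] := yq i; have /andP[y3 y4] := yq' i; have /andP[z1 z2] := zq i.
apply/andP; split; lra.
Qed.

Lemma scube_neq0 q : (0 < q.2)%R -> scube q !=set0.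
Proof.
move=> q0; exists [tuple (tnth q.1 i + q.2 / 2)%R | i < n] => i.
rewrite tnth_mktuple; apply/andP; split; lra.
Qed.

Lemma sub_tripled q : (0 < q.2)%R -> scube q `<=` scube (tripled q).
Proof. by move=> q0; apply: meet_sub_tripled => //; rewrite setIid; exact: scube_neq0. Qed.

Lemma seq_max_side q1 s : exists2 q0, q0 \in q1 :: s &
  forall q, q \in q1 :: s -> (q.2 <= q0.2)%R.
Proof.
elim: s q1 => [q1|q2 s IH q1].
  by exists q1; rewrite ?mem_head// => q; rewrite inE => /eqP ->.
have [q qs qmax] := IH q2.
have [qq|qq] := leP q1.2 q.2.
  exists q; first by rewrite inE qs orbT.
  by move=> q'; rewrite inE => /orP[/eqP ->//|]; exact: qmax.
exists q1; first by rewrite mem_head.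
move=> q'; rewrite inE => /orP[/eqP ->//|q's]; exact: le_trans (qmax _ q's) (ltW qq).
Qed.

(** The finite Vitali covering lemma: keep the largest cube, discard those that
    meet it, and repeat. *)
Lemma vitali_cubes s : (forall q, q \in s -> 0 < q.2)%R ->
  exists s', [/\ {subset s' <= s},
    pairwise (fun q q' => `[< scube q `&` scube q' = set0 >]) s' &
    forall x, (exists2 q, q \in s & scube q x) -> exists2 q, q \in s' & scube (tripled q) x].
Proof.
have [k] := ubnP (size s); elim: k s => // k IH [|q1 s1] sk s0.
  by exists [::]; split => // x [].
have [q0 q0s q0max] := seq_max_side q1 s1.
move: (q1 :: s1) => s in sk s0 q0s q0max *.
pose disj q := `[< scube q0 `&` scube q = set0 >].
have tk : (size [seq q <- s | disj q] < k)%N.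
  rewrite -ltnS; apply: leq_trans sk; rewrite ltnS size_filter ltn_neqAle count_size andbT.
  rewrite -all_count; apply/negP => /allP/(_ _ q0s)/asboolP; rewrite setIid => q00.
  by have [x] := scube_neq0 (s0 _ q0s); rewrite q00.
have [|s' [s't ps' covs']] := IH _ tk.
  by move=> q; rewrite mem_filter => /andP[_]; exact: s0.
exists (q0 :: s'); split.
- move=> q; rewrite inE => /orP[/eqP ->//|/s't]; by rewrite mem_filter => /andP[].
- rewrite /= ps' andbT; apply/allP => q /s't; by rewrite mem_filter => /andP[].
move=> x [q qs qx]; have [dq|/asboolP ndq] := boolP (disj q).
  have [|q' q's' q'x] := covs' x; last by exists q' => //; rewrite inE q's' orbT.
  by exists q => //; rewrite mem_filter dq.
exists q0; first by rewrite mem_head.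
apply: (@meet_sub_tripled q) => //; first exact: q0max.
by rewrite setIC; apply/set0P/eqP.
Qed.

End vitali.

(** * The maximal operator over cubes *)

Section cube_maximal.
Context {R : realType} {n : nat}.
Variable m : {measure set (Rn R n) -> \bar R}.
Implicit Types (f g : Rn R n -> \bar R) (Q D : set (Rn R n)).

Definition cube_maximal f (x : Rn R n) : \bar R :=
  ereal_sup [set (m Q)^-1 * \int[m]_(y in Q) `|f y| | Q in [set Q : set (Rn R n) | cubes Q /\ Q x]].

Hypotheses (m_gt0 : forall Q, cubes Q -> 0 < m Q) (m_fin : forall Q, cubes Q -> m Q < +oo).

Lemma measurable_cubes Q : cubes Q -> measurable Q.
Proof. by move=> [a [l [_ ->]]]; exact: measurable_cube. Qed.

Lemma cubesE Q : cubes Q -> exists2 r : R, (0 < r)%R & m Q = r%:E.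
Proof.
move=> cQ; have := m_gt0 cQ; have := m_fin cQ; case: (m Q) => [r _ r0| |]//.
by exists r.
Qed.

Lemma cube_average_le Q (X c : \bar R) : cubes Q -> ((m Q)^-1 * X <= c) = (X <= m Q * c).
Proof.
by move=> /cubesE[r r0 ->]; rewrite inver gt_eqF// lee_pdivrMl.
Qed.

Lemma cube_maximal_ge f x Q : cubes Q -> Q x ->
  (m Q)^-1 * \int[m]_(y in Q) `|f y| <= cube_maximal f x.
Proof. by move=> cQ Qx; apply: ereal_sup_ubound; exists Q. Qed.

Lemma cube_maximal_integral_le f x Q : cubes Q -> Q x ->
  \int[m]_(y in Q) `|f y| <= m Q * cube_maximal f x.
Proof. by move=> cQ Qx; rewrite -cube_average_le//; exact: cube_maximal_ge. Qed.

Lemma cube_maximal_le f x c :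
  (forall Q, cubes Q -> Q x -> \int[m]_(y in Q) `|f y| <= m Q * c) -> cube_maximal f x <= c.
Proof.
by move=> H; apply/ereal_supP => _ [Q [cQ Qx] <-]; rewrite cube_average_le//; exact: H.
Qed.

Lemma cubes_cover (x : Rn R n) : exists2 Q : set (Rn R n), cubes Q & Q x.
Proof.
have [a ax] := cube_ex x (@ltr01 R).
by exists (cube a 1%R) => //; exists a, 1%R.
Qed.

Lemma cube_maximal_ge0 f x : 0 <= cube_maximal f x.
Proof.
have [Q cQ Qx] := cubes_cover x; apply: le_trans (cube_maximal_ge f cQ Qx).
have [r r0 ->] := cubesE cQ.
by rewrite inver gt_eqF// mule_ge0 ?lee_fin ?invr_ge0 ?(ltW r0)// integral_ge0.
Qed.

Lemma cube_maximal_abse f : cube_maximal (abse \o f) = cube_maximal f.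
Proof.
apply/funext => x; congr ereal_sup; apply/seteqP.
by split=> _ [Q HQ <-]; exists Q => //; congr (_ * _); apply: eq_integral => y _ /=; rewrite abse_id.
Qed.

Let superlevelE f (l : \bar R) : [set x | l < cube_maximal f x] =
  \bigcup_(Q in [set Q : set (Rn R n) | cubes Q /\ l < (m Q)^-1 * \int[m]_(y in Q) `|f y|]) Q.
Proof.
apply/seteqP; split => x /=.
  by move=> /ereal_sup_gt[_ [Q [cQ Qx] <-] lQ]; exists Q.
by move=> [Q [cQ lQ] Qx]; apply: lt_le_trans lQ (cube_maximal_ge f cQ Qx).
Qed.

Lemma measurable_cube_maximal f : measurable_fun setT (cube_maximal f).
Proof.
apply: measurable_superlevels => r; rewrite superlevelE.
have [|Q FQ ->] := @cubes_countable_subcover R n [set Q : set (Rn R n) | cubes Q /\ r%:E < (m Q)^-1 * \int[m]_(y in Q) `|f y|].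
  by move=> Q [].
apply: bigcup_measurable => k _; case: (FQ k) => [[cQ _]|->//]; exact: measurable_cubes.
Qed.

Lemma cube_maximal_layered e K (G : nat -> set (Rn R n)) x : (0 <= e)%R -> nested K G ->
  cube_maximal (layered e K G) x <= \sum_(k < K) e%:E * cube_maximal (EFin \o \1_(G k)) x.
Proof.
move=> e0 nG; apply: cube_maximal_le => Q cQ Qx.
have mQ := measurable_cubes cQ.
rewrite ge0_sume_distrr => [|k _]; last by rewrite mule_ge0 ?cube_maximal_ge0// lee_fin.
under eq_integral do rewrite gee0_abs ?step_ge0//.
rewrite integral_layered_in//; apply: lee_sum => k _.
rewrite muleCA lee_wpmul2l ?lee_fin//.
apply: le_trans (cube_maximal_integral_le _ cQ Qx).
under eq_integral do rewrite /= ger0_norm//.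
by rewrite integral_indic//; exact: nested_measurable nG k.
Qed.

Lemma cube_maximal_increases A f : (forall k, measurable_fun setT (A k)) -> increases_to A f ->
  increases_to (fun k => cube_maximal (A k)) (cube_maximal f).
Proof.
move=> mA Af; have [A0 ndA _] := Af; have mf := measurable_increases_to Af mA.
have mono g h x : measurable_fun setT g -> measurable_fun setT h ->
    (forall y, 0 <= g y <= h y) -> cube_maximal g x <= cube_maximal h x.
  move=> mg mh gh; apply: cube_maximal_le => Q cQ Qx.
  apply: le_trans (cube_maximal_integral_le _ cQ Qx).
  apply: ge0_le_integral => //.
  - exact: measurable_cubes.
  - by apply: measurable_funTS; exact: measurableT_comp.
  - by apply: measurable_funTS; exact: measurableT_comp.
  - move=> y _; have /andP[g0 {}gh] := gh y.
    by rewrite !gee0_abs// (le_trans g0).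
split.
- by move=> k x; exact: cube_maximal_ge0.
- by move=> k l x kl; apply: mono => // y; rewrite A0 ndA.
move=> x; apply/eqP; rewrite eq_le; apply/andP; split; last first.
  apply/ereal_supP => _ [k _ <-]; apply: mono => // y.
  by rewrite A0 (increases_to_le _ _ Af).
apply: cube_maximal_le => Q cQ Qx.
have mQ := measurable_cubes cQ.
have m1 : measurable_fun setT (fun y => (\1_Q y)%:E : \bar R).
  by apply/measurable_EFinP; exact: measurable_indic.
have E g : (forall y, 0 <= g y) ->
    \int[m]_(y in Q) `|g y| = \int[m]_y (g y * (\1_Q y)%:E).
  by move=> g0; rewrite integral_mkcond; apply: eq_integral => y _; rewrite epatch_indic/= gee0_abs.
rewrite E => [|y]; last exact: increases_to_ge0 Af.
apply: (integral_increases_to_le (increases_toMr _ Af)) => // k.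
  exact: emeasurable_funM.
rewrite -E//; apply: le_trans (cube_maximal_integral_le (A k) cQ Qx) _.
rewrite lee_wpmul2l// ?measure_ge0//.
by apply: ereal_sup_ubound; exists k.
Qed.

Lemma cube_maximal_indic_le1 D x : measurable D -> cube_maximal (EFin \o \1_D) x <= 1.
Proof.
move=> mD; apply: cube_maximal_le => Q cQ Qx; have mQ := measurable_cubes cQ.
under eq_integral do rewrite /= ger0_norm//.
rewrite mule1 integral_indic//; apply: le_measure; rewrite ?inE//; exact: measurableI.
Qed.

Section weak_type.
Variable C : R.
Hypotheses (C0 : (0 <= C)%R)
  (doubling : forall q : Rn R n * R, (0 < q.2)%R -> m (scube (tripled q)) <= C%:E * m (scube q)).

Let cubes_scube (q : Rn R n * R) : (0 < q.2)%R -> cubes (scube q).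
Proof. by move=> q0; exists q.1, q.2. Qed.

Let mscube (q : Rn R n * R) : measurable (scube q : set (Rn R n)). Proof. exact: measurable_cube. Qed.

Lemma sum_measure_pairwise_le (s : seq (Rn R n * R)) D : measurable D ->
  pairwise (fun q q' => `[< scube q `&` scube q' = set0 >]) s ->
  \sum_(q <- s) m (D `&` scube q) <= m D.
Proof.
elim: s D => [|q s IH] D mD; first by rewrite big_nil.
rewrite big_cons /= => /andP[/allP qs ps].
rewrite (measureDI m mD (mscube q)) addeC leeD2r//.
have := IH _ (measurableD mD (mscube q)) ps.
apply: le_trans; rewrite big_seq [leRHS]big_seq; apply: lee_sum => q' q's.
apply: le_measure; rewrite ?inE; [exact: measurableI|exact: measurableI (measurableD _ _) _|].
move=> x [Dx q'x]; split => //; split => // qx.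
have /asboolP := qs _ q's; move/seteqP => [/(_ x) + _]; exact.
Qed.

Lemma measure_seq_cover_le (s : seq (Rn R n * R)) D : measurable D ->
  (forall x, D x -> exists2 q, q \in s & scube q x) -> m D <= \sum_(q <- s) m (scube q).
Proof.
elim: s D => [|q s IH] D mD Ds.
  rewrite big_nil (_ : D = set0) ?measure0//; apply/seteqP; split => x // /Ds[q].
  by rewrite in_nil.
rewrite big_cons (measureDI m mD (mscube q)) addeC; apply: leeD.
  by apply: le_measure; rewrite ?inE//; exact: measurableI.
apply: IH; first exact: measurableD.
move=> x [Dx nqx]; have [q'] := Ds x Dx; rewrite inE => /orP[/eqP -> //|q's q'x].
by exists q'.
Qed.

(** The superlevel set is exhausted by finite unions of cubes on which the average
    exceeds [l]; the Vitali lemma extracts disjoint cubes whose triples still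
    cover, and doubling compares the triples with the cubes. *)
Lemma cube_maximal_weak D (l : R) : measurable D -> (0 < l)%R ->
  m [set x | l%:E < cube_maximal (EFin \o \1_D) x] <= (C / l)%:E * m D.
Proof.
move=> mD l0; rewrite superlevelE.
set F := [set Q | _].
have FE Q : F Q -> cubes Q /\ l%:E * m Q <= m (D `&` Q).
  move=> [cQ]; under eq_integral do rewrite /= ger0_norm//.
  have mQ := measurable_cubes cQ.
  rewrite integral_indic// => lQ; split => //; rewrite muleC leNgt; apply/negP => /ltW.
  by rewrite -cube_average_le// leNgt lQ.
have [|Q FQ ->] := @cubes_countable_subcover R n F; first by move=> Q [].
have exq k : exists q : Rn R n * R, F (Q k) -> (0 < q.2)%R /\ Q k = scube q.
  have [FQk|nFQ] := pselect (F (Q k)); last by exists (nseq_tuple n 0%R, 0%R).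
  by have [[a [r [r0 ->]]] _] := FE _ FQk; exists (a, r).
have [q Hq] := choice exq.
have mQ k : measurable (Q k).
  by case: (FQ k) => [/FE[cQ _]|->//]; exact: measurable_cubes.
pose U k := \bigcup_(i in [set i | (i < k)%N]) Q i.
have mU k : measurable (U k) by apply: bigcup_measurable.
have -> : \bigcup_k Q k = \bigcup_k U k.
  apply/seteqP; split => x [k _]; first by move=> Qx; exists k.+1 => //; exists k => //=.
  by move=> [i _ Qx]; exists i.
have ndU : nondecreasing_seq U.
  by move=> i j ij; apply/subsetPset => x [k ki Qx]; exists k => //=; exact: leq_trans ki ij.
rewrite leNgt; apply/negP => /(lt_measure_bigcup mU ndU)[k]; apply/negP; rewrite -leNgt.
pose s := [seq q i | i <- iota 0 k & `[< F (Q i) >]].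
have sP p : p \in s -> [/\ (0 < p.2)%R, cubes (scube p) & l%:E * m (scube p) <= m (D `&` scube p)].
  move=> /mapP[i]; rewrite mem_filter => /andP[/asboolP Fi _] ->.
  have [q0 Qq] := Hq i Fi; have [_ lm] := FE _ Fi; rewrite -Qq; split => //.
  by rewrite Qq; exact: cubes_scube.
have [|s' [s's ps' covs']] := vitali_cubes (s := s); first by move=> p /sP[].
have covU x : U k x -> exists2 p, p \in map (@tripled R n) s' & scube p x.
  move=> [i /= ik Qx]; have [|p p_s' px] := covs' x; last by exists (tripled p) => //; exact: map_f.
  case: (FQ i) => [Fi|Q0]; last by move: Qx; rewrite Q0.
  exists (q i); last by have [_ <-] := Hq i Fi.
  by apply/mapP; exists i => //; rewrite mem_filter mem_iota /= add0n ik andbT; apply/asboolP.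
apply: le_trans (measure_seq_cover_le (mU k) covU) _.
rewrite big_map; apply: (@le_trans _ _ (\sum_(p <- s') (C / l)%:E * m (D `&` scube p))).
  rewrite big_seq [leRHS]big_seq; apply: lee_sum => p p_s'; have [p0 cp lp] := sP _ (s's _ p_s').
  apply: le_trans (doubling p0) _; rewrite EFinM -muleA lee_wpmul2l ?lee_fin//.
  by rewrite lee_pdivlMl.
rewrite -ge0_sume_distrr => [|p _]; last exact: measure_ge0.
by rewrite lee_wpmul2l ?lee_fin ?divr_ge0// ?(ltW l0)//; exact: sum_measure_pairwise_le.
Qed.

End weak_type.

End cube_maximal.

(** * Muckenhoupt weights *)

Lemma ae_exists {d} {T : measurableType d} {R : realType} (mu : {measure set T -> \bar R})
    (D : set T) (P : T -> Prop) : measurable D -> 0 < mu D ->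
  (\forall x \ae mu, P x) -> exists2 x, D x & P x.
Proof.
move=> mD D0 [N [mN N0 NP]]; apply: contrapT => H.
have : mu D <= mu N.
  apply: le_measure; rewrite ?inE// => x Dx; apply: NP => Px; apply: H; by exists x.
by rewrite N0 leNgt D0.
Qed.

Lemma integral_gt0 {d} {T : measurableType d} {R : realType} (mu : {measure set T -> \bar R})
    (D : set T) (f : T -> \bar R) : measurable D -> 0 < mu D -> measurable_fun D f ->
  (\forall x \ae mu, f x != 0) -> 0 < \int[mu]_(x in D) `|f x|.
Proof.
move=> mD D0 mf f0; rewrite lt_neqAle integral_ge0// andbT eq_sym; apply/eqP => I0.
have /(_ I0) f_0 := (ae_eq_integral_abs mu mD mf).1.
have [x Dx [/eqP fx]] : exists2 x, D x & (f x != 0 /\ (D x -> f x = 0)).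
  apply: (ae_exists mD D0); apply: filterS2 f0 f_0 => x; by split.
by move=> /(_ Dx).
Qed.

Section muckenhoupt_weights.
Context {R : realType} {n : nat}.
Local Notation mu := (lebesgueRn R n).
Implicit Types (w v : Rn R n -> \bar R) (Q : set (Rn R n)).

Lemma lebesgueRn_cubes Q : cubes Q -> exists2 r : R, (0 < r)%R & mu Q = r%:E.
Proof.
by move=> [a [l [l0 ->]]]; exists (l ^+ n)%R; rewrite ?exprn_gt0//; exact: lebesgueRn_cube.
Qed.

Lemma lebesgueRn_cubes_gt0 Q : cubes Q -> 0 < mu Q.
Proof. by move=> /lebesgueRn_cubes[r r0 ->]. Qed.

Lemma lebesgueRn_cubes_lty Q : cubes Q -> mu Q < +oo.
Proof. by move=> /lebesgueRn_cubes[r r0 ->]; rewrite ltry. Qed.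

Lemma maximal_integral_le w x Q : cubes Q -> Q x ->
  \int[mu]_(y in Q) `|w y| <= mu Q * maximal w x.
Proof.
exact: (cube_maximal_integral_le lebesgueRn_cubes_gt0 lebesgueRn_cubes_lty).
Qed.

(** A bound [c] on the [A_1] constant of [w], multiplied out so as to be used
    pointwise. *)
Definition A1_bound w (c : R) := \forall x \ae mu, maximal w x <= c%:E * w x.

Lemma A1_bound_constant w : muckenhoupt 1 w -> A1_bound w (fine (A1_constant w)).
Proof.
move=> [[mw w0]]; rewrite /Ap_constant eqxx => Afin.
have maximal0 x : 0 <= maximal w x.
  exact: (cube_maximal_ge0 lebesgueRn_cubes_gt0 lebesgueRn_cubes_lty).
have [a aA] : exists a : R, A1_constant w <= a%:E.
  by move: Afin; case: (A1_constant w) => [r _|//|_]; [exists r|exists 0%R; rewrite leNye].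
have Age : \forall x \ae mu, maximal w x <= A1_constant w * w x /\ 0 <= A1_constant w.
  apply: filterS2 w0 (ess_sup_ge mu (fun x => maximal w x / w x)) => x /andP[wx0 wx1].
  rewrite -/(A1_constant w).
  have := maximal0 x; move: wx0 wx1; case: (w x) => [r| |]// r0 _ m0.
  rewrite inver gt_eqF// => H.
  have A0 : 0 <= A1_constant w by apply: le_trans H; rewrite mule_ge0// lee_fin invr_ge0 ltW.
  by split => //; move: H; rewrite muleC lee_pdivrMl// muleC.
apply: filterS Age => x [H A0]; rewrite fineK// ge0_fin_numE//.
Qed.

Section A1_bound.
Context {w : Rn R n -> \bar R} {c : R}.
Hypotheses (ww : is_weight mu w) (wc : A1_bound w c).

Let mw : measurable_fun setT w. Proof. by case: ww. Qed.

Let maw D : measurable_fun D (fun x => `|w x|).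
Proof. by apply: measurable_funTS; exact: measurableT_comp. Qed.

Lemma A1_bound_integral_le : \forall x \ae mu, forall Q, cubes Q -> Q x ->
  \int[mu]_(y in Q) `|w y| <= mu Q * (c%:E * w x).
Proof.
apply: filterS wc => x wx Q cQ Qx.
by apply: le_trans (maximal_integral_le w cQ Qx) _; rewrite lee_wpmul2l// measure_ge0.
Qed.

Lemma weight_integral_lty Q : cubes Q -> \int[mu]_(x in Q) `|w x| < +oo.
Proof.
move=> cQ; have [x Qx [/andP[w0 w1] /(_ Q cQ Qx) H]] :=
  ae_exists (measurable_cubes cQ) (lebesgueRn_cubes_gt0 cQ) (filterI ww.2 A1_bound_integral_le).
apply: le_lt_trans H _; have [r r0 ->] := lebesgueRn_cubes cQ.
by move: w0 w1; case: (w x) => [s| |]// _ _; rewrite -!EFinM ltry.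
Qed.

Lemma weight_integral_gt0 Q : cubes Q -> 0 < \int[mu]_(x in Q) `|w x|.
Proof.
move=> cQ; apply: integral_gt0; [exact: measurable_cubes|exact: lebesgueRn_cubes_gt0|exact: measurable_funTS|].
by apply: filterS ww.2 => x /andP[w0 _]; rewrite gt_eqF.
Qed.

(** Almost everywhere on [D], the average over [Q] is at most [c w]; integrate over
    [D]. For [D = Q] this gives [1 <= c], and for a cube [D] of triple [Q] the
    doubling property. *)
Lemma A1_bound_average Q D : (0 <= c)%R -> cubes Q -> measurable D -> D `<=` Q ->
  mu D * \int[mu]_(x in Q) `|w x| <= mu Q * (c%:E * \int[mu]_(x in D) `|w x|).
Proof.
move=> c0 cQ mD DQ; have [r r0 Qr] := lebesgueRn_cubes cQ.
have Ifin : \int[mu]_(x in Q) `|w x| \is a fin_num.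
  by rewrite ge0_fin_numE ?integral_ge0// weight_integral_lty.
rewrite muleC -(fineK Ifin) -integral_cst// fineK//.
rewrite Qr muleA -EFinM -ge0_integralZl//; last by rewrite lee_fin mulr_ge0// ltW.
apply: ae_ge0_le_integral => //.
- by move=> x _; exact: integral_ge0.
- by move=> x _; rewrite mule_ge0// lee_fin mulr_ge0// ltW.
- by apply: emeasurable_funM.
apply: filterS2 ww.2 A1_bound_integral_le => x /andP[w0 w1] H Dx.
have := H Q cQ (DQ _ Dx); rewrite Qr muleA -EFinM gee0_abs//; exact: ltW.
Qed.

Lemma A1_bound_ge1 : (1 <= c)%R.
Proof.
have [Q cQ _] := cubes_cover ([tuple of nseq n 0%R] : Rn R n).
have mQ := measurable_cubes cQ; have [r r0 Qr] := lebesgueRn_cubes cQ.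
have I0 := weight_integral_gt0 cQ; have I1 := weight_integral_lty cQ.
have c0 : (0 <= c)%R.
  have [x Qx [/andP[w0 w1] /(_ Q cQ Qx) H]] :=
    ae_exists mQ (lebesgueRn_cubes_gt0 cQ) (filterI ww.2 A1_bound_integral_le).
  have := lt_le_trans I0 H; rewrite Qr pmule_rgt0// => {}H.
  by rewrite -lee_fin ltW// -(@pmule_lgt0 _ (w x)).
have := A1_bound_average c0 cQ mQ (@subset_refl _ Q); rewrite Qr lee_pmul2l//.
move: I0 I1; case: (\int[mu]_(x in Q) `|w x|) => [s| |]//; rewrite lte_fin => s0 _.
by rewrite -EFinM lee_fin -{1}[s]mul1r ler_pM2r.
Qed.

Lemma A1_bound_doubling (q : Rn R n * R) : (0 < q.2)%R ->
  \int[mu]_(x in scube (tripled q)) `|w x| <= (3 ^+ n * c)%:E * \int[mu]_(x in scube q) `|w x|.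
Proof.
move=> q0; have c0 : (0 <= c)%R by rewrite (le_trans ler01)// A1_bound_ge1.
have cQ : cubes (scube (tripled q)).
  by exists (tripled q).1, (tripled q).2; split => //; rewrite mulr_gt0.
have := A1_bound_average c0 cQ (measurable_cube _ _) (sub_tripled q0).
rewrite /scube !lebesgueRn_cube//; last by rewrite mulr_gt0.
have qn : (0 < q.2 ^+ n)%R by rewrite exprn_gt0.
have -> : ((tripled q).2 ^+ n)%:E = (q.2 ^+ n)%:E * (3 ^+ n)%:E by rewrite -EFinM exprMn mulrC.
by rewrite -muleA lee_pmul2l// muleA.
Qed.

End A1_bound.

End muckenhoupt_weights.

Section powers.
Context {R : realType}.
Implicit Types (x y z : R).

Lemma powR_antitone q x y : (0 <= q)%R -> (0 < x)%R -> (x <= y)%R -> (y `^ (- q) <= x `^ (- q))%R.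
Proof.
move=> q0 x0 xy; have y0 : (0 < y)%R by exact: lt_le_trans xy.
rewrite !powRN lef_pV2 ?posrE ?powR_gt0//.
by apply: ge0_ler_powR => //; rewrite nnegrE ltW.
Qed.

(** The tangent line at 1 of the convex function [z |-> z `^ (- q)]. *)
Lemma powRN_tangent q z : (0 <= q)%R -> (0 < z)%R -> (1 + q <= z `^ (- q) + q * z)%R.
Proof.
move=> q0 z0; have lnz : (ln z <= z - 1)%R.
  by have := @le_ln1Dx R (z - 1)%R; rewrite addrCA subrr addr0; apply; lra.
rewrite /powR gt_eqF//; have := expR_ge1Dx (- q * ln z)%R.
have : (q * ln z <= q * (z - 1))%R by rewrite ler_wpM2l.
lra.
Qed.

Lemma powRNV q x : (q != 0)%R -> (0 <= x)%R -> ((x `^ (- q)) `^ (- q^-1) = x)%R.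
Proof. by move=> q0 x0; rewrite -powRrM mulrNN mulfV// powRr1. Qed.

End powers.

Section Ap_weights.
Context {R : realType} {n : nat}.
Local Notation mu := (lebesgueRn R n).
Implicit Types (u w : Rn R n -> \bar R) (p : R).

Lemma conjugate_exponentB p : (1 < p)%R -> (1 - conjugate_exponent p = - (p - 1)^-1)%R.
Proof.
move=> p1; rewrite /conjugate_exponent.
have p0 : (p - 1 != 0)%R by rewrite subr_eq0 gt_eqF.
by field.
Qed.

Lemma dual_weightE p u x (r : R) : (1 < p)%R -> u x = r%:E ->
  dual_weight p u x = (r `^ (- (p - 1)^-1))%:E.
Proof. by move=> p1 ux; rewrite /dual_weight ux poweR_EFin conjugate_exponentB. Qed.

Lemma measurable_dual_weight p u : measurable_fun setT u -> measurable_fun setT (dual_weight p u).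
Proof. by move=> mu_; exact: (measurableT_comp (measurable_poweR _) mu_). Qed.

Let ae_fin u : is_weight mu u -> \forall x \ae mu, exists2 r : R, (0 < r)%R & u x = r%:E.
Proof.
move=> [_]; apply: filterS => x /andP[]; case: (u x) => [r| |]// r0 _; by exists r.
Qed.

Lemma fin_integralE (w : Rn R n -> \bar R) (Q : set (Rn R n)) : 0 < \int[mu]_(x in Q) `|w x| ->
  \int[mu]_(x in Q) `|w x| < +oo ->
  exists2 s : R, (0 < s)%R & \int[mu]_(x in Q) `|w x| = s%:E.
Proof. by case: (\int[mu]_(x in Q) `|w x|) => [s s0 _| |]//; exists s. Qed.

(** Almost everywhere on a cube, both [A_1] weights are bounded below by their
    averages. The first bound is used in the average of the product, the second
    in the average of its dual weight, and all averages cancel. *)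
Lemma Ap_constant_product p u w (s c : R) : (1 < p)%R ->
  is_weight mu u -> is_weight mu (dual_weight p u) -> A1_bound (dual_weight p u) s ->
  is_weight mu w -> A1_bound w c ->
  Ap_constant p (fun x => `|u x| * `|w x|) <= (s `^ (p - 1) * c)%:E.
Proof.
move=> p1 wu ws us ww wc.
have s1 := A1_bound_ge1 ws us; have c1 := A1_bound_ge1 ww wc.
have s0 : (0 < s)%R by exact: lt_le_trans s1.
have c0 : (0 < c)%R by exact: lt_le_trans c1.
set q := (p - 1)^-1%R; have p0 : (0 < p - 1)%R by rewrite subr_gt0.
have q0 : (0 < q)%R by rewrite invr_gt0.
have qp : (q^-1 = p - 1)%R by rewrite invrK.
rewrite /Ap_constant gt_eqF//; apply/ereal_supP => _ [Q cQ <-].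
have [r r0 Qr] := lebesgueRn_cubes cQ; have mQ := measurable_cubes cQ.
have [S S0 SE] := fin_integralE (weight_integral_gt0 ws cQ) (weight_integral_lty ws us cQ).
have [B B0 BE] := fin_integralE (weight_integral_gt0 ww cQ) (weight_integral_lty ww wc cQ).
have bounds : \forall x \ae mu, Q x -> exists a b : R, [/\ (0 < a)%R, (0 < b)%R,
    u x = a%:E, w x = b%:E & (S / (r * s) <= a `^ (- q) /\ B / (r * c) <= b)%R].
  apply: filterS2 (filterI (ae_fin wu) (ae_fin ww))
    (filterI (A1_bound_integral_le us) (A1_bound_integral_le wc)).
  move=> x [[a a0 ua] [b b0 wb]] [Hs Hw] Qx; exists a, b; split => //.
  have := Hs Q cQ Qx; have := Hw Q cQ Qx.
  rewrite SE BE Qr (dual_weightE p1 ua) wb -!EFinM !lee_fin !mulrA => h1 h2.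
  by split; rewrite ler_pdivrMr ?mulr_gt0// mulrC.
pose k1 := ((S / (r * s)) `^ (- (p - 1)))%R.
pose k2 := ((B / (r * c)) `^ (- q))%R.
have Srs0 : (0 < S / (r * s))%R by rewrite divr_gt0// mulr_gt0.
have Brc0 : (0 < B / (r * c))%R by rewrite divr_gt0// mulr_gt0.
have mu_ : measurable_fun setT u by case: wu.
have mw_ : measurable_fun setT w by case: ww.
have mau : measurable_fun setT (fun x => `|u x|) by exact: measurableT_comp.
have maw : measurable_fun setT (fun x => `|w x|) by exact: measurableT_comp.
have mp : measurable_fun setT (fun x => `|u x| * `|w x|) by exact: emeasurable_funM.
have I1 : \int[mu]_(x in Q) (`|u x| * `|w x|) <= (k1 * B)%:E.
  rewrite EFinM -BE -ge0_integralZl//; last 2 first.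
  - exact: measurable_funTS.
  - by rewrite lee_fin powR_ge0.
  apply: ae_ge0_le_integral => //.
  - exact: measurable_funTS.
  - by move=> x _; rewrite mule_ge0// lee_fin powR_ge0.
  - by apply: emeasurable_funM => //; exact: measurable_funTS.
  apply: filterS bounds => x H Qx; have [a [b [a0 b0 ua wb [h1 h2]]]] := H Qx.
  rewrite ua wb lee_wpmul2r//= lee_fin gtr0_norm// -[leLHS](@powRNV R q)// ?gt_eqF// ?(ltW a0)//.
  by rewrite qp; apply: powR_antitone => //; exact: ltW.
have I2 : \int[mu]_(x in Q) dual_weight p (fun x => `|u x| * `|w x|) x <= (k2 * S)%:E.
  rewrite EFinM -SE -ge0_integralZl//; last 2 first.
  - apply: measurable_funTS; apply: measurableT_comp => //; exact: measurable_dual_weight.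
  - by rewrite lee_fin powR_ge0.
  apply: ae_ge0_le_integral => //.
  - by move=> x _; exact: poweR_ge0.
  - by apply: measurable_funTS; exact: measurable_dual_weight.
  - by move=> x _; rewrite mule_ge0// lee_fin powR_ge0.
  - apply: emeasurable_funM => //; apply: measurable_funTS; apply: measurableT_comp => //.
    exact: measurable_dual_weight.
  apply: filterS bounds => x H Qx; have [a [b [a0 b0 ua wb [h1 h2]]]] := H Qx.
  rewrite (@dual_weightE p (fun x => `|u x| * `|w x|) x (a * b)%R)//; last first.
    by rewrite ua wb /= !gtr0_norm.
  rewrite (dual_weightE p1 ua) /= (ger0_norm (powR_ge0 _ _)) -EFinM lee_fin -/q.
  rewrite powRM ?(ltW a0)// ?(ltW b0)// mulrC ler_wpM2r ?powR_ge0//.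
  by apply: powR_antitone => //; exact: ltW.
rewrite /average Qr inver gt_eqF//.
apply: (@le_trans _ _ ((r^-1)%:E * (k1 * B)%:E * ((r^-1)%:E * (k2 * S)%:E) `^ (p - 1))).
  apply: lee_pmul.
  - by rewrite mule_ge0 ?lee_fin ?invr_ge0 ?(ltW r0)//; apply: integral_ge0 => x _; rewrite mule_ge0.
  - exact: poweR_ge0.
  - by rewrite lee_wpmul2l// lee_fin invr_ge0 ltW.
  have Iq0 : 0 <= \int[mu]_(x in Q) dual_weight p (fun x => `|u x| * `|w x|) x.
    by apply: integral_ge0 => x _; exact: poweR_ge0.
  apply: gt0_ler_poweR; rewrite ?in_itv/= ?leey ?andbT ?mule_ge0 ?lee_fin ?invr_ge0 ?(ltW r0) ?(ltW p0)//.
  - by rewrite mulr_ge0 ?powR_ge0 ?(ltW S0).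
  - by rewrite lee_wpmul2l// lee_fin invr_ge0 ltW.
rewrite -[(r^-1)%:E * (k2 * S)%:E]EFinM poweR_EFin -!EFinM lee_fin.
have k2E : (k2 `^ (p - 1) = r * c / B)%R.
  by rewrite -powRrM mulNr mulVf ?gt_eqF// powR_inv1 ?(ltW Brc0)// invf_div.
(* Every power is expressed by [X], which cancels. *)
pose X := ((S / (r * s)) `^ (p - 1))%R.
have X0 : (0 < X)%R by rewrite powR_gt0.
have k1E : (k1 = X^-1)%R by rewrite /k1 powRN.
have SrE : ((S / r) `^ (p - 1) = X * s `^ (p - 1))%R.
  rewrite -powRM ?(ltW Srs0) ?(ltW s0)//; congr (_ `^ _)%R; field.
  by rewrite !gt_eqF.
have -> : (r^-1 * (k2 * S) = (S / r) * k2)%R by ring.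
rewrite powRM ?powR_ge0 ?divr_ge0 ?(ltW S0) ?(ltW r0)// k2E k1E SrE.
rewrite le_eqVlt; apply/orP; left; apply/eqP; field.
by rewrite !gt_eqF.
Qed.

(** Jensen's inequality for the convex function [z |-> z ^ (1 - p')], by
    integrating its tangent line at the average. *)
Lemma Ap_constant_ge1 p w : (1 < p)%R -> is_weight mu w -> (forall x, 0 <= w x) ->
  1 <= Ap_constant p w.
Proof.
move=> p1 ww w0.
set q := (p - 1)^-1%R; have p0 : (0 < p - 1)%R by rewrite subr_gt0.
have q0 : (0 < q)%R by rewrite invr_gt0.
have [Q cQ _] := cubes_cover ([tuple of nseq n 0%R] : Rn R n).
have mQ := measurable_cubes cQ; have [r r0 Qr] := lebesgueRn_cubes cQ.
have mw_ : measurable_fun setT w by case: ww.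
have md : measurable_fun setT (dual_weight p w) by exact: measurable_dual_weight.
rewrite /Ap_constant gt_eqF//; apply: le_ereal_sup_tmp.
exists (average w Q * average (dual_weight p w) Q `^ (p - 1)); first by exists Q.
have d0 x : 0 <= dual_weight p w x by exact: poweR_ge0.
have a0 : 0 < \int[mu]_(x in Q) w x.
  rewrite (eq_integral (fun x => `|w x|)); last by move=> x _; rewrite gee0_abs.
  exact: weight_integral_gt0.
have b0 : 0 < \int[mu]_(x in Q) dual_weight p w x.
  rewrite (eq_integral (fun x => `|dual_weight p w x|)); last by move=> x _; rewrite gee0_abs.
  apply: integral_gt0 => //; first exact: lebesgueRn_cubes_gt0.
    exact: measurable_funTS.
  apply: filterS (ae_fin ww) => x [t t0 wx].
  by rewrite (dual_weightE p1 wx) gt_eqF// lte_fin powR_gt0.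
rewrite /average Qr inver gt_eqF//.
have ri0 : 0 < (r^-1)%:E by rewrite lte_fin invr_gt0.
have [a_oo|a_fin] := eqVneq (\int[mu]_(x in Q) w x) +oo.
  rewrite a_oo gt0_muley// gt0_mulye ?leey//.
  by rewrite lt_neqAle poweR_ge0 andbT eq_sym poweR_eq0 ?gt_eqF ?mule_gt0//= mule_ge0// ltW.
have [b_oo|b_fin] := eqVneq (\int[mu]_(x in Q) dual_weight p w x) +oo.
  rewrite b_oo gt0_muley// poweRyr ?gt_eqF// gt0_muley ?leey//.
  by rewrite mule_gt0.
have [a Ea] : exists a : R, \int[mu]_(x in Q) w x = a%:E.
  by move: a0 a_fin; case: (\int[mu]_(x in Q) w x) => [a| |]//; exists a.
have [b Eb] : exists b : R, \int[mu]_(x in Q) dual_weight p w x = b%:E.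
  by move: b0 b_fin; case: (\int[mu]_(x in Q) dual_weight p w x) => [b| |]//; exists b.
rewrite Ea lte_fin in a0; rewrite Eb lte_fin in b0.
rewrite Ea Eb -[(r^-1)%:E * b%:E]EFinM poweR_EFin -!EFinM lee_fin.
rewrite ![(r^-1 * _)%R]mulrC; set A := (a / r)%R.
have A0 : (0 < A)%R by rewrite divr_gt0.
pose k := (q * A `^ (- q) / A)%R.
have k0 : (0 <= k)%R by rewrite divr_ge0 ?(ltW A0)// mulr_ge0 ?powR_ge0// ltW.
have : (A `^ (- q) * (1 + q) * r)%:E <= (b + k * a)%:E.
  rewrite EFinD (EFinM k) -Ea -Eb -ge0_integralZl//; last exact: measurable_funTS.
  have md' : measurable_fun Q (dual_weight p w) by exact: measurable_funTS.
  have mk' : measurable_fun Q (fun x => k%:E * w x).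
    by apply: emeasurable_funM => //; exact: measurable_funTS.
  have k_ge0 x : 0 <= k%:E * w x by rewrite mule_ge0// lee_fin.
  rewrite -ge0_integralD//.
  rewrite EFinM -Qr -integral_cst//; apply: ae_ge0_le_integral => //.
  - by move=> x _; rewrite lee_fin mulr_ge0 ?powR_ge0// addr_ge0// ltW.
  - by move=> x _; rewrite adde_ge0.
  - exact: emeasurable_funD.
  apply: filterS (ae_fin ww) => x [t t0 wx] _; rewrite (dual_weightE p1 wx) wx -EFinM -EFinD lee_fin -/q.
  have tA0 : (0 < t / A)%R by rewrite divr_gt0.
  apply: le_trans (ler_wpM2l (powR_ge0 A (- q)) (powRN_tangent (ltW q0) tA0)) _.
  rewrite mulrDr -powRM ?(ltW A0) ?(ltW tA0)//.
  rewrite (_ : (A * (t / A) = t)%R); last by rewrite mulrC divfK// gt_eqF.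
  by rewrite lerD2l le_eqVlt; apply/orP; left; apply/eqP; rewrite /k; ring.
rewrite lee_fin => H.
have Ab : (A `^ (- q) <= b / r)%R.
  rewrite ler_pdivlMr//; move: H.
  have -> : (k * a = A `^ (- q) * q * r)%R by rewrite /k /A; field; rewrite !gt_eqF.
  by rewrite mulrDr mulr1 mulrDl lerD2r.
apply: (@le_trans _ _ (A * (A `^ (- q)) `^ (p - 1))%R).
  by rewrite -powRrM mulNr mulVf ?gt_eqF// powR_inv1 ?(ltW A0)// mulfV ?gt_eqF.
rewrite ler_wpM2l ?(ltW A0)//; apply: ge0_ler_powR => //; rewrite ?nnegrE ?powR_ge0 ?(ltW p0)//.
by rewrite divr_ge0// ltW.
Qed.

End Ap_weights.

(** * The Rubio de Francia algorithm *)

Lemma increases_to_nneseries {d} {T : measurableType d} {R : realType} (h : nat -> T -> \bar R) :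
  (forall k x, 0 <= h k x) ->
  increases_to (fun n x => \sum_(0 <= k < n) h k x) (fun x => \sum_(0 <= k <oo) h k x).
Proof.
move=> h0; have nd x : nondecreasing_seq (fun n => \sum_(0 <= k < n) h k x).
  by move=> k l kl; apply: lee_sum_nneg_natr.
split=> [k x|k l x kl|x]; [exact: sume_ge0|exact: nd|].
by apply/cvg_lim => //; exact: ereal_nondecreasing_cvgn (nd x).
Qed.

Section boxes.
Context {R : realType} {n : nat}.

Definition box (k : nat) : set (Rn R n) :=
  cube [tuple of nseq n (- k.+1%:R)%R] (k.+1%:R + k.+1%:R)%R.

Lemma boxP k (x : Rn R n) : box k x <-> forall i, (`|tnth x i| < k.+1%:R)%R.
Proof.
by split=> H i; have := H i; rewrite tnth_nseq ltr_norml addKr.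
Qed.

Lemma cubes_box k : cubes (box k).
Proof. by exists [tuple of nseq n (- k.+1%:R)%R], (k.+1%:R + k.+1%:R)%R; split => //; rewrite addr_gt0. Qed.

Lemma box_nondecreasing : nondecreasing_seq box.
Proof.
move=> k l kl; apply/subsetPset => x /boxP xk; apply/boxP => i.
by apply: (lt_le_trans (xk i)); rewrite ler_nat.
Qed.

Lemma bigcup_box : \bigcup_k box k = setT.
Proof.
apply/seteqP; split => // x _; pose M := \max_(i < n) Num.truncn `|tnth x i|%R.
exists M => //; apply/boxP => i; apply: lt_le_trans (truncnS_gt _) _.
by rewrite ler_nat ltnS; exact: (@leq_bigmax _ (fun i : 'I_n => Num.truncn `|tnth x i|%R)).
Qed.

End boxes.

Section associate_local.
Context {R : realType} (Nb : (measurableTypeR R -> \bar R) -> \bar R).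
Hypothesis riN : ri_function_norm (lebesgue_half R) Nb.
Context {d} {T : measurableType d}.
Variable m : {measure set T -> \bar R}.

Lemma rnorm_indic_lty (D : set T) : measurable D -> m D < +oo ->
  rnorm Nb m (EFin \o \1_D) < +oo.
Proof.
move=> mD finD; pose G k := if k is 0%N then D else set0.
have nG : nested 1 G.
  split=> [k|k l kl x|//]; first by case: k => //=; exact: measurable0.
  by case: l kl => [|l] //; rewrite leqn0 => /eqP ->.
have -> : (EFin \o \1_D : T -> \bar R) = step (fun i : 'I_1 => shell G i) (fun i => 1 * i.+1%:R)%R.
  apply/funext => x; rewrite -(layered_step nG) /layered /step big_ord1 mul1r//.
by rewrite (rnorm_step_shell riN nG finD); exact: fnorm_step_lty.
Qed.

(** Hoelder's inequality against an indicator. It shows both that the majorants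
    below are finite almost everywhere and that the norm of the maximal operator
    is not 0. *)
Lemma assoc_locally_integrable (D : set T) : measurable D -> m D < +oo ->
  exists b : R, forall h (a : R), measurable_fun setT h -> assoc Nb m h <= a%:E ->
    \int[m]_(x in D) `|h x| <= (a * b)%:E.
Proof.
move=> mD finD; have := rnorm_indic_lty mD finD.
have := rnorm_ge0 riN m (EFin \o \1_D).
case E : (rnorm Nb m (EFin \o \1_D)) => [b| |]// b0 _.
exists b => h a mh ha.
have m1 : measurable_fun setT (EFin \o \1_D : T -> \bar R).
  by apply/measurable_EFinP; exact: measurable_indic.
have := hoelder_assoc riN mh m1 ha (_ : _ <= b%:E); rewrite E lexx => /(_ isT).
apply: le_trans; rewrite integral_mkcond le_eqVlt; apply/orP; left; apply/eqP.
by apply: eq_integral => x _; rewrite epatch_indic abseM /= [`|\1_D x|%R]ger0_norm.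
Qed.

(** By monotone convergence, as the coefficients add up to 2. *)
Lemma assoc_series (h : nat -> T -> \bar R) : (forall k, measurable_fun setT (h k)) ->
  (forall k x, 0 <= h k x) -> (forall k, assoc Nb m (h k) <= 1) ->
  assoc Nb m (fun x => \sum_(0 <= k <oo) (2^-1 ^+ k)%:E * h k x) <= 2%:E.
Proof.
move=> mh h0 h1; apply/ereal_supP => _ [g [mg g1] <-].
have mag : measurable_fun setT (fun x => `|g x|) by exact: measurableT_comp.
have c0 k : (0 <= 2^-1 ^+ k :> R)%R by rewrite exprn_ge0.
have t0 k x : 0 <= (2^-1 ^+ k)%:E * h k x by rewrite mule_ge0// lee_fin.
have F0 n x : 0 <= \sum_(0 <= k < n) (2^-1 ^+ k)%:E * h k x by exact: sume_ge0.
have inc := increases_to_nneseries t0.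
under eq_integral do rewrite abseM gee0_abs ?nneseries_ge0//.
have mF n : measurable_fun setT (fun x => \sum_(0 <= k < n) (2^-1 ^+ k)%:E * h k x).
  by apply: emeasurable_sum => k; exact: emeasurable_funM.
apply: (integral_increases_to_le (increases_toMr _ inc)) => // n; first exact: emeasurable_funM.
under eq_integral do rewrite ge0_sume_distrl//.
rewrite ge0_integral_sum//; last 2 first.
- by move=> k; apply: emeasurable_funM => //; exact: emeasurable_funM.
- by move=> k x _; rewrite mule_ge0.
apply: (@le_trans _ _ (\sum_(0 <= k < n) (2^-1 ^+ k)%:E)).
  apply: lee_sum => k _; under eq_integral do rewrite -muleA.
  have mhg : measurable_fun setT (fun x => h k x * `|g x|) by exact: emeasurable_funM.
  have hg0 x : 0 <= h k x * `|g x| by rewrite mule_ge0.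
  rewrite ge0_integralZl ?lee_fin//.
  rewrite -[leRHS]mule1 lee_wpmul2l ?lee_fin//; apply: le_trans (h1 k).
  apply: le_trans (assoc_ge _ mg g1).
  by rewrite le_eqVlt; apply/orP; left; apply/eqP; apply: eq_integral => x _; rewrite abseM (gee0_abs (h0 k x)).
rewrite sumEFin lee_fin; elim: n => [|n IH]; first by rewrite big_nil.
suff -> : (\sum_(0 <= k < n.+1) 2^-1 ^+ k = 2 - 2^-1 ^+ n :> R)%R by rewrite gerBl.
elim: n {IH} => [|n IH]; first by rewrite big_nat1 !expr0; lra.
by rewrite big_nat_recr//= IH exprS; lra.
Qed.

End associate_local.

Section rubio_de_francia.
Context {R : realType} (Nb : (measurableTypeR R -> \bar R) -> \bar R).
Hypothesis riN : ri_function_norm (lebesgue_half R) Nb.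
Context {n : nat}.
Variable m : {measure set (Rn R n) -> \bar R}.
Hypotheses (m_gt0 : forall Q, cubes Q -> 0 < m Q) (m_fin : forall Q, cubes Q -> m Q < +oo).
Variable A : R.
Hypothesis MA : forall f, measurable_fun setT f -> assoc Nb m f <= 1 ->
  assoc Nb m (cube_maximal m f) <= A%:E.

Let M_ge0 := cube_maximal_ge0 m_gt0 m_fin.
Let M_meas := measurable_cube_maximal m.

(** Large enough cubes contain both [x] and part of the support of [h]. *)
Lemma cube_maximal_gt0 h x : measurable_fun setT h -> (forall y, 0 <= h y) ->
  0 < \int[m]_y h y -> 0 < cube_maximal m h x.
Proof.
move=> mh h0; apply: contraTT; rewrite -!leNgt => Mx.
have [k0 _ xk0] : (\bigcup_k box k) x by rewrite bigcup_box.
have mb k : measurable (box k : set (Rn R n)) by exact: measurable_cube.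
have inc : increases_to (fun k y => h y * (\1_(box (k0 + k)) y)%:E) h.
  split=> [k y|k l y kl|y].
  - by rewrite mule_ge0.
  - rewrite lee_wpmul2l// lee_fin !indicE ler_nat.
    have [yk|] := boolP (y \in box (k0 + k)) => //.
    rewrite (_ : y \in box (k0 + l) = true)//; apply: mem_set.
    have /subsetPset := @box_nondecreasing R n (k0 + k)%N (k0 + l)%N (leq_add (leqnn _) kl).
    by apply; exact: set_mem.
  - apply/eqP; rewrite eq_le; apply/andP; split.
      have [k _ yk] : (\bigcup_k box k) y by rewrite bigcup_box.
      apply: ereal_sup_ubound; exists k => //; rewrite indicE mem_set ?mule1//.
      have /subsetPset := @box_nondecreasing R n k (k0 + k)%N (leq_addl _ _); exact.
    apply/ereal_supP => _ [k _ <-]; rewrite indicE.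
    by case: (_ \in _); rewrite ?mule1 ?mule0.
apply: (integral_increases_to_le inc) => k.
  by apply: emeasurable_funM => //; apply/measurable_EFinP; exact: measurable_indic.
have xk : box (k0 + k)%N x.
  have /subsetPset := @box_nondecreasing R n k0 (k0 + k)%N (leq_addr _ _); exact.
have := cube_maximal_integral_le m_gt0 m_fin h (cubes_box (k0 + k)) xk.
have -> : cube_maximal m h x = 0 by apply: le_anti; rewrite Mx M_ge0.
rewrite mule0; apply: le_trans; rewrite [leRHS]integral_mkcond.
rewrite le_eqVlt; apply/orP; left; apply/eqP; apply: eq_integral => y _.
by rewrite epatch_indic gee0_abs.
Qed.

(** [H] is the sum of [2^-k h_k] with [h_0 = h] and [h_(k+1) = A^-1 M h_k], all of
    associate norm at most 1. By sublinearity, applying [M] shifts the series,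
    at the cost of a factor [2 A]. *)
Lemma rubio_de_francia h : measurable_fun setT h -> (forall x, 0 <= h x) ->
  assoc Nb m h <= 1 -> 0 < \int[m]_x h x ->
  exists H, [/\ measurable_fun setT H, forall x, h x <= H x, forall x, 0 < H x,
    assoc Nb m H <= 2%:E &
    [/\ (0 < A)%R, forall x, cube_maximal m H x <= (2 * A)%:E * H x &
       \forall x \ae m, H x < +oo]].
Proof.
move=> mh h0 h1 hpos.
have Mh x : 0 < cube_maximal m h x by exact: cube_maximal_gt0.
have mbox k : measurable (box k : set (Rn R n)) by exact: measurable_cube.
have boxfin k : m (box k) < +oo by apply: m_fin; exact: cubes_box.
(* Otherwise [M h], which is positive everywhere, would have norm 0. *)
have A0 : (0 < A)%R.
  rewrite ltNge; apply/negP => A0.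
  have [b Hb] := assoc_locally_integrable riN (mbox 0%N) (boxfin 0%N).
  have MhA : assoc Nb m (cube_maximal m h) <= 0%:E by apply: le_trans (MA mh h1) _; rewrite lee_fin.
  have := Hb _ _ (M_meas h) MhA; rewrite mul0r leNgt => /negP; apply.
  apply: integral_gt0 => //; first by apply: m_gt0; exact: cubes_box.
    exact: measurable_funTS (M_meas h).
  by apply: aeW => x; rewrite gt_eqF.
pose hk := fix hk k : Rn R n -> \bar R := if k is k'.+1 then
  (fun x => (A^-1)%:E * cube_maximal m (hk k') x) else h.
have mhk k : measurable_fun setT (hk k).
  by case: k => [//|k] /=; apply: emeasurable_funM.
have hk0 k x : 0 <= hk k x.
  by case: k => [//|k] /=; rewrite mule_ge0// lee_fin invr_ge0 ltW.
have hk1 k : assoc Nb m (hk k) <= 1.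
  elim: k => [//|k IH] /=; apply/ereal_supP => _ [g [mg g1] <-].
  have := le_trans (assoc_ge (cube_maximal m (hk k)) mg g1) (MA (mhk k) IH).
  rewrite -[A%:E]mule1 -lee_pdivrMl//; apply: le_trans.
  rewrite -ge0_integralZl//; last 2 first.
  - by apply: measurableT_comp => //; exact: emeasurable_funM.
  - by rewrite lee_fin invr_ge0 ltW.
  rewrite le_eqVlt; apply/orP; left; apply/eqP; apply: eq_integral => x _.
  by rewrite -muleA [in LHS]abseM /= gtr0_norm ?invr_gt0.
pose c k : R := (2^-1 ^+ k)%R.
have c0 k : (0 <= c k)%R by rewrite exprn_ge0.
pose H x := \sum_(0 <= k <oo) (c k)%:E * hk k x.
have t0 k x : 0 <= (c k)%:E * hk k x by rewrite mule_ge0// lee_fin.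
have mt k : measurable_fun setT (fun x => (c k)%:E * hk k x) by exact: emeasurable_funM.
have mH : measurable_fun setT H by apply: ge0_emeasurable_sum => k *.
have H_ge k x : (c k)%:E * hk k x <= H x by exact: nneseries_ge_term.
have H2 : assoc Nb m H <= 2%:E by exact: assoc_series.
exists H; split => //.
- by move=> x; apply: le_trans (H_ge 0%N x); rewrite /c expr0 mul1e.
- by move=> x; apply: lt_le_trans (H_ge 1%N x); rewrite /= !mule_gt0// lte_fin ?invr_gt0.
split=> //.
- move=> x; apply: (cube_maximal_le m_gt0 m_fin) => Q cQ Qx.
  have mQ := measurable_cubes cQ; have [r r0 Qr] := cubesE m_gt0 m_fin cQ.
  under eq_integral do rewrite gee0_abs ?nneseries_ge0//.
  rewrite integral_nneseries//; last by move=> k; exact: measurable_funTS.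
  apply: (@le_trans _ _ (\sum_(0 <= k <oo) (r * (2 * A))%:E * ((c k.+1)%:E * hk k.+1 x))).
    apply: lee_nneseries => [k _ _|k _]; first exact: integral_ge0.
    rewrite ge0_integralZl//; last 2 first.
    - exact: measurable_funTS.
    - by rewrite lee_fin.
    rewrite (eq_integral (fun y => `|hk k y|)); last by move=> y _; rewrite gee0_abs.
    apply: le_trans (lee_wpmul2l _ (cube_maximal_integral_le m_gt0 m_fin (hk k) cQ Qx)) _.
      by rewrite lee_fin.
    rewrite Qr /= !muleA -!EFinM; rewrite le_eqVlt; apply/orP; left; apply/eqP.
    congr (_%:E * _); rewrite /c exprS; field; rewrite gt_eqF//.
  rewrite nneseriesZl// Qr muleA -EFinM lee_wpmul2l ?lee_fin ?mulr_ge0 ?(ltW r0) ?(ltW A0)//.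
  rewrite /H [leRHS]nneseries_recl//= -[leLHS]add0e leeD//.
  rewrite -(nneseries_addn (f := fun k => (c k)%:E * hk k x) 1)//.
  by rewrite le_eqVlt; apply/orP; left; apply/eqP; apply: eq_eseriesr => k _; rewrite addn1.
have : \forall x \ae m, forall k, box k x -> H x < +oo.
  apply/ae_foralln => k.
  have [b Hb] := assoc_locally_integrable riN (mbox k) (boxfin k).
  have HI : m.-integrable (box k) H.
    apply/integrableP; split; first exact: measurable_funTS.
    by apply: le_lt_trans (Hb H 2%R mH H2) _; rewrite ltry.
  apply: filterS (integrable_ae (mbox k) HI) => x Hx xk.
  by have := Hx xk; rewrite fin_numE => /andP[_]; rewrite ltey.
apply: filterS => x Hx; have [k _ xk] : (\bigcup_k box k) x by rewrite bigcup_box.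
exact: Hx xk.
Qed.

End rubio_de_francia.

(** * Extrapolation *)

Section weighted_measure.
Context {R : realType} {n : nat}.
Local Notation mu := (lebesgueRn R n).
Context {v : Rn R n -> \bar R}.
Hypotheses (wv : is_weight mu v) (mv : measurable_fun setT v).
Local Notation nu := (density mu mv).

Let v_ae : \forall x \ae mu, `|v x| = v x.
Proof. by apply: filterS wv.2 => x /andP[v0 _]; rewrite gee0_abs// ltW. Qed.

Lemma integral_weight (D : set (Rn R n)) (f : Rn R n -> \bar R) : measurable D ->
  measurable_fun setT f -> (forall x, 0 <= f x) ->
  \int[mu]_(x in D) (f x * v x) = \int[nu]_(x in D) f x.
Proof.
move=> mD mf f0; have m1 : measurable_fun setT (fun x => (\1_D x)%:E : \bar R).
  by apply/measurable_EFinP; exact: measurable_indic.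
rewrite [RHS]integral_mkcond.
transitivity (\int[nu]_x (f x * (\1_D x)%:E)); last first.
  by apply: eq_integral => x _; rewrite epatch_indic.
rewrite integral_density; last 2 first.
- exact: emeasurable_funM.
- by move=> x; rewrite mule_ge0.
rewrite [LHS]integral_mkcond; apply: ae_eq_integral => //.
- by apply/(measurable_restrictT _ mD); apply: measurable_funTS; exact: emeasurable_funM.
- by apply: emeasurable_funM; [exact: emeasurable_funM|exact: measurableT_comp].
by apply: filterS v_ae => x vx _; rewrite epatch_indic vx muleAC.
Qed.

Lemma wmeasure_density (D : set (Rn R n)) : measurable D -> wmeasure mu v D = nu D.
Proof.
move=> mD; apply: ae_eq_integral => //; try exact: measurable_funTS.
  by apply: measurable_funTS; exact: measurableT_comp.
by apply: filterS v_ae => x -> _.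
Qed.

(** A null set for [v dx] is Lebesgue null because [v] is positive almost
    everywhere. *)
Lemma ae_density (P : Rn R n -> Prop) : (\forall x \ae nu, P x) -> \forall x \ae mu, P x.
Proof.
move=> [D [mD D0 DP]]; exists D; split => //.
apply: le_anti; rewrite measure_ge0 andbT leNgt; apply/negP => D_gt0.
have : 0 < nu D.
  apply: integral_gt0 => //; first exact: measurable_funTS.
  by apply: filterS wv.2 => x /andP[v0 _]; rewrite gt_eqF.
by rewrite D0 ltxx.
Qed.

Context {Nb : (measurableTypeR R -> \bar R) -> \bar R}.

Lemma weighted_norm_density f : measurable_fun setT f -> weighted_norm mu Nb v f = rnorm Nb nu f.
Proof.
move=> mf; congr (Nb _); apply/funext => t; rewrite /rearrangement.
have E r : distribution (wmeasure mu v) f r = distribution nu f r.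
  by rewrite /distribution wmeasure_density//; exact: measurable_superlevel.
congr (ereal_inf (_ @` _)); apply/seteqP; split => r /=; by rewrite E.
Qed.

Lemma associate_norm_density f : measurable_fun setT f ->
  associate_norm mu v (weighted_norm mu Nb v) f = assoc Nb nu f.
Proof.
move=> mf.
have E g : measurable_fun setT g -> \int[mu]_x (`|f x * g x| * v x) = \int[nu]_x `|f x * g x|.
  move=> mg; apply: (@integral_weight setT (fun x => `|f x * g x|)) => //.
  by apply: measurableT_comp => //; exact: emeasurable_funM.
congr ereal_sup; apply/seteqP; split => _ [g [mg g1] <-]; exists g; rewrite ?E//;
  by split => //; move: g1; rewrite weighted_norm_density.
Qed.

Lemma wmaximal_density f : measurable_fun setT f -> wmaximal v f = cube_maximal nu f.
Proof.
move=> mf; apply/funext => x; rewrite /wmaximal /cube_maximal.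
have E Q : cubes Q -> (wmeasure mu v Q)^-1 * \int[mu]_(y in Q) (`|f y| * v y) =
    (nu Q)^-1 * \int[nu]_(y in Q) `|f y|.
  move=> cQ; have mQ := measurable_cubes cQ.
  rewrite wmeasure_density// (@integral_weight Q (fun y => `|f y|))//.
  exact: measurableT_comp.
by congr ereal_sup; apply/seteqP; split => _ [Q [cQ Qx] <-]; exists Q => //; rewrite E.
Qed.

End weighted_measure.

Lemma A1_constant_le {R : realType} {n : nat} (w : Rn R n -> \bar R) (c : R) :
  is_weight (lebesgueRn R n) w -> A1_bound w c -> A1_constant w <= c%:E.
Proof.
move=> [_ w0] wc; apply/ess_supP; apply: filterS2 w0 wc => x /andP[].
case: (w x) => [r| |]// r0 _ wr; rewrite inver gt_eqF// muleC lee_pdivrMl//.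
by rewrite muleC.
Qed.

Lemma fine_le_real {R : realType} (x : \bar R) (c : R) : (0 <= c)%R -> x <= c%:E -> (fine x <= c)%R.
Proof. by case: x. Qed.

Lemma rnorm_indic_gt0 {R : realType} (Nb : (measurableTypeR R -> \bar R) -> \bar R)
    {d} {T : measurableType d} (m : {measure set T -> \bar R}) (D : set T) :
  ri_function_norm (lebesgue_half R) Nb -> measurable D -> 0 < m D ->
  0 < rnorm Nb m (EFin \o \1_D).
Proof.
move=> riN mD D0; rewrite lt_neqAle rnorm_ge0// andbT eq_sym; apply/eqP => N0.
have mr := measurable_rearrangement m (EFin \o \1_D).
have m1 : measurable_fun setT (EFin \o \1_D : T -> \bar R).
  by apply/measurable_EFinP; exact: measurable_indic.
have [S [mS S0 SP]] := (fnorm_eq0 riN.1 mr).1 N0.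
have := distribution_half_rearrangement m m1 (lexx 0%R).
have -> : distribution m (EFin \o \1_D) 0%R = m D.
  congr (m _); apply/seteqP; split => x; rewrite /= indicE lte_fin.
    by have [/set_mem//|_] := boolP (x \in D); rewrite normr0 ltxx.
  by move=> Dx; rewrite mem_set// normr1.
suff : distribution (lebesgue_half R) (rearrangement m (EFin \o \1_D)) 0%R <= 0.
  by move=> + E; rewrite E leNgt D0.
rewrite -S0; apply: le_measure; rewrite ?inE//; first exact: measurable_superlevel.
by move=> x /= x0; apply: SP => /= rx; move: x0; rewrite rx abse0 ltxx.
Qed.

Section extrapolation.
Context {R : realType} {n : nat}.
Local Notation mu := (lebesgueRn R n).
Context {Nb : (measurableTypeR R -> \bar R) -> \bar R}.
Hypotheses (riN : ri_function_norm (lebesgue_half R) Nb) (boyd : upper_boyd_index Nb < +oo).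
Context {v : Rn R n -> \bar R}.
Hypothesis v1 : muckenhoupt 1 v.

Let wv : is_weight mu v := v1.1.
Let mv : measurable_fun setT v := wv.1.
Local Notation nu := (density mu mv).
Let cv := fine (A1_constant v).
Let vc : A1_bound v cv := A1_bound_constant v1.
Let nu_gt0 Q : cubes Q -> 0 < nu Q := fun cQ => weight_integral_gt0 wv cQ.
Let nu_fin Q : cubes Q -> nu Q < +oo := fun cQ => weight_integral_lty wv vc cQ.
Let mbox k : measurable (box k : set (Rn R n)).
Proof. exact: measurable_cube. Qed.
Let box_fin k : nu (box k) < +oo. Proof. by apply: nu_fin; exact: cubes_box. Qed.

Lemma wmaximal_norm_density : wmaximal_norm Nb v =
  ereal_sup [set assoc Nb nu (cube_maximal nu f) | f in
    [set f : Rn R n -> \bar R | measurable_fun setT f /\ assoc Nb nu f <= 1]].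
Proof.
have mM f : measurable_fun setT (cube_maximal nu f) by exact: measurable_cube_maximal.
rewrite /wmaximal_norm; congr ereal_sup.
apply/seteqP; split => _ [f [mf f1] <-]; exists f;
  rewrite ?wmaximal_density ?(associate_norm_density wv mv)//.
  by split => //; rewrite -(associate_norm_density wv mv).
by split => //; rewrite (associate_norm_density wv mv).
Qed.

(** The maximal operator over cubes, with respect to [v dx], satisfies all
    hypotheses of [maximal_assoc_bounded]; the weak type bound uses that [v dx]
    is doubling. *)
Lemma wmaximal_norm_lty : wmaximal_norm Nb v < +oo.
Proof.
have cv1 := A1_bound_ge1 wv vc.
have C0 : (0 <= 3 ^+ n * cv)%R by rewrite mulr_ge0// ?exprn_ge0// (le_trans ler01).
have C1 : (1 <= 3 ^+ n * cv)%R.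
  by rewrite -[leLHS]mul1r ler_pM// -natrX ler1n expn_gt0.
have weak := cube_maximal_weak nu_gt0 nu_fin C0 (fun q q0 => A1_bound_doubling wv vc q0).
have [D HD] : exists D : R, forall f, measurable_fun setT f -> assoc Nb nu f <= 1 ->
    assoc Nb nu (cube_maximal nu f) <= D%:E.
  apply: (maximal_assoc_bounded riN mbox box_nondecreasing bigcup_box box_fin C1) => //.
  - exact: measurable_cube_maximal.
  - exact: cube_maximal_ge0 nu_gt0 nu_fin.
  - exact: cube_maximal_abse.
  - by move=> e K G x e0 nG; apply: (cube_maximal_layered nu_gt0 nu_fin).
  - by move=> A f mA Af; apply: (cube_maximal_increases nu_gt0 nu_fin).
  - by move=> E x mE; apply: (cube_maximal_indic_le1 nu_gt0 nu_fin).
rewrite wmaximal_norm_density; apply: (@le_lt_trans _ _ D%:E); last exact: ltry.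
by apply/ereal_supP => _ [f [mf f1] <-]; exact: HD.
Qed.

Let A := fine (wmaximal_norm Nb v).

Lemma wmaximal_norm_bound f : measurable_fun setT f -> assoc Nb nu f <= 1 ->
  assoc Nb nu (cube_maximal nu f) <= A%:E.
Proof.
move=> mf f1.
have ub : assoc Nb nu (cube_maximal nu f) <= wmaximal_norm Nb v.
  by rewrite wmaximal_norm_density; apply: ereal_sup_ubound; exists f.
have a0 : 0 <= assoc Nb nu (cube_maximal nu f).
  apply: le_trans (assoc_ge _ (g := cst 0) _ _).
  - by apply: integral_ge0 => x _; exact: abse_ge0.
  - exact: measurable_cst.
  - by rewrite rnorm0.
rewrite fineK// ge0_fin_numE; first exact: wmaximal_norm_lty.
exact: le_trans ub.
Qed.

(** The average of [H v] over [Q] is the average of [H] with respect to [v dx],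
    at most [M H <= 2 A H], times the average of [v], at most [cv v]. *)
Lemma majorant_A1 (H : Rn R n -> \bar R) : measurable_fun setT H -> (forall x, 0 < H x) ->
  (forall x, cube_maximal nu H x <= (2 * A)%:E * H x) ->
  (\forall x \ae nu, H x < +oo) ->
  is_weight mu (fun x => H x * `|v x|) /\ A1_bound (fun x => H x * `|v x|) (2 * A * cv).
Proof.
move=> mH H0 MH Hfin.
have mW : measurable_fun setT (fun x => H x * `|v x|).
  by apply: emeasurable_funM => //; exact: measurableT_comp.
split.
  split => //; have Hfin' := ae_density wv Hfin.
  apply: filterS2 wv.2 Hfin' => x /andP[v0 vy] Hx.
  rewrite gee0_abs ?(ltW v0)// mule_gt0//= lte_mul_pinfty ?(ltW (H0 x))//.
  by rewrite ge0_fin_numE// ltW.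
apply: filterS2 wv.2 (A1_bound_integral_le vc) => x /andP[v0 vy] Hx.
apply: (cube_maximal_le (@lebesgueRn_cubes_gt0 R n) (@lebesgueRn_cubes_lty R n)) => Q cQ Qx.
have mQ := measurable_cubes cQ; have H_ge0 y : 0 <= H y by exact: ltW.
have -> : \int[mu]_(y in Q) `|H y * `|v y| | = \int[nu]_(y in Q) H y.
  rewrite -(integral_weight wv mv mQ mH H_ge0); apply: ae_eq_integral => //.
  - by apply: measurable_funTS; apply: measurableT_comp.
  - by apply: measurable_funTS; exact: emeasurable_funM.
  apply: filterS wv.2 => y /andP[vy0 _] _.
  by rewrite gee0_abs ?mule_ge0// gee0_abs// ltW.
rewrite (eq_integral (fun y => `|H y|)); last by move=> y _; rewrite gee0_abs.
apply: le_trans (cube_maximal_integral_le nu_gt0 nu_fin H cQ Qx) _.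
apply: le_trans (lee_wpmul2l _ (MH x)) _; first exact: measure_ge0.
have AH0 : 0 <= (2 * A)%:E * H x by exact: le_trans (cube_maximal_ge0 nu_gt0 nu_fin H x) (MH x).
apply: le_trans (lee_wpmul2r AH0 (Hx Q cQ Qx)) _.
rewrite gee0_abs ?(ltW v0)// le_eqVlt; apply/orP; left; apply/eqP.
by rewrite -muleA muleACA -EFinM [v x * _]muleC [(cv * _)%R]mulrC.
Qed.

Context {p0 : R} {u : Rn R n -> \bar R}.
Hypotheses (p0_ge1 : (1 <= p0)%R) (wu : is_weight mu u) (u1 : admissible p0 u).

Let K : R := (2 * A * admissible_constant p0 u * cv)%R.

Lemma majorant_Ap (W : Rn R n -> \bar R) : is_weight mu W -> A1_bound W (2 * A * cv) ->
  (0 <= A)%R -> (forall x, 0 <= W x) ->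
  muckenhoupt p0 (fun x => `|u x| * `|W x|) /\
  (1 <= fine (Ap_constant p0 (fun x => `|u x| * `|W x|)%E) <= K)%R.
Proof.
move=> wW W1 A0 W0; set w := fun x => `|u x| * `|W x|.
have cv0 : (0 <= cv)%R by rewrite (le_trans ler01)// (A1_bound_ge1 wv vc).
have K0 : (0 <= 2 * A * cv)%R by rewrite !mulr_ge0.
have [p0E|p0E] := eqVneq p0 1%R.
  have KE : K = (2 * A * cv)%R by rewrite /K /admissible_constant p0E eqxx mulr1.
  have wE : w = W.
    have -> : w = fun x => `|W x|.
      by apply/funext => x; move: u1; rewrite /w /admissible p0E eqxx => ->; rewrite /= normr1 mul1e.
    by apply/funext => x; rewrite gee0_abs.
  rewrite wE KE p0E.
  have Wc : A1_constant W <= (2 * A * cv)%:E by exact: A1_constant_le.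
  have W_A1 : muckenhoupt 1 W.
    by split => //; rewrite /Ap_constant eqxx; apply: le_lt_trans Wc _; rewrite ltry.
  split => //; rewrite /Ap_constant eqxx fine_le_real// andbT.
  exact: A1_bound_ge1 wW (A1_bound_constant W_A1).
have p1 : (1 < p0)%R by rewrite lt_neqAle eq_sym p0E.
have s_A1 : muckenhoupt 1 (dual_weight p0 u) by move: u1; rewrite /admissible (negbTE p0E).
have s1 := A1_bound_ge1 s_A1.1 (A1_bound_constant s_A1).
have acE : admissible_constant p0 u = (fine (A1_constant (dual_weight p0 u)) `^ (p0 - 1))%R.
  by rewrite /admissible_constant (negbTE p0E).
have wc : Ap_constant p0 w <= K%:E.
  have := Ap_constant_product p1 wu s_A1.1 (A1_bound_constant s_A1) wW W1.
  suff -> : K = (fine (A1_constant (dual_weight p0 u)) `^ (p0 - 1) * (2 * A * cv))%R by [].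
  by rewrite /K acE; ring.
have ww : is_weight mu w.
  split; first by apply: emeasurable_funM; apply: measurableT_comp => //; [case: wu|case: wW].
  apply: filterS2 wu.2 wW.2 => x /andP[a0 a1] /andP[b0 b1].
  rewrite /w !gee0_abs ?(ltW a0) ?(ltW b0)// mule_gt0//= lte_mul_pinfty ?(ltW a0)//.
  by rewrite ge0_fin_numE// ltW.
have wge0 x : 0 <= w x by rewrite mule_ge0.
have w1 := Ap_constant_ge1 p1 ww wge0.
have wfin : Ap_constant p0 w \is a fin_num.
  by rewrite ge0_fin_numE ?(le_trans _ w1)// (le_lt_trans wc)// ltry.
split; first by split => //; rewrite -ge0_fin_numE// (le_trans _ w1).
by rewrite -!lee_fin fineK// w1.
Qed.

Lemma extrapolation_weight h : measurable_fun setT h -> (forall x, 0 <= h x) ->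
  assoc Nb nu h <= 1 -> 0 < \int[nu]_x h x ->
  exists H, [/\ measurable_fun setT H, forall x, 0 <= h x <= H x, assoc Nb nu H <= 2%:E,
    muckenhoupt p0 (fun x => `|u x| * `|H x * `|v x| |) &
    (1 <= fine (Ap_constant p0 (fun x => `|u x| * `|H x * `|v x| |)%E) <= K)%R].
Proof.
move=> mh h0 h1 hpos.
have [H [mH hH H0 H2 [A0 MH Hfin]]] := rubio_de_francia riN nu_gt0 nu_fin wmaximal_norm_bound mh h0 h1 hpos.
have [wW W1] := majorant_A1 mH H0 MH Hfin.
have W0 x : 0 <= H x * `|v x| by rewrite mule_ge0// ltW.
have [wA wK] := majorant_Ap wW W1 (ltW A0) W0.
by exists H; split => // x; rewrite h0 hH.
Qed.

(** An [A_p] constant of a weight constructed above lies between 1 and [K]; it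
    remains to see that some admissible [h] is not zero, and otherwise duality
    would give an indicator function of norm 0. *)
Lemma extrapolation_constant_ge1 : (1 <= K)%R.
Proof.
have [h [mh h0 h1 hpos]] : exists h, [/\ measurable_fun setT h, forall x, 0 <= h x,
    assoc Nb nu h <= 1 & 0 < \int[nu]_x h x].
  have := rnorm_indic_gt0 riN (mbox 0%N) (nu_gt0 (cubes_box 0%N)).
  apply: contraPP => /forallNP nh; apply/negP; rewrite -leNgt.
  have m1 : measurable_fun setT (EFin \o \1_(box 0) : Rn R n -> \bar R).
    by apply/measurable_EFinP; exact: measurable_indic.
  apply: (rnorm_le_associate riN mbox box_nondecreasing bigcup_box box_fin m1) => h mh h0 h1.
  have hz : \int[nu]_x h x <= 0.
    by rewrite leNgt; apply/negP => hpos; apply: (nh h).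
  apply: le_trans hz; apply: ge0_le_integral => //.
  - by move=> x _; rewrite mule_ge0.
  - by apply: emeasurable_funM => //; exact: measurableT_comp.
  - move=> x _; rewrite /= indicE -[leRHS]mul1e lee_wpmul2r//.
    by case: (_ \in _); rewrite ?normr1 ?normr0.
have [H [_ _ _ _ /andP[]]] := extrapolation_weight mh h0 h1 hpos.
exact: le_trans.
Qed.

(** Duality, with each [h] replaced by its Rubio de Francia majorant. *)
Theorem extrapolation_bound (Psi : R -> R) (f g : Rn R n -> \bar R) :
  measurable_fun setT f -> measurable_fun setT g ->
  (forall x : R, (1 <= x)%R -> (1 <= Psi x)%R) ->
  (forall x y : R, (1 <= x)%R -> (x <= y)%R -> (Psi x <= Psi y)%R) ->
  (forall w, muckenhoupt p0 w ->
    L1norm mu w f <= (Psi (fine (Ap_constant p0 w)))%:E * L1norm mu w g) ->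
  rnorm Nb nu (f \* u) <= (2 * Psi K)%:E * rnorm Nb nu (g \* u).
Proof.
move=> mf mg Psi1 Psi_mono fg.
have mu_ : measurable_fun setT u by case: wu.
have mfu : measurable_fun setT (f \* u) by exact: emeasurable_funM.
have mgu : measurable_fun setT (g \* u) by exact: emeasurable_funM.
have PK : (1 <= Psi K)%R by apply: Psi1; exact: extrapolation_constant_ge1.
have PK0 : (0 < Psi K)%R by exact: lt_le_trans PK.
have := rnorm_ge0 riN nu (g \* u).
case E : (rnorm Nb nu (g \* u)) => [b| |]// b0; last by rewrite gt0_muley ?leey// lte_fin mulr_gt0.
apply: (rnorm_le_associate riN mbox box_nondecreasing bigcup_box box_fin mfu) => h mh h0 h1.
(* The iteration needs a function that does not vanish. *)
have [hz|hpos] := leP (\int[nu]_x h x) 0.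
  have h_ae : \forall x \ae nu, h x = 0.
    have h_abs : \int[nu]_(x in setT) `|h x| = 0.
      apply: le_anti; rewrite integral_ge0// andbT; apply: le_trans hz.
      by rewrite le_eqVlt; apply/orP; left; apply/eqP; apply: eq_integral => x _; rewrite gee0_abs.
    by apply: filterS ((ae_eq_integral_abs nu measurableT mh).1 h_abs) => x; exact.
  have -> : \int[nu]_x (`|(f \* u) x| * h x) = \int[nu]_x cst 0 x.
    apply: ae_eq_integral => //.
    - by apply: emeasurable_funM => //; exact: measurableT_comp.
    - by apply: filterS h_ae => x -> _; rewrite mule0.
  by rewrite integral_cst// mul0e -EFinM lee_fin !mulr_ge0// ltW.
have [H [mH hH H2 wA /andP[w1 wK]]] := extrapolation_weight mh h0 h1 hpos.
set w := fun x => `|u x| * `|H x * `|v x| | in wA w1 wK.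
have H0 x : 0 <= H x by case/andP: (hH x) => /le_trans; exact.
have L1E k : measurable_fun setT k -> L1norm mu w k = \int[nu]_x `|H x * (k \* u) x|.
  move=> mk; rewrite integral_density; last 2 first.
  - by apply: measurableT_comp => //; apply: emeasurable_funM => //; exact: emeasurable_funM.
  - by move=> x; exact: abse_ge0.
  apply: eq_integral => x _; rewrite /w /= !abseM abse_id -!muleA.
  by rewrite [in LHS](muleCA `|u x|) [in LHS](muleCA `|k x|).
apply: (@le_trans _ _ (L1norm mu w f)).
  rewrite L1E//; apply: ge0_le_integral => //.
  - by move=> x _; rewrite mule_ge0.
  - by apply: emeasurable_funM => //; exact: measurableT_comp.
  - by apply: measurableT_comp => //; exact: emeasurable_funM.
  - by move=> x _; rewrite [leRHS]abseM [leRHS]muleC lee_wpmul2l// (gee0_abs (H0 x)); case/andP: (hH x).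
apply: le_trans (fg w wA) _.
have -> : (2 * Psi K)%:E * b%:E = (Psi K)%:E * (2 * b)%:E by rewrite -!EFinM; congr EFin; ring.
apply: lee_pmul.
- by rewrite lee_fin (le_trans ler01)// Psi1.
- by apply: integral_ge0 => x _; rewrite mule_ge0// mule_ge0.
- by rewrite lee_fin Psi_mono.
- by rewrite L1E//; apply: (hoelder_assoc riN) => //; rewrite E.
Qed.

End extrapolation.

Theorem theorem1p1 (R : realType) (n : nat)
    (F : set ((Rn R n -> \bar R) * (Rn R n -> \bar R)))
    (N : (Rn R n -> \bar R) -> \bar R)
    (Nbar : (measurableTypeR R -> \bar R) -> \bar R)
    (p0 : R) (Psi : R -> R) :
  (0 < n)%N ->
  extrapolation_pairs F ->
  ri_function_norm (lebesgueRn R n) N ->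
  ri_function_norm (lebesgue_half R) Nbar ->
  luxemburg_representation (lebesgueRn R n) N Nbar ->
  upper_boyd_index Nbar < +oo ->
  (1 <= p0)%R ->
  (forall x : R, (1 <= x)%R -> (1 <= Psi x)%R) ->
  (forall x y : R, (1 <= x)%R -> (x <= y)%R -> (Psi x <= Psi y)%R) ->
  (forall w : Rn R n -> \bar R, muckenhoupt p0 w ->
    forall f g, F (f, g) ->
      L1norm (lebesgueRn R n) w f <=
      (Psi (fine (Ap_constant p0 w)))%:E * L1norm (lebesgueRn R n) w g) ->
  forall u v : Rn R n -> \bar R,
    is_weight (lebesgueRn R n) u -> admissible p0 u -> muckenhoupt 1 v ->
    wmaximal_norm Nbar v < +oo /\
    forall f g, F (f, g) ->
      weighted_norm (lebesgueRn R n) Nbar v (f \* u) <=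
      (4 * Psi (2 * fine (wmaximal_norm Nbar v) * admissible_constant p0 u *
                fine (A1_constant v)))%:E *
      weighted_norm (lebesgueRn R n) Nbar v (g \* u).
Proof.
move=> _ pairs _ riN _ boyd p0_ge1 Psi1 Psi_mono FH u v wu u1 v1.
split=> [|f g Ffg]; first exact: wmaximal_norm_lty.
have [mf mg _ _] := pairs _ _ Ffg.
have wv : is_weight (lebesgueRn R n) v by case: v1.
have mu_ : measurable_fun setT u by case: wu.
rewrite !(weighted_norm_density wv wv.1); try exact: emeasurable_funM.
have := extrapolation_bound riN boyd v1 p0_ge1 wu u1 mf mg Psi1 Psi_mono (fun w wA => FH w wA f g Ffg).
move=> /le_trans; apply; rewrite lee_wpmul2r//; first exact: rnorm_ge0.
rewrite lee_fin ler_wpM2r ?ler_nat// (le_trans ler01)// Psi1//.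
exact: extrapolation_constant_ge1.
Qed.
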